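(* Let $a\in(0,1]$, $T>0$, and let $u\in C([0,T];\mathcal Z_{2,2})$ be a solution of the initial value problem $$\begin{cases} u_t+\mathcal H\partial_x^2u+D^{1+a}u+uu_x=0, & x\in\mathbb R,\ t>0,\\ u(x,0)=\phi(x).\end{cases}$$ If there exist three times $t_1<t_2<t_3$ in $[0,T]$ with $u(t_j)\in\mathcal Z_{5/2+a,5/2+a}$ for $j=1,2,3$, then there exists $\bar t$ with $t_1<\bar t<t_2$ such that $$u(x,t)=0\quad\text{for all } x\in\mathbb R \text{ and all } t\in[\bar t,T].$$
   Context: Functions $u(x,t)$ are real-valued. The Fourier transform is $\hat f(\xi)=\int_{\mathbb R}e^{-i\xi x}f(x)\,dx$. $\mathcal H$ is the Hilbert transform, $\widehat{\mathcal Hf}(\xi)=-i\,\mathrm{sgn}(\xi)\hat f(\xi)$, and $\widehat{D^{\alpha}f}(\xi)=|\xi|^{\alpha}\hat f(\xi)$. With $\langle x\rangle=(1+x^2)^{1/2}$, $\mathcal Z_{s,r}=H^s(\mathbb R)\cap L^2(\langle x\rangle^{2r}dx)$ with norm $\|f\|_{\mathcal Z_{s,r}}^2=\|f\|_{H^s}^2+\|\langle x\rangle^{r}f\|_{L^2}^2$. Solutions are understood in the sense of the integral equation $u(t)=U(t)\phi-\int_0^tU(t-\tau)\tfrac12\partial_x(u^2)(\tau)\,d\tau$, where $\widehat{U(t)\phi}(\xi)=e^{-it\xi|\xi|-t|\xi|^{1+a}}\hat\phi(\xi)$. *)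

(* Defs.v *)
From mathcomp Require Import all_boot all_order all_algebra.
From mathcomp Require Import all_classical all_reals all_analysis.
From mathcomp Require Import complex.

Set Implicit Arguments.
Unset Strict Implicit.
Unset Printing Implicit Defensive.

Import Order.TTheory GRing.Theory Num.Theory.
Import numFieldNormedType.Exports.

Local Open Scope classical_set_scope.
Local Open Scope ring_scope.
Local Open Scope complex_scope.

Definition japanese {R : realType} (x : R) : R := Num.sqrt (1 + x ^+ 2).

Definition expC {R : realType} (z : R[i]) : R[i] :=
  (expR (complex.Re z) * cos (complex.Im z))
    +i* (expR (complex.Re z) * sin (complex.Im z)).

Definition Cintegral {R : realType} (D : set R) (f : R -> R[i]) : R[i] :=
  Rintegral lebesgue_measure D (fun x => complex.Re (f x))
    +i* Rintegral lebesgue_measure D (fun x => complex.Im (f x)).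

(* The integral converges absolutely as soon as <x>^r f \in L^2 for some
   r > 1/2, where <x> is japanese x. *)
Definition fourier {R : realType} (f : R -> R) (xi : R) : R[i] :=
  Cintegral setT (fun x => expC (0 +i* (- (xi * x))) * (f x)%:C).

Definition inv_fourier {R : realType} (g : R -> R[i]) (x : R) : R[i] :=
  ((2 * pi)^-1)%:C * Cintegral setT (fun xi => expC (0 +i* (x * xi)) * g xi).

(* Integrand of the H^s norm, |<xi>^s \hat f(xi)|. *)
Definition sobolev_density {R : realType} (s : R) (f : R -> R) (xi : R) : R :=
  (japanese xi `^ s) * Normc.normc (fourier f xi).

Definition weighted {R : realType} (r : R) (f : R -> R) (x : R) : R :=
  (japanese x `^ r) * f x.

(* Membership in Z_{s,r} = H^s \cap L^2(<x>^{2r} dx) for s >= 0 and r > 1/2: in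
   this range Z_{s,r} is contained in L^1 and L^2, so that the integral
   defining fourier is the L^2 Fourier transform. *)
Definition Zspace {R : realType} (s r : R) (f : R -> R) : Prop :=
  [/\ f \in Lfun lebesgue_measure 2%:E,
      sobolev_density s f \in Lfun lebesgue_measure 2%:E
    & weighted r f \in Lfun lebesgue_measure 2%:E].

Definition Znorm {R : realType} (s r : R) (f : R -> R) : \bar R :=
  (('N[lebesgue_measure]_2%:E[EFin \o sobolev_density s f] ^+ 2
   + 'N[lebesgue_measure]_2%:E[EFin \o weighted r f] ^+ 2) `^ 2^-1)%E.

(* u \in C([0,T]; Z_{s,r}); u t is the function x |-> u(x,t). *)
Definition continuous_in_Z {R : realType} (T s r : R) (u : R -> R -> R) : Prop :=
  (forall t, t \in `[0, T] -> Zspace s r (u t)) /\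
  (forall t0, t0 \in `[0, T] ->
     Znorm s r (u t \- u t0) @[t --> within `[0, T] (nbhs t0)] --> 0%E).

(* The semigroup of u_t + H u_xx + D^{1+a} u = 0.  For t >= 0 and f in H^1 its
   Fourier transform is integrable, so that U a t f is given at every point by
   an absolutely convergent inversion integral. *)
Definition U {R : realType} (a t : R) (f : R -> R) : R -> R[i] :=
  inv_fourier (fun xi =>
    expC ((- (t * (`|xi| `^ (1 + a)))) +i* (- (t * (xi * `|xi|))))
      * fourier f xi).

(* u(t) = U(t) phi - \int_0^t U(t - tau) (1/2 d_x(u^2)(tau)) dtau on [0,T].
   Here u(t) is the continuous, hence C^1, representative of its class in H^2,
   so d_x is the classical derivative.  Since phi \in H^2 and
   d_x(u^2) \in C([0,T]; H^1), every term is a continuous function of x: the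
   identity in L^2 is the same as the pointwise one. *)
Definition mild_solution {R : realType} (a T : R) (phi : R -> R)
    (u : R -> R -> R) : Prop :=
  u 0 = phi /\
  forall t x, t \in `[0, T] ->
    (u t x)%:C =
      U a t phi x
      - Cintegral `[0, t] (fun tau =>
          U a (t - tau)
            (fun y => 2^-1 * derive1 (fun z => u tau z ^+ 2) y) x).

(* Main.v *)
Require Import Defs.
From mathcomp Require Import all_boot all_order all_algebra.
From mathcomp Require Import all_classical all_reals all_analysis.
From mathcomp Require Import complex measurable_realfun ring lra.

Set Implicit Arguments.
Unset Strict Implicit.
Unset Printing Implicit Defensive.

Import Order.TTheory GRing.Theory Num.Theory.
Import numFieldNormedType.Exports.

Local Open Scope classical_set_scope.
Local Open Scope ring_scope.

(** The proof takes place on the Fourier side, where the real transforms [ct]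
    and [st] represent the Fourier transform of a real function as [ct - i st].

    At a fixed frequency [xi] the mild equation is Duhamel's formula
    ([duhamel_fourier]), so that the transforms satisfy
      [d/dt ct = - (|xi|^(1+a) ct + xi |xi| st + FA)],
      [d/dt st = - (|xi|^(1+a) st - xi |xi| ct + FB)]
    in integrated form ([ct_increment], [st_increment]), with [FA - i FB] the
    transform of [u u_x].  At zero frequency the first equation says that the
    mean of [u] is conserved; to first order the second one says that the
    moment, the integral of [x u], grows at the rate of half the energy
    ([mass_conserved], [moment_increment]).

    The symbols [|xi|^(1+a)] and [xi |xi|] are not smooth at the origin, whereas
    a weight of exponent [5/2 + a] makes the transform as regular as [2 + a]
    derivatives would: combinations of its values at [4 xi], [2 xi] and [xi]
    that annihilate the low Taylor coefficients are of smaller order than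
    [xi^(2+a)] ([weighted_little_o]).  If [u] has this decay at two times
    [s < t], then so must the combination of the rates, integrated over
    [[s, t]].  But there the dispersion contributes the mean of [u] at the order
    [xi^2], which therefore vanishes ([tight_mean_zero]); after that the damping
    contributes the moment at the order [xi^(2+a)].  Hence the moment has
    integral zero over [[s, t]] ([tight_moment]).  For [a = 1] the damping is
    smooth, and the moment is seen through the dispersion instead, in the
    cosine transform at the order [xi^3].

    With three times the nondecreasing moment has integral zero over two
    consecutive intervals; so it vanishes on the first one, and with it the
    energy at some time of it ([extinction_time]).  The solution stays zero
    afterwards by Gronwall's inequality for the integral of the modulus of the
    Fourier transform, a norm that the flow contracts and in which Young's
    inequality bounds the nonlinearity ([dsqr_conv], [forward_uniqueness]).

    Elements of the function space enter as [profile], continuous functions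
    for which Fourier inversion holds pointwise, and the solution as
    [trajectory], a bounded continuous curve of profiles. *)

(** * Integrable real functions on the line *)

Section IntegrationKit.
Context {R : realType}.
Notation mu := (@lebesgue_measure R).
Implicit Types f g h : R -> R.

Definition L1 f := mu.-integrable setT (EFin \o f).

Lemma L1_measurable f : L1 f -> measurable_fun setT f.
Proof. by move/(measurable_int mu)/measurable_EFinP. Qed.

Lemma L1_dom f g : measurable_fun setT f -> (forall x, `|f x| <= g x) ->
  L1 g -> L1 f.
Proof.
move=> mf fg; apply: le_integrable => //; first exact/measurable_EFinP.
by move=> x _ /=; rewrite lee_fin (le_trans (fg x))// ler_norm.
Qed.

Lemma L1_norm f : L1 f -> L1 (fun x => `|f x|).
Proof. by move=> ?; exact: integrable_norm. Qed.

Lemma L1D f g : L1 f -> L1 g -> L1 (fun x => f x + g x).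
Proof. by move=> lf lg; have := integrableD measurableT lf lg. Qed.

Lemma L1N f : L1 f -> L1 (fun x => - f x).
Proof. by move=> lf; exact: (integrableN lf). Qed.

Lemma L1B f g : L1 f -> L1 g -> L1 (fun x => f x - g x).
Proof. by move=> lf lg; apply: L1D => //; exact: L1N. Qed.

Lemma L1Z (c : R) f : L1 f -> L1 (fun x => c * f x).
Proof. by move=> lf; have := integrableZl measurableT c lf. Qed.

Lemma L1Mb f (b : R -> R) (c : R) : L1 f -> measurable_fun setT b -> (forall x, `|b x| <= c) ->
  L1 (fun x => f x * b x).
Proof.
move=> lf mb bc; apply: (@L1_dom _ (fun x => c * `|f x|)).
- by apply: measurable_funM => //; exact: L1_measurable.
- by move=> x; rewrite normrM mulrC ler_wpM2r.
- exact/L1Z/L1_norm.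
Qed.

Lemma RintZ (c : R) f : L1 f -> \int[mu]_x (c * f x) = c * \int[mu]_x f x.
Proof. exact: RintegralZl. Qed.

Lemma RintD f g : L1 f -> L1 g ->
  \int[mu]_x (f x + g x) = \int[mu]_x f x + \int[mu]_x g x.
Proof. exact: RintegralD. Qed.

Lemma RintB f g : L1 f -> L1 g ->
  \int[mu]_x (f x - g x) = \int[mu]_x f x - \int[mu]_x g x.
Proof. exact: RintegralB. Qed.

Lemma Rint_le f g : L1 f -> L1 g -> (forall x, f x <= g x) ->
  \int[mu]_x f x <= \int[mu]_x g x.
Proof. by move=> lf lg fg; apply: le_Rintegral. Qed.

Lemma Rint_normle f g : L1 f -> L1 g -> (forall x, `|f x| <= g x) ->
  `|\int[mu]_x f x| <= \int[mu]_x g x.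
Proof.
move=> lf lg fg; apply: (le_trans (le_normr_Rintegral _ lf)) => //.
by apply: le_Rintegral => //; exact: L1_norm.
Qed.

Lemma L1E f : L1 f -> (\int[mu]_x (f x)%:E = (\int[mu]_x f x)%:E)%E.
Proof. by move=> lf; rewrite /Rintegral fineK//; exact: integrable_fin_num. Qed.

Lemma L1_ge0 f c : measurable_fun setT f -> (forall x, 0 <= f x) ->
  (\int[mu]_x (f x)%:E <= c%:E)%E -> L1 f /\ \int[mu]_x f x <= c.
Proof.
move=> mf f0 fc; have lf : L1 f.
  apply/integrableP; split; first exact/measurable_EFinP.
  apply: le_lt_trans (ltry c); apply: le_trans fc.
  apply: ge0_le_integral => //; first exact/measurableT_comp/measurable_EFinP.
    exact/measurable_EFinP.
  by move=> x _ /=; rewrite lee_fin ger0_norm.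
by split=> //; rewrite -lee_fin -L1E.
Qed.

Lemma FubiniR (h : R * R -> R) :
  (mu \x mu)%E.-integrable setT (EFin \o h) ->
  (forall x, L1 (fun y => h (x, y))) -> (forall y, L1 (fun x => h (x, y))) ->
  \int[mu]_x \int[mu]_y h (x, y) = \int[mu]_y \int[mu]_x h (x, y).
Proof.
move=> ih l1 l2; rewrite /Rintegral; congr fine.
have := Fubini ih; rewrite /=.
under eq_integral do rewrite L1E//.
by under [X in _ = X -> _]eq_integral do rewrite L1E//.
Qed.

Lemma prod_integrable_dom (h : R * R -> R) f g :
  measurable_fun setT h -> L1 f -> L1 g ->
  (forall x y, `|h (x, y)| <= f x * g y) ->
  (mu \x mu)%E.-integrable setT (EFin \o h).
Proof.
move=> mh lf lg hfg; apply/integrable12ltyP; first exact/measurable_EFinP.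
apply: (@le_lt_trans _ _ (\int[mu]_x (`|f x| * \int[mu]_y `|g y|)%:E)%E).
  apply: ge0_le_integral => //=.
  - by move=> x _; exact: integral_ge0.
  - apply: (@measurable_fun_fubini_tonelli_F _ _ _ _ _ mu (fun z => `|(EFin \o h) z|%E)) => //=.
    by apply/measurable_EFinP; apply: measurableT_comp.
  - apply/measurable_EFinP; apply: measurable_funM => //.
    by apply: (L1_measurable (L1_norm _)).
  move=> x _; rewrite EFinM -(L1E (L1_norm lg)) -integralZl//; last exact: L1_norm.
  apply: ge0_le_integral => //=.
  - apply/measurable_EFinP; apply: measurableT_comp => //.
    exact: (measurable_fun_pair2 x mh).
  - by apply/measurable_EFinP; apply: measurable_funM => //; apply: (L1_measurable (L1_norm _)).
  - move=> y _; rewrite -EFinM lee_fin (le_trans (hfg x y))//.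
    by rewrite -normrM ler_norm.
have l : L1 (fun x => (\int[mu]_y `|g y|) * `|f x|) by exact/L1Z/L1_norm.
under eq_integral do rewrite mulrC.
by rewrite (L1E l) ltry.
Qed.

End IntegrationKit.

(** * Elementary calculus *)

Section Calculus.
Context {R : realType}.
Notation mu := (@lebesgue_measure R).
Implicit Types (f g : R -> R) (x y : R).

Lemma is_derive_mul f g x df dg : is_derive x 1 f df -> is_derive x 1 g dg ->
  is_derive x 1 (fun y => f y * g y) (f x * dg + g x * df).
Proof. by move=> *; exact: is_deriveM. Qed.

Lemma is_derive_add f g x df dg : is_derive x 1 f df -> is_derive x 1 g dg ->
  is_derive x 1 (fun y => f y + g y) (df + dg).
Proof. by move=> *; exact: is_deriveD. Qed.

Lemma is_derive_sub f g x df dg : is_derive x 1 f df -> is_derive x 1 g dg ->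
  is_derive x 1 (fun y => f y - g y) (df - dg).
Proof. by move=> *; exact: is_deriveB. Qed.

Lemma is_derive_scale (c : R) f x df : is_derive x 1 f df ->
  is_derive x 1 (fun y => c * f y) (c * df).
Proof. by move=> *; exact: is_deriveZ. Qed.

Lemma is_derive_affine (c b x : R) : is_derive x 1 (fun y => c * y + b) c.
Proof.
have h := is_derive_add (is_derive_scale c (is_derive_id x 1)) (is_derive_cst b x 1).
by apply: is_derive_eq h _; rewrite mulr1 addr0.
Qed.

Lemma is_derive_comp_affine f (c b x df : R) : is_derive (c * x + b) 1 f df ->
  is_derive x 1 (fun y => f (c * y + b)) (c * df).
Proof.
move=> fd; have := @is_derive1_comp R f (fun y => c * y + b) x df c fd (is_derive_affine c b x).
by rewrite mulrC.
Qed.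

Lemma is_derive_comp_scale f (c x df : R) : is_derive (c * x) 1 f df ->
  is_derive x 1 (fun y => f (c * y)) (c * df).
Proof.
rewrite -[c * x]addr0 => /is_derive_comp_affine.
by under eq_fun do rewrite addr0.
Qed.

Lemma is_derive_continuous f x df : is_derive x 1 f df -> {for x, continuous f}.
Proof. by move=> h; apply/differentiable_continuous/derivable1_diffP/ex_derive. Qed.

Lemma derive1_is f x df : is_derive x 1 f df -> derive1 f x = df.
Proof. by move=> h; rewrite derive1E; exact: derive_val. Qed.

Lemma continuous_mul f g : continuous f -> continuous g ->
  continuous (fun x => f x * g x).
Proof. by move=> cf cg x; apply: (@continuousM _ R^o f g); [exact: cf|exact: cg]. Qed.

Lemma continuous_add f g : continuous f -> continuous g ->
  continuous (fun x => f x + g x).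
Proof. by move=> cf cg x; apply: (@continuousD _ R^o R f g); [exact: cf|exact: cg]. Qed.

Lemma continuous_opp f : continuous f -> continuous (fun x => - f x).
Proof. by move=> cf x; apply: (@continuousN _ R^o R f); exact: cf. Qed.

Lemma continuous_sub f g : continuous f -> continuous g ->
  continuous (fun x => f x - g x).
Proof. by move=> cf cg; apply: continuous_add => //; exact: continuous_opp. Qed.

Lemma continuous_cst (c : R) : continuous (fun _ : R => c).
Proof. by move=> x; exact: cst_continuous. Qed.

Lemma continuous_abs f : continuous f -> continuous (fun x => `|f x|).
Proof. by move=> cf x; apply: continuous_comp; [exact: cf|exact: norm_continuous]. Qed.

(** The integral of a nonnegative function is invariant under increasing affine
    changes of variable; this is where translations and dilations of
    Lebesgue measure enter. *)
Lemma Rint_affine f (p b : R) : 0 < p -> continuous f -> (forall x, 0 <= f x) ->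
  L1 f -> L1 (fun x => f (p * x + b)) /\
  \int[mu]_x f (p * x + b) = p^-1 * \int[mu]_x f x.
Proof.
move=> p0 cf f0 lf.
have dF x : is_derive x 1 (fun y => p * y + b) p by exact: is_derive_affine.
have F1 : derive1 (fun y => p * y + b) = cst p by apply/funext => x; rewrite (derive1_is (dF x)).
have cg : continuous (fun x => f (p * x + b)).
  move=> x; apply: continuous_comp; last exact: cf.
  exact: is_derive_continuous (dF x).
have e := @increasing_ge0_integration_by_substitutionT R (fun y => p * y + b) f.
have {e}e : (\int[mu]_x (f (p * x + b) * p)%:E)%E = (\int[mu]_x (f x)%:E)%E.
  rewrite e ?F1//.
  - by move=> x y xy; rewrite ltrD2r ltr_pM2l.
  - by move=> x; exact: cst_continuous.
  - exact: is_cvg_cst.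
  - exact: is_cvg_cst.
  - apply/cvgrNyPle => A; near=> x.
    by rewrite -lerBrDr -ler_pdivlMl//; near: x; exact: nbhs_ninfty_le.
  - apply/cvgryPge => A; near=> x.
    by rewrite -lerBlDr -ler_pdivrMl//; near: x; exact: nbhs_pinfty_ge.
have m : measurable_fun setT (fun x => f (p * x + b)) by exact: continuous_measurable_fun.
have l : L1 (fun x => p * f (p * x + b)).
  have [] // := @L1_ge0 R (fun x => p * f (p * x + b)) (\int[mu]_x f x).
  - exact: measurable_funM.
  - by move=> x; rewrite mulr_ge0// ltW.
  - by rewrite -L1E// -e; under eq_integral do rewrite mulrC.
have l' : L1 (fun x => f (p * x + b)).
  have := L1Z p^-1 l; congr L1; apply/funext => x.
  by rewrite mulrA mulVf ?mul1r// gt_eqF.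
split => //.
have -> : \int[mu]_x f x = \int[mu]_x (p * f (p * x + b)).
  by rewrite /Rintegral -e; congr fine; apply: eq_integral => x _; rewrite mulrC.
by rewrite RintegralZl// mulrA mulVf ?mul1r// gt_eqF.
Unshelve. all: by end_near. Qed.

Lemma Rint_shift f b : continuous f -> (forall x, 0 <= f x) -> L1 f ->
  L1 (fun x => f (x + b)) /\ \int[mu]_x f (x + b) = \int[mu]_x f x.
Proof.
move=> cf f0 lf; have := Rint_affine b ltr01 cf f0 lf.
by under eq_fun do rewrite mul1r; rewrite invr1 mul1r.
Qed.

Lemma norm_sin_le x : `|sin x| <= `|x|.
Proof.
wlog x0 : x / 0 <= x.
  move=> h; have [|x0] := leP 0 x; first exact: h.
  by rewrite -normrN -sinN -[`|x|]normrN; apply: h; rewrite oppr_ge0 ltW.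
have [|c _] := @MVT_segment R sin cos 0 x x0.
  by apply: continuous_subspaceT => y; exact: continuous_sin.
 rewrite sin0 !subr0 => ->.
by rewrite normrM ler_piMl// ler_norml cos_le1 cos_geN1.
Qed.

Lemma one_minus_cosE x : 1 - cos x = 2 * sin (x / 2) ^+ 2.
Proof.
rewrite {1}(_ : x = x / 2 + x / 2); last by rewrite -splitr.
by rewrite cosD -!expr2 -{1}(cos2Dsin2 (x / 2)); ring.
Qed.

Lemma one_minus_cos_ge0 x : 0 <= 1 - cos x.
Proof. by rewrite subr_ge0 cos_le1. Qed.

Lemma one_minus_cos_le x : 1 - cos x <= x ^+ 2 / 2.
Proof.
rewrite one_minus_cosE; have := norm_sin_le (x / 2).
rewrite -(ler_pXn2r (n := 2))// ?nnegrE// !real_normK ?num_real//.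
by rewrite exprMn exprVn; lra.
Qed.

Lemma one_minus_cos_le1 x : 1 - cos x <= `|x|.
Proof.
have := one_minus_cos_le x; have := cos_geN1 x.
have [h|h] := leP `|x| 2; last by lra.
rewrite -real_normK ?num_real// => _ h1; apply: (le_trans h1).
by rewrite ler_pdivrMr// expr2 ler_wpM2l.
Qed.

Lemma norm_cos_le1 x : `|cos x| <= 1.
Proof. by rewrite ler_norml cos_geN1 cos_le1. Qed.

Lemma norm_sin_le1 x : `|sin x| <= 1.
Proof. by rewrite ler_norml sin_geN1 sin_le1. Qed.

End Calculus.

(** * Cauchy and Poisson kernels *)

Section Kernels.
Context {R : realType}.
Notation mu := (@lebesgue_measure R).
Implicit Types (f g : R -> R) (x y eps : R).

Definition cauchy x : R := (1 + x ^+ 2)^-1.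

Lemma cauchy_gt0 x : 0 < cauchy x.
Proof. by rewrite invr_gt0 ltr_wpDr// sqr_ge0. Qed.

Lemma continuous_cauchy : continuous cauchy.
Proof.
move=> x; apply: (@continuousV _ _ (fun x : R => 1 + x ^+ 2)).
  by rewrite gt_eqF// ltr_wpDr// sqr_ge0.
apply: continuousD; first exact: cst_continuous.
exact: exprn_continuous.
Qed.

Lemma ge0_integral_halves f : continuous f -> (forall x, 0 <= f x) ->
  (\int[mu]_x (f x)%:E =
   \int[mu]_(x in `[0%R, +oo[) (f (- x))%:E + \int[mu]_(x in `[0%R, +oo[) (f x)%:E)%E.
Proof.
move=> cf f0.
have mf : measurable_fun setT (EFin \o f).
  by apply/measurable_EFinP; exact: continuous_measurable_fun.
have -> : [set: R] = `]-oo, 0] `|` `]0, +oo[.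
  by apply/seteqP; split=> x //= _; rewrite !in_itv/= andbT; have [|] := leP x 0; [left|right].
rewrite ge0_integral_setU//=.
- congr (_ + _)%E.
    rewrite -{1}(oppr0 R) ge0_integration_by_substitutionNy//.
    exact: continuous_subspaceT.
  by rewrite integral_itv_obnd_cbnd//; exact: measurable_funS mf.
- exact: measurable_funS mf.
- by move=> x _; rewrite lee_fin.
- by apply/disj_setPS => x /=; rewrite !in_itv/= andbT => -[/le_lt_trans h /h]; rewrite ltxx.
Qed.

(** Lebesgue measure is invariant under reflection, so odd functions have
    integral zero; [g] serves to stay within nonnegative integrands. *)
Lemma Rint_odd h g : continuous h -> continuous g -> L1 g ->
  (forall x, `|h x| <= g x) -> (forall x, h (- x) = - h x) ->
  (forall x, g (- x) = g x) -> \int[mu]_x h x = 0.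
Proof.
move=> ch cg lg hg oh eg.
have lh : L1 h by apply: L1_dom hg lg; exact: continuous_measurable_fun.
have p x : 0 <= g x + h x.
  by have := hg x; rewrite ler_norml => /andP[+ _]; rewrite -subr_ge0 opprK addrC.
have n x : 0 <= g x - h x.
  by have := hg x; rewrite ler_norml => /andP[_ +]; rewrite subr_ge0.
have e : \int[mu]_x (g x + h x) = \int[mu]_x (g x - h x).
  rewrite /Rintegral; congr fine.
  rewrite (ge0_integral_halves (f := fun x => g x + h x))//; last first.
    by move=> x; apply: continuousD; [exact: cg|exact: ch].
  rewrite (ge0_integral_halves (f := fun x => g x - h x))//; last first.
    by move=> x; apply: continuousB; [exact: cg|exact: ch].
  rewrite addeC; congr (_ + _)%E; apply: eq_integral => x _.
    by rewrite oh eg opprK.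
  by rewrite oh eg.
by move: e; rewrite RintegralD// RintegralB//; lra.
Qed.

Lemma cauchy_int : L1 cauchy /\ \int[mu]_x cauchy x = pi.
Proof.
have e : (\int[mu]_x (cauchy x)%:E)%E = pi%:E.
  rewrite ge0_integral_halves//; [|exact: continuous_cauchy|by move=> x; apply: ltW; apply: cauchy_gt0].
  have -> : (\int[mu]_(x in `[0%R, +oo[) (cauchy (- x))%:E = \int[mu]_(x in `[0%R, +oo[) (cauchy x)%:E)%E.
    by apply: eq_integral => x _; rewrite /cauchy sqrrN.
  rewrite (@ge0_continuous_FTC2y _ _ atan 0 (pi / 2)).
  - by rewrite atan0 -EFinB -EFinD subr0 -splitr.
  - by move=> x _; apply: ltW; apply: cauchy_gt0.
  - by apply: continuous_subspaceT; exact: continuous_cauchy.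
  - exact: cvgy_atan.
  - by move=> x _; exact: derivable_atan.
  - by apply: cvg_at_right_filter; exact: continuous_atan.
  - by move=> x _; rewrite derive1_atan.
have m : measurable_fun setT cauchy by apply: continuous_measurable_fun; exact: continuous_cauchy.
split; last by rewrite /Rintegral e.
have [] // := @L1_ge0 R cauchy pi m; last by rewrite e.
by move=> x; apply: ltW; apply: cauchy_gt0.
Qed.

Definition poisson eps x : R := eps / (eps ^+ 2 + x ^+ 2).

Lemma poissonE eps x : 0 < eps -> poisson eps x = eps^-1 * cauchy (eps^-1 * x).
Proof.
move=> e0; rewrite /poisson /cauchy exprMn exprVn.
have : eps ^+ 2 + x ^+ 2 != 0 by rewrite gt_eqF// ltr_wpDr ?sqr_ge0// exprn_gt0.
by move=> h; field; rewrite h gt_eqF.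
Qed.

Lemma poisson_ge0 eps x : 0 < eps -> 0 <= poisson eps x.
Proof. by move=> e0; rewrite divr_ge0 ?addr_ge0 ?sqr_ge0// ltW. Qed.

Lemma poisson_int eps y : 0 < eps -> L1 (fun x => poisson eps (x - y)) /\
  \int[mu]_x poisson eps (x - y) = pi.
Proof.
move=> e0; have [lc ic] := cauchy_int.
have ei : 0 < eps^-1 by rewrite invr_gt0.
have [l i] := Rint_affine (- (eps^-1 * y)) ei continuous_cauchy (fun x => ltW (cauchy_gt0 x)) lc.
have E : (fun x => poisson eps (x - y)) = (fun x => eps^-1 * cauchy (eps^-1 * x - eps^-1 * y)).
  by apply/funext => x; rewrite poissonE// mulrBr.
rewrite E RintegralZl// i ic invrK; split; first exact: L1Z.
by rewrite mulrA mulVf ?mul1r// gt_eqF.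
Qed.

End Kernels.

(** * The Fourier transform of the Laplace density *)

Section LaplaceKernel.
Context {R : realType}.
Notation mu := (@lebesgue_measure R).
Implicit Types (x y eps : R).

Definition laplace eps x : R := expR (- (eps * `|x|)).

Lemma laplace_ge0 eps x : 0 <= laplace eps x.
Proof. exact: expR_ge0. Qed.

Lemma continuous_laplace eps : continuous (laplace eps).
Proof.
move=> x; apply: continuous_comp; last exact: continuous_expR.
apply: continuousN; apply: (@continuousM _ R^o (fun=> eps) (fun x : R => `|x|)).
  exact: cst_continuous.
exact: norm_continuous.
Qed.

Lemma continuous_cosM y : continuous (fun x : R => cos (x * y)).
Proof.
move=> x; apply: continuous_comp; last exact: continuous_cos.
exact: mulrr_continuous.
Qed.

Lemma continuous_sinM y : continuous (fun x : R => sin (x * y)).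
Proof.
move=> x; apply: continuous_comp; last exact: continuous_sin.
exact: mulrr_continuous.
Qed.

Let G eps y x := expR (- eps * x) * (1 + cos (x * y)).
Let F eps y x := expR (- eps * x) *
  ((eps ^+ 2 + y ^+ 2)^-1 * (y * sin (y * x) - eps * cos (y * x)) - eps^-1).

Let den_gt0 eps y : 0 < eps -> 0 < eps ^+ 2 + y ^+ 2.
Proof. by move=> e0; rewrite ltr_wpDr ?sqr_ge0// exprn_gt0. Qed.

Let dF eps y x : 0 < eps -> is_derive x 1 (F eps y) (G eps y x).
Proof.
move=> e0.
have de := is_derive_comp_scale (is_derive_expR (- eps * x)).
have ds := is_derive_scale y (is_derive_comp_scale (is_derive_sin (y * x))).
have dc := is_derive_scale eps (is_derive_comp_scale (is_derive_cos (y * x))).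
have d := is_derive_mul de (is_derive_sub (is_derive_scale (eps ^+ 2 + y ^+ 2)^-1
  (is_derive_sub ds dc)) (is_derive_cst eps^-1 x 1)).
apply: is_derive_eq d _.
have h : eps ^+ 2 + y ^+ 2 != 0 by rewrite gt_eqF// den_gt0.
by rewrite /G [x * y]mulrC /cst /=; field; rewrite h gt_eqF.
Qed.

Let cvgF eps y : 0 < eps -> F eps y x @[x --> +oo] --> 0.
Proof.
move=> e0; set d := eps ^+ 2 + y ^+ 2; set C := d^-1 * (`|y| + eps) + eps^-1.
have d0 : 0 < d by exact: den_gt0.
have C0 : 0 < C.
  have : 0 <= d^-1 * (`|y| + eps) by apply: mulr_ge0; [rewrite invr_ge0 ltW|apply: addr_ge0 => //; exact: ltW].
  have : 0 < eps^-1 by rewrite invr_gt0.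
  by rewrite /C; lra.
apply/cvgrPdist_le => e e1; near=> x.
have x0 : 0 < x by near: x; exact: nbhs_pinfty_gt.
have xC : C / (eps * e) <= x by near: x; apply: nbhs_pinfty_ge; exact: num_real.
rewrite sub0r normrN /F -/d normrM (ger0_norm (expR_ge0 _)) mulNr expRN.
have ex : eps * x <= expR (eps * x).
  by have := expR_ge1Dx (eps * x); lra.
rewrite mulrC ler_pdivrMr; last exact: expR_gt0.
apply: (@le_trans _ _ C); last first.
  rewrite (le_trans _ (ler_wpM2l (ltW e1) ex))//.
  by move: xC; rewrite ler_pdivrMr ?mulr_gt0// => /le_trans; apply; rewrite mulrC -mulrA mulrCA.
rewrite (le_trans (ler_normB _ _))// lerD//; last by rewrite ger0_norm// invr_ge0 ltW.
have di : 0 <= d^-1 by rewrite invr_ge0 ltW.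
rewrite normrM (ger0_norm di) ler_wpM2l//.
rewrite (le_trans (ler_normB _ _))// !normrM lerD//.
  by rewrite ler_piMr// norm_sin_le1.
by rewrite (ger0_norm (ltW e0)) ler_piMr ?norm_cos_le1// ltW.
Unshelve. all: by end_near. Qed.

(** Adding 1 to the cosine makes the integrand nonnegative, as is needed for
    integrating a derivative over a half-line. *)
Let half eps y : 0 < eps ->
  (\int[mu]_(x in `[0%R, +oo[) (G eps y x)%:E = (eps^-1 + poisson eps y)%:E)%E.
Proof.
move=> e0; rewrite (@ge0_continuous_FTC2y _ _ (F eps y) 0 0).
- rewrite -EFinB sub0r /F !mulr0 expR0 sin0 cos0 mulr1 mulr0 mul1r sub0r opprB; congr EFin.
  by rewrite /poisson; field; rewrite gt_eqF ?den_gt0// gt_eqF.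
- move=> x _; rewrite /G. apply: mulr_ge0; first exact: expR_ge0.
  by have := cos_geN1 (x * y); lra.
- apply: continuous_subspaceT; apply: continuous_mul.
    move=> x; apply: continuous_comp; last exact: continuous_expR.
    exact: mulrl_continuous.
  by apply: continuous_add; [exact: continuous_cst|exact: continuous_cosM].
- exact: cvgF.
- by move=> x _; apply: ex_derive; exact: dF.
- by apply: cvg_at_right_filter; exact: is_derive_continuous (dF y 0 e0).
- by move=> x _; apply: derive1_is; exact: dF.
Qed.

Let whole eps y : 0 < eps -> L1 (fun x => laplace eps x * (1 + cos (x * y))) /\
  \int[mu]_x (laplace eps x * (1 + cos (x * y))) = 2 * (eps^-1 + poisson eps y).
Proof.
move=> e0; set g := fun x => laplace eps x * (1 + cos (x * y)).
have g0 x : 0 <= g x by rewrite mulr_ge0 ?laplace_ge0//; have := cos_geN1 (x * y); lra.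
have cg : continuous g.
  apply: continuous_mul; first exact: continuous_laplace.
  by apply: continuous_add; [exact: continuous_cst|exact: continuous_cosM].
have e : (\int[mu]_x (g x)%:E = (2 * (eps^-1 + poisson eps y))%:E)%E.
  rewrite (ge0_integral_halves cg g0) mulr2n mulrDl mul1r EFinD -(half y e0).
  congr (_ + _)%E; apply: eq_integral => x; rewrite inE/= in_itv/= andbT => x0.
    by rewrite /g /laplace /G mulNr cosN normrN ger0_norm// mulNr.
  by rewrite /g /laplace /G ger0_norm// mulNr.
split; last by rewrite /Rintegral e.
have [] // := @L1_ge0 R g (2 * (eps^-1 + poisson eps y)); last by rewrite e.
exact: continuous_measurable_fun.
Qed.

Lemma laplace_int eps : 0 < eps -> L1 (laplace eps) /\
  \int[mu]_x laplace eps x = 2 * eps^-1.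
Proof.
move=> e0; have [l i] := whole 0 e0.
have E : laplace eps = (fun x => 2^-1 * (laplace eps x * (1 + cos (x * 0)))).
  by apply/funext => x; rewrite mulr0 cos0; field.
split; first by rewrite E; exact: L1Z.
by rewrite E RintegralZl// i /poisson; field; rewrite gt_eqF//= expr0n addr0 gt_eqF// exprn_gt0.
Qed.

Lemma laplace_cos eps y : 0 < eps ->
  \int[mu]_x (laplace eps x * cos (x * y)) = 2 * poisson eps y.
Proof.
move=> e0; have [l i] := whole y e0; have [l1 i1] := laplace_int e0.
have -> : \int[mu]_x (laplace eps x * cos (x * y)) =
    \int[mu]_x (laplace eps x * (1 + cos (x * y)) - laplace eps x).
  by apply: eq_Rintegral => x _; ring.
by rewrite RintegralB// i i1; ring.
Qed.

Lemma laplace_trig eps (t : R -> R) : 0 < eps -> continuous t ->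
  (forall x, `|t x| <= 1) -> L1 (fun x => laplace eps x * t x).
Proof.
move=> e0 ct t1; apply: L1Mb t1; first by have [] := laplace_int e0.
exact: continuous_measurable_fun.
Qed.

End LaplaceKernel.

(** * The Poisson kernel as an approximate identity *)

Section ApproximateIdentity.
Context {R : realType}.
Notation mu := (@lebesgue_measure R).
Implicit Types (f g : R -> R) (x y z eps : R).

Lemma L1_poissonM g z eps : 0 < eps -> L1 g -> L1 (fun x => g x * poisson eps (x - z)).
Proof.
move=> e0 lg; apply: (@L1Mb _ _ _ eps^-1) => //.
  by apply: (L1_measurable (proj1 (poisson_int z e0))).
move=> x; rewrite ger0_norm ?poisson_ge0// /poisson.
rewrite ler_pdivrMr; last by rewrite ltr_pwDl ?exprn_gt0// sqr_ge0.
by rewrite expr2 mulrDr mulKf ?gt_eqF// lerDl mulr_ge0 ?sqr_ge0// invr_ge0 ltW.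
Qed.

(** The Poisson kernel is an approximate identity: away from [z] it is at most
    [eps] times a fixed integrable function. *)
Lemma poisson_bound g z (delta : R) : L1 g -> {for z, continuous g} -> 0 < delta ->
  exists K, forall eps, 0 < eps ->
    `|\int[mu]_x (g x * poisson eps (x - z)) - pi * g z| <= delta * pi + eps * K.
Proof.
move=> lg cg d0; have /cvgrPdist_le/(_ _ d0)[d /= dp dg] := cg.
have [lc ic] := @cauchy_int R.
have [ls i1] := Rint_shift (- z) continuous_cauchy (fun x => ltW (cauchy_gt0 x)) lc.
have lng := L1_norm lg.
pose c := 1 + (d ^+ 2)^-1.
have c0 : 0 <= c by rewrite addr_ge0// invr_ge0 sqr_ge0.
exists (c * (\int[mu]_x `|g x| + `|g z| * pi)) => eps e0.
have [lp ip] := poisson_int z e0.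
have -> : \int[mu]_x (g x * poisson eps (x - z)) - pi * g z =
    \int[mu]_x (g x * poisson eps (x - z) - g z * poisson eps (x - z)).
  rewrite RintegralB//; [|exact: L1_poissonM|exact: L1Z].
  by rewrite RintegralZl// ip mulrC.
have -> : delta * pi + eps * (c * (\int[mu]_x `|g x| + `|g z| * pi)) =
   \int[mu]_x (delta * poisson eps (x - z) +
      (eps * c) * (`|g x| + `|g z| * cauchy (x - z))).
  rewrite RintegralD//; [|exact: L1Z|by apply: L1Z; apply: L1D => //; exact: L1Z].
  rewrite RintegralZl// ip RintegralZl//; last by apply: L1D => //; exact: L1Z.
  by rewrite RintegralD//; [rewrite RintegralZl// i1 ic mulrA|exact: L1Z].
apply: Rint_normle.
- by apply: L1B; [exact: L1_poissonM|exact: L1Z].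
- by apply: L1D; apply: L1Z => //; apply: L1D => //; exact: L1Z.
move=> x; rewrite -mulrBl normrM (ger0_norm (poisson_ge0 _ e0)).
have cx : 0 <= cauchy (x - z) by apply: ltW; exact: cauchy_gt0.
have px : 0 <= poisson eps (x - z) by exact: poisson_ge0.
have [xd|xd] := ltP `|z - x| d.
  apply: ler_wpDr; first by rewrite mulr_ge0 ?addr_ge0 ?mulr_ge0// ltW.
  by rewrite ler_wpM2r// distrC; exact: dg.
apply: ler_wpDl; first by rewrite mulr_ge0// ltW.
have d2 : 0 < d ^+ 2 by rewrite exprn_gt0.
have dx : d ^+ 2 <= (x - z) ^+ 2.
  by rewrite -(real_normK (num_real (x - z))) (ler_pXn2r (n := 2))// ?nnegrE ?(ltW dp)// distrC.
have x2 : 0 < (x - z) ^+ 2 by exact: lt_le_trans dx.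
have e2 : 0 < eps ^+ 2 by rewrite exprn_gt0.
have s2 : 0 < eps ^+ 2 + (x - z) ^+ 2 by exact: addr_gt0.
have s1 : 0 < 1 + (x - z) ^+ 2 by exact: addr_gt0.
have p1 : poisson eps (x - z) <= eps * ((x - z) ^+ 2)^-1.
  by rewrite /poisson ler_wpM2l ?(ltW e0)// lef_pV2 ?posrE// lerDr ltW.
have p2 : ((x - z) ^+ 2)^-1 <= c.
  by rewrite (@le_trans _ _ (d ^+ 2)^-1)// ?lerDr// lef_pV2 ?posrE.
have p3 : ((x - z) ^+ 2)^-1 <= c * cauchy (x - z).
  by rewrite /cauchy ler_pdivlMr// mulrDr mulr1 mulVf ?gt_eqF// addrC lerD2l lef_pV2 ?posrE.
apply: (@le_trans _ _ ((`|g x| + `|g z|) * poisson eps (x - z))).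
  by rewrite ler_wpM2r//; exact: ler_normB.
have q1 : poisson eps (x - z) <= eps * c.
  by apply: (le_trans p1); rewrite ler_wpM2l// ltW.
have q2 : poisson eps (x - z) <= eps * c * cauchy (x - z).
  by rewrite -mulrA; apply: (le_trans p1); rewrite ler_wpM2l// ltW.
rewrite mulrDl mulrDr; apply: lerD; first by rewrite mulrC ler_wpM2r.
by rewrite [X in _ <= X]mulrCA ler_wpM2l.
Qed.

Lemma poisson_cvg g z : L1 g -> {for z, continuous g} ->
  \int[mu]_x (g x * poisson n.+1%:R^-1 (x - z)) @[n --> \oo] --> pi * g z.
Proof.
move=> lg cg; apply/cvgrPdist_le => e e0.
have p0 : 0 < (pi : R) by exact: pi_gt0.
have d0 : 0 < e / 2 / pi by rewrite !divr_gt0.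
have [K hK] := poisson_bound lg cg d0.
have k1 : 0 < `|K| + 1 by rewrite ltr_wpDl.
have ek : 0 < e / 2 / (`|K| + 1) by rewrite !divr_gt0.
near=> n; rewrite distrC.
apply: (le_trans (hK _ _)) => //.
rewrite divfK ?gt_eqF// -lerBrDl (_ : e - e / 2 = e / 2); last by field.
apply: (@le_trans _ _ (n.+1%:R^-1 * (`|K| + 1))).
  by rewrite ler_wpM2l// (le_trans (ler_norm K))// lerDl.
rewrite -ler_pdivlMr//; apply: ltW; near: n.
exact: (near_infty_natSinv_lt (PosNum ek)).
Unshelve. all: by end_near. Qed.

End ApproximateIdentity.

(** * Fourier inversion *)

Section FourierInversion.
Context {R : realType}.
Notation mu := (@lebesgue_measure R).
Implicit Types (f g : R -> R) (x y z xi eps : R).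

Lemma measurable_fst2 f : measurable_fun setT f ->
  measurable_fun setT (fun z : R * R => f z.1).
Proof. by move=> mf; apply: (measurableT_comp mf); exact: measurable_fst. Qed.

Lemma measurable_snd2 f : measurable_fun setT f ->
  measurable_fun setT (fun z : R * R => f z.2).
Proof. by move=> mf; apply: (measurableT_comp mf); exact: measurable_snd. Qed.

Lemma measurable_mul2 f : continuous f ->
  measurable_fun setT (fun z : R * R => f (z.1 * z.2)).
Proof.
move=> cf; apply: (measurableT_comp (continuous_measurable_fun cf)).
by apply: measurable_funM; [exact: measurable_fst|exact: measurable_snd].
Qed.

(** The Fourier transform of the real function [f] is [ct f - i st f]. *)
Definition ct f xi : R := \int[mu]_x (f x * cos (x * xi)).
Definition st f xi : R := \int[mu]_x (f x * sin (x * xi)).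

Lemma L1_cos f xi : L1 f -> L1 (fun x => f x * cos (x * xi)).
Proof.
move=> lf; apply: (L1Mb lf) => [|x]; last exact: norm_cos_le1.
by apply: continuous_measurable_fun; exact: continuous_cosM.
Qed.

Lemma L1_sin f xi : L1 f -> L1 (fun x => f x * sin (x * xi)).
Proof.
move=> lf; apply: (L1Mb lf) => [|x]; last exact: norm_sin_le1.
by apply: continuous_measurable_fun; exact: continuous_sinM.
Qed.

(** [synth A B] is, up to the factor 2 pi, the inverse Fourier transform of
    [A - i B] when [A] is even and [B] is odd. *)
Definition synth (A B : R -> R) x : R :=
  \int[mu]_xi (cos (x * xi) * A xi + sin (x * xi) * B xi).

Lemma L1_synth A B x : L1 A -> L1 B ->
  L1 (fun xi => cos (x * xi) * A xi + sin (x * xi) * B xi).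
Proof.
move=> lA lB; have := L1D (L1_cos x lA) (L1_sin x lB).
by congr L1; apply/funext => y; rewrite [x * y]mulrC [cos _ * _]mulrC [sin _ * _]mulrC.
Qed.

Let laplace_cos_cos eps a b : 0 < eps ->
  \int[mu]_x (laplace eps x * cos (x * a) * cos (x * b)) =
  poisson eps (b - a) + poisson eps (b + a).
Proof.
move=> e0; have lc y := laplace_trig e0 (@continuous_cosM R y) (fun x => norm_cos_le1 _).
rewrite (_ : poisson eps (b - a) + _ = 2^-1 * (2 * poisson eps (b - a) + 2 * poisson eps (b + a))); last by field.
rewrite -!laplace_cos// -(RintegralD _ (lc _) (lc _))// -RintegralZl//; last first.
  by apply: L1D; exact: lc.
by apply: eq_Rintegral => x _; rewrite (mulrBr x) (mulrDr x) cosB cosD; field.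
Qed.

Let laplace_sin_sin eps a b : 0 < eps ->
  \int[mu]_x (laplace eps x * sin (x * a) * sin (x * b)) =
  poisson eps (b - a) - poisson eps (b + a).
Proof.
move=> e0; have lc y := laplace_trig e0 (@continuous_cosM R y) (fun x => norm_cos_le1 _).
rewrite (_ : poisson eps (b - a) - _ = 2^-1 * (2 * poisson eps (b - a) - 2 * poisson eps (b + a))); last by field.
rewrite -!laplace_cos// -(RintegralB _ (lc _) (lc _))// -RintegralZl//; last first.
  by apply: L1B; exact: lc.
by apply: eq_Rintegral => x _; rewrite (mulrBr x) (mulrDr x) cosB cosD; field.
Qed.

Let laplace_cos_sin eps a b : 0 < eps ->
  \int[mu]_x (laplace eps x * cos (x * a) * sin (x * b)) = 0.
Proof.
move=> e0; have [ll _] := laplace_int e0.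
apply: (Rint_odd (g := laplace eps)) => //.
- apply: continuous_mul; last exact: continuous_sinM.
  by apply: continuous_mul; [exact: continuous_laplace|exact: continuous_cosM].
- exact: continuous_laplace.
- move=> x; rewrite !normrM ger0_norm ?laplace_ge0// -mulrA ler_piMr ?laplace_ge0//.
  by rewrite mulr_ile1// ?norm_cos_le1 ?norm_sin_le1.
- by move=> x; rewrite /laplace normrN !mulNr cosN sinN mulrN.
- by move=> x; rewrite /laplace normrN.
Qed.

(** Parseval's formula in its elementary form: the Fourier kernel can be
    integrated first in either variable. *)
Lemma synth_dual g A B : L1 g -> L1 A -> L1 B ->
  \int[mu]_x (g x * synth A B x) = \int[mu]_y (A y * ct g y + B y * st g y).
Proof.
move=> lg lA lB.
pose h (z : R * R) := g z.1 *
  (cos (z.1 * z.2) * A z.2 + sin (z.1 * z.2) * B z.2).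
have mh : measurable_fun setT h.
  apply: measurable_funM; first exact: (measurable_fst2 (L1_measurable lg)).
  apply: measurable_funD; apply: measurable_funM.
  - exact: (measurable_mul2 (@continuous_cos R)).
  - exact: (measurable_snd2 (L1_measurable lA)).
  - exact: (measurable_mul2 (@continuous_sin R)).
  - exact: (measurable_snd2 (L1_measurable lB)).
have E : \int[mu]_x \int[mu]_y h (x, y) = \int[mu]_y \int[mu]_x h (x, y).
  apply: FubiniR.
  - apply: (@prod_integrable_dom R h (fun x => `|g x|) (fun y => `|A y| + `|B y|)) => //.
    + exact: L1_norm.
    + by apply: L1D; exact: L1_norm.
    move=> x y; rewrite /h/= normrM; apply: ler_pM => //.
    rewrite (le_trans (ler_normD _ _))// !normrM.
    by apply: lerD; rewrite ler_piMl ?norm_cos_le1 ?norm_sin_le1.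
  - by move=> x; rewrite /h/=; apply: L1Z; exact: L1_synth.
  - move=> y; rewrite /h/=.
    have := L1D (L1Z (A y) (L1_cos y lg)) (L1Z (B y) (L1_sin y lg)).
    by congr L1; apply/funext => x; ring.
transitivity (\int[mu]_x \int[mu]_y h (x, y)).
  by apply: eq_Rintegral => x _; rewrite /h/= RintegralZl//; exact: L1_synth.
rewrite E; apply: eq_Rintegral => y _; rewrite /h/=.
have lc := L1_cos y lg; have ls := L1_sin y lg.
rewrite /ct /st -(RintZ (A y) lc) -(RintZ (B y) ls) -(RintD (L1Z (A y) lc) (L1Z (B y) ls)).
by apply: eq_Rintegral => x _; ring.
Qed.

(** Integrating [synth A B] against [laplace eps x * cos (x * xi)] gives the
    mean of [A] for the Poisson kernels centred at [xi] and [- xi]; with the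
    sine in place of the cosine the same holds for [B]. *)
Lemma synth_inj A B : L1 A -> L1 B -> continuous A -> continuous B ->
  (forall x, A (- x) = A x) -> (forall x, B (- x) = - B x) ->
  (forall x, synth A B x = 0) -> (forall xi, A xi = 0) /\ (forall xi, B xi = 0).
Proof.
move=> lA lB cA cB eA oB s0.
have p0 : pi != 0 :> R by rewrite gt_eqF// pi_gt0.
have e0 n : 0 < n.+1%:R^-1 :> R by rewrite invr_gt0.
have z0 n (t : R -> R) : \int[mu]_x (laplace n.+1%:R^-1 x * t x * synth A B x) = 0.
  under eq_Rintegral do rewrite s0 mulr0.
  by rewrite Rintegral_cst// mul0r.
have P g z n : L1 g -> L1 (fun x => g x * poisson n.+1%:R^-1 (x - z)).
  by move=> lg; exact: L1_poissonM.
split=> xi.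
- pose I z n := \int[mu]_y (A y * poisson n.+1%:R^-1 (y - z)).
  have h : I xi n + I (- xi) n @[n --> \oo] --> pi * A xi + pi * A (- xi).
    by apply: cvgD; apply: poisson_cvg => //; exact: cA.
  have I0 n : I xi n + I (- xi) n = 0.
    rewrite -(z0 n (fun x => cos (x * xi))) synth_dual//; last first.
      by apply: laplace_trig => //; [exact: continuous_cosM|move=> x; exact: norm_cos_le1].
    rewrite -RintegralD//; [|exact: P|exact: P].
    apply: eq_Rintegral => y _.
    by rewrite /ct /st laplace_cos_cos// laplace_cos_sin// mulr0 addr0 mulrDr opprK.
  move: h; under eq_cvg do rewrite I0.
  move/(cvg_lim (@Rhausdorff R)); rewrite lim_cst; last exact: Rhausdorff.
  rewrite eA -mulr2n => /esym/eqP.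
  by rewrite mulrn_eq0/= mulf_eq0 (negbTE p0)/= => /eqP.
- pose I z n := \int[mu]_y (B y * poisson n.+1%:R^-1 (y - z)).
  have h : I xi n - I (- xi) n @[n --> \oo] --> pi * B xi - pi * B (- xi).
    by apply: cvgB; apply: poisson_cvg => //; exact: cB.
  have I0 n : I xi n - I (- xi) n = 0.
    rewrite -(z0 n (fun x => sin (x * xi))) synth_dual//; last first.
      by apply: laplace_trig => //; [exact: continuous_sinM|move=> x; exact: norm_sin_le1].
    rewrite -RintegralB//; [|exact: P|exact: P].
    apply: eq_Rintegral => y _.
    rewrite /ct /st laplace_sin_sin//.
    under eq_Rintegral do rewrite mulrAC.
    by rewrite laplace_cos_sin// mulr0 add0r mulrBr opprK.
  move: h; under eq_cvg do rewrite I0.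
  move/(cvg_lim (@Rhausdorff R)); rewrite lim_cst; last exact: Rhausdorff.
  rewrite oB mulrN opprK -mulr2n => /esym/eqP.
  by rewrite mulrn_eq0/= mulf_eq0 (negbTE p0)/= => /eqP.
Unshelve. all: by end_near. Qed.

(** The factor [`|xi|] makes the error of the damping [laplace eps] explicit:
    it is at most [eps] times a fixed integral. *)
Lemma fourier_inversion f x : L1 f -> {for x, continuous f} ->
  L1 (ct f) -> L1 (st f) ->
  L1 (fun xi => `|xi| * ct f xi) -> L1 (fun xi => `|xi| * st f xi) ->
  synth (ct f) (st f) x = 2 * pi * f x.
Proof.
move=> lf cf lc ls lxc lxs.
have e0 n : 0 < n.+1%:R^-1 :> R by rewrite invr_gt0.
pose J eps := \int[mu]_xi (laplace eps xi *
  (cos (x * xi) * ct f xi + sin (x * xi) * st f xi)).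
have JE eps : 0 < eps -> J eps = 2 * \int[mu]_y (f y * poisson eps (y - x)).
  move=> ep; have [ll _] := laplace_int ep.
  pose h (z : R * R) := laplace eps z.1 *
    (cos (x * z.1) * cos (z.1 * z.2) + sin (x * z.1) * sin (z.1 * z.2)) * f z.2.
  have cx : continuous (fun y : R => cos (x * y)).
    by under eq_fun do rewrite mulrC; exact: continuous_cosM.
  have sx : continuous (fun y : R => sin (x * y)).
    by under eq_fun do rewrite mulrC; exact: continuous_sinM.
  have mh : measurable_fun setT h.
    apply: measurable_funM; last exact: (measurable_snd2 (L1_measurable lf)).
    apply: measurable_funM; first exact: (measurable_fst2 (L1_measurable ll)).
    apply: measurable_funD; apply: measurable_funM.
    - exact: (measurable_fst2 (continuous_measurable_fun cx)).
    - exact: (measurable_mul2 (@continuous_cos R)).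
    - exact: (measurable_fst2 (continuous_measurable_fun sx)).
    - exact: (measurable_mul2 (@continuous_sin R)).
  have hE xi y : h (xi, y) = laplace eps xi * cos (xi * (y - x)) * f y.
    by rewrite /h/= mulrBr cosB [xi * x]mulrC; ring.
  have lcos y := laplace_trig ep (@continuous_cosM R y) (fun x => norm_cos_le1 _).
  have E : \int[mu]_xi \int[mu]_y h (xi, y) = \int[mu]_y \int[mu]_xi h (xi, y).
    apply: FubiniR.
    - apply: (prod_integrable_dom mh ll (L1_norm lf)) => xi y.
      rewrite hE normrM ler_wpM2r// normrM ger0_norm ?laplace_ge0//.
      by rewrite ler_piMr ?laplace_ge0// norm_cos_le1.
    - move=> xi; have := L1D (L1Z (laplace eps xi * cos (x * xi)) (L1_cos xi lf))
        (L1Z (laplace eps xi * sin (x * xi)) (L1_sin xi lf)).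
      by congr L1; apply/funext => y; rewrite /h/= [y * xi]mulrC; ring.
    - move=> y; have := L1Z (f y) (lcos (y - x)).
      by congr L1; apply/funext => xi; rewrite hE mulrC.
  transitivity (\int[mu]_xi \int[mu]_y h (xi, y)).
    apply: eq_Rintegral => xi _.
    have lcx := L1Z (cos (x * xi)) (L1_cos xi lf); have lsx := L1Z (sin (x * xi)) (L1_sin xi lf).
    rewrite /ct /st -(RintZ _ (L1_cos xi lf)) -(RintZ _ (L1_sin xi lf)) -(RintD lcx lsx).
    rewrite -(RintZ _ (L1D lcx lsx)).
    by apply: eq_Rintegral => y _; rewrite /h/= [y * xi]mulrC; ring.
  rewrite E -RintegralZl//; last exact: L1_poissonM.
  apply: eq_Rintegral => y _.
  under eq_Rintegral do rewrite hE mulrC.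
  by rewrite (RintZ _ (lcos (y - x))) laplace_cos//; ring.
have lsy := L1_synth x lc ls.
have J0 : J n.+1%:R^-1 @[n --> \oo] --> synth (ct f) (st f) x.
  pose K := \int[mu]_xi (`|(`|xi| * ct f xi)| + `|(`|xi| * st f xi)|).
  have lK : L1 (fun xi => `|(`|xi| * ct f xi)| + `|(`|xi| * st f xi)|).
    by apply: L1D; exact: L1_norm.
  have b n : `|synth (ct f) (st f) x - J n.+1%:R^-1| <= n.+1%:R^-1 * K.
    have lJ : L1 (fun xi => laplace n.+1%:R^-1 xi *
        (cos (x * xi) * ct f xi + sin (x * xi) * st f xi)).
      have := L1Mb lsy (continuous_measurable_fun (continuous_laplace (eps := n.+1%:R^-1))).
      move=> /(_ 1) h; under eq_fun do rewrite mulrC; apply: h => y.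
      by rewrite ger0_norm ?laplace_ge0// /laplace -expR0 ler_expR oppr_le0 mulr_ge0// ltW.
    rewrite /synth /J -RintegralB// -RintegralZl//.
    apply: Rint_normle; [exact: L1B|exact: L1Z|move=> xi].
    rewrite -[X in X - _]mul1r -mulrBl normrM.
    have l1 : laplace n.+1%:R^-1 xi <= 1.
      by rewrite /laplace -expR0 ler_expR oppr_le0 mulr_ge0// ltW.
    have l2 : 1 - laplace n.+1%:R^-1 xi <= n.+1%:R^-1 * `|xi|.
      by rewrite /laplace; move: (_ * _) => t; have := expR_ge1Dx (- t); lra.
    rewrite ger0_norm ?subr_ge0//.
    apply: (@le_trans _ _ (n.+1%:R^-1 * `|xi| * (`|ct f xi| + `|st f xi|))); last first.
      by rewrite !normrM !normr_id -mulrDr mulrA.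
    apply: ler_pM => //; first by rewrite subr_ge0.
    rewrite (le_trans (ler_normD _ _))// !normrM.
    by apply: lerD; rewrite ler_piMl ?norm_cos_le1 ?norm_sin_le1.
  have K0 : 0 <= K by apply: Rintegral_ge0 => xi _; rewrite addr_ge0.
  have h : n.+1%:R^-1 * K @[n --> \oo] --> (0 : R).
    rewrite -(mul0r K); apply: cvgMl; exact: cvg_harmonic.
  apply/cvgrPdist_le => e ep; move/cvgrPdist_le : h => /(_ _ ep) h.
  near=> n; apply: (le_trans (b n)).
  have : `|0 - n.+1%:R^-1 * K| <= e by near: n.
  by rewrite sub0r normrN; apply: le_trans; exact: ler_norm.
have h : J n.+1%:R^-1 @[n --> \oo] --> 2 * (pi * f x).
  under eq_cvg do rewrite JE//.
  by apply: cvgMr; exact: poisson_cvg.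
by rewrite -mulrA; apply: (cvg_unique _ J0 h).
Unshelve. all: by end_near. Qed.

End FourierInversion.

(** * Functions with two derivatives and two weights *)

Section Profiles.
Context {R : realType}.
Notation mu := (@lebesgue_measure R).
Implicit Types (f g : R -> R) (x y xi lam : R).

Definition bracket4 x : R := (1 + x ^+ 2) ^+ 2.

Lemma bracket4_ge1 x : 1 <= bracket4 x.
Proof. by rewrite exprn_ege1// lerDl sqr_ge0. Qed.

Lemma bracket4_gt0 x : 0 < bracket4 x.
Proof. exact: lt_le_trans (bracket4_ge1 x). Qed.

Lemma continuous_bracket4 : continuous bracket4.
Proof.
have c : continuous (fun x : R => 1 + x ^+ 2).
  by apply: continuous_add; [exact: continuous_cst|exact: exprn_continuous].
have -> : bracket4 = (fun x => (1 + x ^+ 2) * (1 + x ^+ 2)) by apply/funext => x; rewrite /bracket4 expr2.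
exact: continuous_mul.
Qed.

(** Cauchy-Schwarz in its pointwise form: a weighted square controls the first
    power, and even its first moment, up to the integrable [cauchy]. *)
Lemma weight_bound (g y lam : R) : 0 < lam ->
  `|g| <= lam^-1 * (bracket4 y * g ^+ 2) + lam * cauchy y /\
  `|y * g| <= lam^-1 * (bracket4 y * g ^+ 2) + lam * cauchy y.
Proof.
move=> l0; set s := 1 + y ^+ 2; have s1 : 1 <= s by rewrite /s lerDl sqr_ge0.
have s0 : 0 < s by exact: lt_le_trans s1.
have key b : 0 <= b -> b ^+ 2 <= s ->
    b * `|g| <= lam^-1 * (bracket4 y * g ^+ 2) + lam * cauchy y.
  move=> b0 bs; rewrite /bracket4 /cauchy -/s -(real_normK (num_real g)).
  have G0 : 0 <= `|g| by [].
  move: `|g| G0 => G G0.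
  have : 0 <= lam^-1 * (s * G - lam * (b / s) / 2) ^+ 2.
    by rewrite mulr_ge0 ?invr_ge0 ?(ltW l0)// sqr_ge0.
  have -> : lam^-1 * (s * G - lam * (b / s) / 2) ^+ 2 =
      lam^-1 * (s ^+ 2 * G ^+ 2) - b * G + lam * (b ^+ 2 * s^-1 * s^-1 / 4).
    by field; rewrite !gt_eqF.
  have bs1 : b ^+ 2 * s^-1 <= 1 by rewrite ler_pdivrMr// mul1r.
  have bs2 : lam * (b ^+ 2 * s^-1 * s^-1 / 4) <= lam * s^-1.
    rewrite ler_wpM2l ?(ltW l0)// (@le_trans _ _ (b ^+ 2 * s^-1 * s^-1))//.
      by rewrite ler_pdivrMr// ler_peMr ?ler1n// !mulr_ge0 ?invr_ge0 ?sqr_ge0// ltW.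
    by rewrite ler_piMl// invr_ge0 ltW.
  by lra.
split; first by rewrite -[`|g|]mul1r; apply: key => //; rewrite expr1n.
by rewrite normrM; apply: key => //; rewrite real_normK ?num_real// lerDr.
Qed.

(** The profiles of a solution at fixed time: continuous representatives of
    functions with two derivatives and two weights in L2. *)
Record profile f : Prop := Profile {
  profile_cont : continuous f ;
  profile_weight : L1 (fun x => bracket4 x * f x ^+ 2) ;
  profile_sobolev : L1 (fun xi => bracket4 xi * (ct f xi ^+ 2 + st f xi ^+ 2)) }.

Definition mass f := \int[mu]_x (bracket4 x * f x ^+ 2).
Definition smass f := \int[mu]_xi (bracket4 xi * (ct f xi ^+ 2 + st f xi ^+ 2)).

Lemma weight_L1 f lam : measurable_fun setT f -> L1 (fun x => bracket4 x * f x ^+ 2) ->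
  0 < lam ->
  [/\ L1 f, L1 (fun x => x * f x),
      \int[mu]_x `|f x| <= lam^-1 * mass f + lam * pi
    & \int[mu]_x `|x * f x| <= lam^-1 * mass f + lam * pi].
Proof.
move=> mf lw l0; have [lc ic] := @cauchy_int R.
have lb : L1 (fun x => lam^-1 * (bracket4 x * f x ^+ 2) + lam * cauchy x).
  by apply: L1D; exact: L1Z.
have ib : \int[mu]_x (lam^-1 * (bracket4 x * f x ^+ 2) + lam * cauchy x) =
    lam^-1 * mass f + lam * pi.
  by rewrite RintegralD//; [rewrite !RintegralZl// ic|exact: L1Z|exact: L1Z].
have lf : L1 f by apply: L1_dom lb => // x; have [] := weight_bound (f x) x l0.
have lxf : L1 (fun x => x * f x).
  apply: L1_dom lb; first by apply: measurable_funM.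
  by move=> x; have [] := weight_bound (f x) x l0.
split => //; rewrite -ib; apply: le_Rintegral => //.
- exact: L1_norm.
- by move=> x _; have [] := weight_bound (f x) x l0.
- exact: L1_norm lxf.
- by move=> x _; have [] := weight_bound (f x) x l0.
Qed.

Lemma profile_measurable f : profile f -> measurable_fun setT f.
Proof. by move=> pf; apply: continuous_measurable_fun; exact: profile_cont. Qed.

Lemma profile_L1 f : profile f -> L1 f.
Proof. by move=> pf; have [] := weight_L1 (profile_measurable pf) (profile_weight pf) ltr01. Qed.

Lemma profile_moment f : profile f -> L1 (fun x => x * f x).
Proof. by move=> pf; have [] := weight_L1 (profile_measurable pf) (profile_weight pf) ltr01. Qed.

Lemma norm_cosB x y : `|cos x - cos y| <= `|x - y|.
Proof.
pose a := (x + y) / 2; pose b := (x - y) / 2.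
have -> : x = a + b by rewrite /a /b; field.
have -> : y = a - b by rewrite /a /b; field.
rewrite cosB cosD (_ : _ - _ = - 2 * (sin a * sin b)); last by ring.
rewrite (_ : a + b - _ = 2 * b); last by ring.
rewrite !normrM normrN (ger0_norm (ler0n _ 2)) ler_wpM2l//.
rewrite -[X in _ <= X]normrM -/b; apply: le_trans (norm_sin_le b).
by rewrite ler_piMl// norm_sin_le1.
Qed.

Lemma norm_sinB x y : `|sin x - sin y| <= `|x - y|.
Proof.
pose a := (x + y) / 2; pose b := (x - y) / 2.
have -> : x = a + b by rewrite /a /b; field.
have -> : y = a - b by rewrite /a /b; field.
rewrite sinB sinD (_ : _ - _ = 2 * (cos a * sin b)); last by ring.
rewrite (_ : a + b - _ = 2 * b); last by ring.
rewrite !normrM (ger0_norm (ler0n _ 2)) ler_wpM2l//.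
rewrite -[X in _ <= X]normrM -/b; apply: le_trans (norm_sin_le b).
by rewrite ler_piMl// norm_cos_le1.
Qed.

Lemma ct_lip f xi y : L1 f -> L1 (fun x => x * f x) ->
  `|ct f xi - ct f y| <= `|xi - y| * \int[mu]_x `|x * f x|.
Proof.
move=> lf lxf; rewrite /ct -RintegralB//; [|exact: L1_cos|exact: L1_cos].
rewrite -RintegralZl//; last exact: L1_norm lxf.
apply: Rint_normle; [by apply: L1B; exact: L1_cos|by apply: L1Z; exact: L1_norm lxf|].
move=> x; rewrite -mulrBr !normrM mulrA mulrC; apply: ler_wpM2r => //.
by rewrite (le_trans (norm_cosB _ _))// -mulrBr normrM mulrC.
Qed.

Lemma st_lip f xi y : L1 f -> L1 (fun x => x * f x) ->
  `|st f xi - st f y| <= `|xi - y| * \int[mu]_x `|x * f x|.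
Proof.
move=> lf lxf; rewrite /st -RintegralB//; [|exact: L1_sin|exact: L1_sin].
rewrite -RintegralZl//; last exact: L1_norm lxf.
apply: Rint_normle; [by apply: L1B; exact: L1_sin|by apply: L1Z; exact: L1_norm lxf|].
move=> x; rewrite -mulrBr !normrM mulrA mulrC; apply: ler_wpM2r => //.
by rewrite (le_trans (norm_sinB _ _))// -mulrBr normrM mulrC.
Qed.

Lemma lip_continuous f (K : R) : (forall x y, `|f x - f y| <= `|x - y| * K) -> continuous f.
Proof.
move=> h x; apply/cvgrPdist_le => e e0; near=> y.
have K1 : 0 < `|K| + 1 by rewrite ltr_wpDl.
rewrite (le_trans (h _ _))// (@le_trans _ _ (`|x - y| * (`|K| + 1)))//.
  by rewrite ler_wpM2l// (le_trans (ler_norm K))// lerDl.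
rewrite -ler_pdivlMr//; near: y; apply: cvgr_dist_le; first exact: cvg_id.
by rewrite divr_gt0.
Unshelve. all: by end_near. Qed.

Lemma ct_continuous f : L1 f -> L1 (fun x => x * f x) -> continuous (ct f).
Proof. by move=> lf lxf; apply: lip_continuous => x y; exact: ct_lip. Qed.

Lemma st_continuous f : L1 f -> L1 (fun x => x * f x) -> continuous (st f).
Proof. by move=> lf lxf; apply: lip_continuous => x y; exact: st_lip. Qed.

Lemma ct_even f xi : ct f (- xi) = ct f xi.
Proof. by apply: eq_Rintegral => x _; rewrite mulrN cosN. Qed.

Lemma st_odd f xi : L1 f -> st f (- xi) = - st f xi.
Proof.
move=> lf; rewrite -[RHS]mulN1r /st -RintegralZl//; last exact: L1_sin.
by apply: eq_Rintegral => x _; rewrite mulrN sinN; ring.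
Qed.

Lemma norm_ct_le f xi : L1 f -> `|ct f xi| <= \int[mu]_x `|f x|.
Proof.
move=> lf; apply: Rint_normle; [exact: L1_cos|exact: L1_norm|move=> x].
by rewrite normrM ler_piMr// norm_cos_le1.
Qed.

Lemma norm_st_le f xi : L1 f -> `|st f xi| <= \int[mu]_x `|f x|.
Proof.
move=> lf; apply: Rint_normle; [exact: L1_sin|exact: L1_norm|move=> x].
by rewrite normrM ler_piMr// norm_sin_le1.
Qed.

(** [amp f] is comparable to the modulus of the Fourier transform. *)
Definition amp f xi : R := `|ct f xi| + `|st f xi|.

Lemma amp_ge0 f xi : 0 <= amp f xi.
Proof. exact: addr_ge0. Qed.

Lemma profile_amp f : profile f ->
  [/\ L1 (amp f), L1 (fun xi => `|xi| * amp f xi),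
      \int[mu]_xi amp f xi <= 2 * (smass f + pi)
    & \int[mu]_xi (`|xi| * amp f xi) <= 2 * (smass f + pi)].
Proof.
move=> pf; have lf := profile_L1 pf; have lxf := profile_moment pf.
have mc := continuous_measurable_fun (ct_continuous lf lxf).
have ms := continuous_measurable_fun (st_continuous lf lxf).
have ma : measurable_fun setT (amp f).
  by apply: measurable_funD; apply: measurableT_comp.
have [lc ic] := @cauchy_int R; have lS := profile_sobolev pf.
pose b xi := 2 * (bracket4 xi * (ct f xi ^+ 2 + st f xi ^+ 2) + cauchy xi).
have lb : L1 b by apply: L1Z; exact: L1D.
have ib : \int[mu]_xi b xi = 2 * (smass f + pi).
  by rewrite RintegralZl//; [rewrite RintegralD// ic|exact: L1D].
have h1 xi : amp f xi <= b xi /\ `|xi| * amp f xi <= b xi.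
  have [c1 c2] := weight_bound (ct f xi) xi ltr01.
  have [s1 s2] := weight_bound (st f xi) xi ltr01.
  move: c1 c2 s1 s2; rewrite !normrM invr1 !mul1r /b /amp mulrDr (mulrDr (bracket4 xi)).
  have : 0 <= bracket4 xi * ct f xi ^+ 2 by rewrite mulr_ge0 ?sqr_ge0 ?ltW ?bracket4_gt0.
  have : 0 <= bracket4 xi * st f xi ^+ 2 by rewrite mulr_ge0 ?sqr_ge0 ?ltW ?bracket4_gt0.
  by split; lra.
have la : L1 (amp f).
  apply: L1_dom lb => // xi; rewrite ger0_norm ?amp_ge0//; exact: (h1 xi).1.
have lxa : L1 (fun xi => `|xi| * amp f xi).
  apply: L1_dom lb; first by apply: measurable_funM => //; exact: measurableT_comp.
  by move=> xi; rewrite ger0_norm ?mulr_ge0 ?amp_ge0//; exact: (h1 xi).2.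
by split => //; rewrite -ib; apply: le_Rintegral => // xi _; have [] := h1 xi.
Qed.

End Profiles.

(** * The derivative of a profile *)

Section QuadraticTerm.
Context {R : realType}.
Notation mu := (@lebesgue_measure R).
Implicit Types (f g A B : R -> R) (x y xi : R).

Lemma synth_continuous A B : L1 A -> L1 B -> continuous (synth A B).
Proof.
move=> lA lB x.
have h : {in `]x - 1, x + 1[%classic, continuous (synth A B)}.
  apply: (@continuity_under_integral R _ _ mu
    (fun y xi => cos (y * xi) * A xi + sin (y * xi) * B xi) setT measurableT
    (x - 1) (x + 1) _ _ (fun xi => `|A xi| + `|B xi|)).
  - by move=> y _; exact: L1_synth.
  - apply: aeW => xi _ y _; apply: continuous_add; apply: continuous_mul.
    + exact: continuous_cosM.
    + exact: continuous_cst.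
    + exact: continuous_sinM.
    + exact: continuous_cst.
  - by apply: L1D; exact: L1_norm.
  - move=> y _; apply: aeW => xi _; rewrite (le_trans (ler_normD _ _))// !normrM.
    by apply: lerD; rewrite ler_piMl ?norm_cos_le1 ?norm_sin_le1.
by apply: h; rewrite inE/= in_itv/= ltrBlDr ltrDl ltr01.
Qed.

Lemma synth_le A B x : L1 A -> L1 B ->
  `|synth A B x| <= \int[mu]_xi (`|A xi| + `|B xi|).
Proof.
move=> lA lB; apply: Rint_normle; first exact: L1_synth.
  by apply: L1D; exact: L1_norm.
move=> xi; rewrite (le_trans (ler_normD _ _))// !normrM.
by apply: lerD; rewrite ler_piMl ?norm_cos_le1 ?norm_sin_le1.
Qed.

Lemma synth_derive A B x : L1 A -> L1 B ->
  L1 (fun xi => xi * A xi) -> L1 (fun xi => xi * B xi) ->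
  is_derive x 1 (synth A B) (synth (fun xi => xi * B xi) (fun xi => - (xi * A xi)) x).
Proof.
move=> lA lB lxA lxB.
pose F y xi := cos (y * xi) * A xi + sin (y * xi) * B xi.
have dF y xi : is_derive y 1 (F ^~ xi)
    (cos (y * xi) * (xi * B xi) + sin (y * xi) * - (xi * A xi)).
  have dc := is_derive_scale (A xi) (is_derive_comp_scale (is_derive_cos (xi * y))).
  have ds := is_derive_scale (B xi) (is_derive_comp_scale (is_derive_sin (xi * y))).
  have -> : F ^~ xi = (fun y => A xi * cos (xi * y) + B xi * sin (xi * y)).
    by apply/funext => z; rewrite /F [z * xi]mulrC; ring.
  apply: is_derive_eq (is_derive_add dc ds) _.
  by rewrite [y * xi]mulrC; ring.
have I : `]x - 1, x + 1[%classic x by rewrite /= in_itv/= ltrBlDr ltrDl ltr01.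
have iF y : `]x - 1, x + 1[%classic y -> mu.-integrable setT (EFin \o F y).
  by move=> _; exact: L1_synth.
have pF y xi : partial1of2 F y xi =
    cos (y * xi) * (xi * B xi) + sin (y * xi) * - (xi * A xi).
  by rewrite /partial1of2; exact: derive1_is.
pose G xi := `|xi * B xi| + `|xi * A xi|.
have G0 xi : 0 <= G xi by exact: addr_ge0.
have lG : mu.-integrable setT (EFin \o G) by apply: L1D; exact: L1_norm.
have bG y xi : `]x - 1, x + 1[%classic y -> setT xi -> `|partial1of2 F y xi| <= G xi.
  move=> _ _; rewrite pF (le_trans (ler_normD _ _))// [X in X + _ <= _]normrM.
  rewrite [X in _ + X <= _]normrM normrN.
  by apply: lerD; rewrite ler_piMl ?norm_cos_le1 ?norm_sin_le1.
have dF' y xi : `]x - 1, x + 1[%classic y -> setT xi -> derivable (F ^~ xi) y 1.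
  by move=> _ _; apply: ex_derive; exact: dF.
apply: DeriveDef; first exact: (derivable_under_integral measurableT I iF dF' G0 lG bG).
rewrite -derive1E (differentiation_under_integral measurableT I iF dF' G0 lG bG).
by apply: eq_Rintegral => xi _; exact: pF.
Qed.

(** The classical derivative of a profile, obtained by differentiating its
    Fourier representation. *)
Definition dprofile f x : R :=
  (2 * pi)^-1 * synth (fun xi => xi * st f xi) (fun xi => - (xi * ct f xi)) x.

Section Profile.
Variable f : R -> R.
Hypothesis pf : profile f.

Let lf := profile_L1 pf.
Let lxf := profile_moment pf.
Let pi2 : 0 < 2 * pi :> R. Proof. by rewrite mulr_gt0// pi_gt0. Qed.

Lemma profile_ct_L1 : L1 (ct f).
Proof.
have [la _ _ _] := profile_amp pf; apply: L1_dom la.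
  by apply: continuous_measurable_fun; exact: (ct_continuous lf lxf).
by move=> x; rewrite lerDl.
Qed.

Lemma profile_st_L1 : L1 (st f).
Proof.
have [la _ _ _] := profile_amp pf; apply: L1_dom la.
  by apply: continuous_measurable_fun; exact: (st_continuous lf lxf).
by move=> x; rewrite lerDr.
Qed.

Lemma profile_ct_moment : L1 (fun xi => xi * ct f xi).
Proof.
have [_ la _ _] := profile_amp pf; apply: L1_dom la.
  by apply: measurable_funM => //; apply: continuous_measurable_fun; exact: (ct_continuous lf lxf).
by move=> x; rewrite normrM ler_wpM2l// lerDl.
Qed.

Lemma profile_st_moment : L1 (fun xi => xi * st f xi).
Proof.
have [_ la _ _] := profile_amp pf; apply: L1_dom la.
  by apply: measurable_funM => //; apply: continuous_measurable_fun; exact: (st_continuous lf lxf).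
by move=> x; rewrite normrM ler_wpM2l// lerDr.
Qed.

Lemma profile_synth x : f x = (2 * pi)^-1 * synth (ct f) (st f) x.
Proof.
rewrite fourier_inversion ?mulKf ?gt_eqF//; first exact: profile_cont.
- exact: profile_ct_L1.
- exact: profile_st_L1.
- apply: L1_dom (L1_norm profile_ct_moment).
    apply: measurable_funM; first exact: normr_measurable.
    by apply: continuous_measurable_fun; exact: (ct_continuous lf lxf).
  by move=> x0; rewrite !normrM normr_id.
- apply: L1_dom (L1_norm profile_st_moment).
    apply: measurable_funM; first exact: normr_measurable.
    by apply: continuous_measurable_fun; exact: (st_continuous lf lxf).
  by move=> x0; rewrite !normrM normr_id.
Qed.

Lemma profile_derive x : is_derive x 1 f (dprofile f x).
Proof.
have E : f = (fun x => (2 * pi)^-1 * synth (ct f) (st f) x).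
  by apply/funext => y; exact: profile_synth.
rewrite [X in is_derive _ _ X _]E.
apply: is_derive_scale; apply: synth_derive.
- exact: profile_ct_L1.
- exact: profile_st_L1.
- exact: profile_ct_moment.
- exact: profile_st_moment.
Qed.

Lemma dprofile_continuous : continuous (dprofile f).
Proof.
apply: continuous_mul; first exact: continuous_cst.
apply: synth_continuous; first exact: profile_st_moment.
by apply: L1N; exact: profile_ct_moment.
Qed.

Lemma dprofile_bounded : exists c, forall x, `|dprofile f x| <= c.
Proof.
exists ((2 * pi)^-1 * \int[mu]_xi (`|xi * st f xi| + `|- (xi * ct f xi)|)) => x.
rewrite /dprofile normrM ger0_norm ?invr_ge0 ?(ltW pi2)// ler_wpM2l ?invr_ge0 ?(ltW pi2)//.
apply: synth_le; first exact: profile_st_moment.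
by apply: L1N; exact: profile_ct_moment.
Qed.

Lemma profile_dprofile_L1 : L1 (fun x => f x * dprofile f x).
Proof.
have [c hc] := dprofile_bounded; apply: (L1Mb lf) hc.
by apply: continuous_measurable_fun; exact: dprofile_continuous.
Qed.

Lemma profile_sqr_L1 : L1 (fun x => f x ^+ 2).
Proof.
apply: L1_dom (profile_weight pf).
  by apply: measurable_funX; exact: profile_measurable.
by move=> x; rewrite ger0_norm ?sqr_ge0// ler_peMl ?sqr_ge0// bracket4_ge1.
Qed.

Lemma profile_sqr_moment : L1 (fun x => x * f x ^+ 2).
Proof.
apply: L1_dom (profile_weight pf).
  by apply: measurable_funM => //; apply: measurable_funX; exact: profile_measurable.
move=> x; rewrite normrM [`|_ ^+ 2|]ger0_norm ?sqr_ge0// ler_wpM2r ?sqr_ge0//.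
have h : `|x| <= 1 + x ^+ 2.
  by rewrite -(real_normK (num_real x)); have := sqr_ge0 (`|x| - 1); have := normr_ge0 x; rewrite sqrrB1; lra.
by rewrite (le_trans h)// /bracket4 expr2 ler_peMl ?addr_ge0 ?sqr_ge0// lerDl sqr_ge0.
Qed.

Lemma profile_sqr_continuous : continuous (fun x => f x ^+ 2).
Proof.
under eq_fun do rewrite expr2.
by apply: continuous_mul; exact: profile_cont.
Qed.

Lemma profile_sqr_derive x : derive1 (fun y => f y ^+ 2) x = 2 * (f x * dprofile f x).
Proof.
under [X in derive1 X]eq_fun do rewrite expr2.
rewrite (derive1_is (is_derive_mul (profile_derive x) (profile_derive x))).
by ring.
Qed.

End Profile.

End QuadraticTerm.

(** * The Fourier transform of the nonlinearity *)

Section QuadraticFourier.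
Context {R : realType}.
Notation mu := (@lebesgue_measure R).
Implicit Types (f g : R -> R) (x y xi : R).

Lemma prod_integrable2 (h : R * R -> R) g : measurable_fun setT h ->
  (forall y, L1 (fun x => h (x, y))) ->
  (forall y, \int[mu]_x `|h (x, y)| <= g y) -> L1 g ->
  (mu \x mu)%E.-integrable setT (EFin \o h).
Proof.
move=> mh l1 hg lg; apply/integrable21ltyP; first exact/measurable_EFinP.
apply: (@le_lt_trans _ _ (\int[mu]_y (g y)%:E)%E); last by rewrite L1E// ltry.
apply: ge0_le_integral => //=.
- by move=> y _; exact: integral_ge0.
- apply: (@measurable_fun_fubini_tonelli_G _ _ _ _ _ mu (fun z => `|(EFin \o h) z|%E)) => //=.
  by apply/measurable_EFinP; apply: measurableT_comp.
- by apply/measurable_EFinP; exact: L1_measurable lg.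
- by move=> y _; rewrite (L1E (L1_norm (l1 y))) lee_fin.
Qed.

Lemma FubiniL1 (h : R * R -> R) : (mu \x mu)%E.-integrable setT (EFin \o h) ->
  (forall x, L1 (fun y => h (x, y))) -> L1 (fun x => \int[mu]_y h (x, y)).
Proof.
move=> ih l1; have := integrable_fubini_F ih.
by apply: eq_integrable => // x _; rewrite /fubini_F/= L1E.
Qed.

Lemma FubiniL1r (h : R * R -> R) : (mu \x mu)%E.-integrable setT (EFin \o h) ->
  (forall y, L1 (fun x => h (x, y))) -> L1 (fun y => \int[mu]_x h (x, y)).
Proof.
move=> ih l1; have mh := measurable_int _ ih.
have ms : measurable_fun setT (EFin \o (fun z : R * R => h (z.2, z.1))).
  by apply: (measurableT_comp mh); exact: measurable_swap.
apply: (FubiniL1 (h := fun z => h (z.2, z.1))) => //.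
by apply/integrable12ltyP => //; have /integrable21ltyP := ih; exact.
Qed.

Lemma Rint_indic (D : set R) f :
  \int[mu]_(x in D) f x = \int[mu]_x (\1_D x * f x).
Proof.
rewrite Rintegral_mkcond; apply: eq_Rintegral => x _.
by rewrite patchE indicE; case: (x \in D); rewrite ?mul1r ?mul0r.
Qed.

Lemma L1_indic (D : set R) f : measurable (D : set (measurableTypeR R)) ->
  mu.-integrable D (EFin \o f) -> L1 (fun x => \1_D x * f x).
Proof.
move=> mD h; have := (integrable_mkcond _ mD).1 h; apply: eq_integrable => // x _.
by rewrite patchE /= indicE; case: (x \in D); rewrite ?mul1r ?mul0r.
Qed.

Lemma continuous_itv_integrable f a b : continuous f ->
  mu.-integrable `[a, b] (EFin \o f).
Proof.
move=> cf; apply: continuous_compact_integrable; first exact: segment_compact.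
exact: continuous_subspaceT.
Qed.

Lemma Rint_FTC2 F f a b : a < b -> continuous f -> continuous F ->
  (forall x, a < x < b -> is_derive x 1 F (f x)) ->
  \int[mu]_(x in `[a, b]) f x = F b - F a.
Proof.
move=> ab cf cF dF; rewrite /Rintegral (@continuous_FTC2 _ f F)//.
- exact: continuous_subspaceT.
- split.
  + by move=> x; rewrite in_itv/= => /dF h; exact: ex_derive.
  + by apply: cvg_at_right_filter; exact: cF.
  + by apply: cvg_at_left_filter; exact: cF.
- by move=> x; rewrite in_itv/= => /dF/derive1_is.
Qed.

Lemma Rint_translate f b : continuous f -> L1 f ->
  L1 (fun x => f (x + b)) /\ \int[mu]_x f (x + b) = \int[mu]_x f x.
Proof.
move=> cf lf; have lnf := L1_norm lf.
have [l1 i1] := Rint_shift b (continuous_abs cf) (fun x => normr_ge0 _) lnf.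
have cs : continuous (fun x => `|f x| + f x) by apply: continuous_add => //; exact: continuous_abs.
have s0 x : 0 <= `|f x| + f x by rewrite -lerBlDr sub0r -normrN ler_norm.
have [l2 i2] := Rint_shift b cs s0 (L1D lnf lf).
have E : (fun x => f (x + b)) = (fun x => (`|f (x + b)| + f (x + b)) - `|f (x + b)|).
  by apply/funext => x; ring.
split; first by rewrite E; exact: L1B.
by rewrite E RintegralB// i2 i1 RintegralD//; ring.
Qed.

(** [Phi (x + 1) - Phi x] has integral zero by translation invariance, and it
    is the mean of the translates of [dPhi] by numbers of the unit interval. *)
Lemma Rint_derivative (Phi dPhi : R -> R) : L1 Phi -> L1 dPhi -> continuous dPhi ->
  (forall x, is_derive x 1 Phi (dPhi x)) -> \int[mu]_x dPhi x = 0.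
Proof.
move=> lP ld cd dP; have cP : continuous Phi.
  by move=> x; exact: is_derive_continuous (dP x).
pose h (z : R * R) := \1_`[0%R, 1%R]%classic z.2 * dPhi (z.1 + z.2).
have lI : L1 (\1_`[0%R, 1%R]%classic : R -> R) by exact: integrable_indic_itv.
have mh : measurable_fun setT h.
  apply: measurable_funM; first exact: (measurable_snd2 (L1_measurable lI)).
  apply: (measurableT_comp (continuous_measurable_fun cd)).
  by apply: measurable_funD; [exact: measurable_fst|exact: measurable_snd].
have l2 y : L1 (fun x => h (x, y)).
  by rewrite /h/=; apply: L1Z; have [] := Rint_translate y cd ld.
have l1 x : L1 (fun y => h (x, y)).
  rewrite /h/=; apply: (L1_indic (f := fun y => dPhi (x + y))); first exact: measurable_itv.
  apply: continuous_itv_integrable => y; apply: continuous_comp; last exact: cd.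
  by apply: continuousD; [exact: cst_continuous|exact: cvg_id].
have ih : (mu \x mu)%E.-integrable setT (EFin \o h).
  apply: (prod_integrable2 mh l2 (g := fun y => \int[mu]_x `|dPhi x| * \1_`[0%R, 1%R]%classic y)).
    move=> y; have [lt it] := Rint_translate y (continuous_abs cd) (L1_norm ld).
    rewrite -it mulrC -RintegralZl//; apply: le_Rintegral => //.
    - exact: L1_norm (l2 y).
    - exact: (L1Z _ lt).
    - by move=> x _; rewrite /h/= normrM ler_wpM2r// ger0_norm.
  exact: L1Z.
have E := FubiniR ih l1 l2.
have LHS0 : \int[mu]_x \int[mu]_y h (x, y) = 0.
  have [lt it] := Rint_translate 1 cP lP.
  transitivity (\int[mu]_x (Phi (x + 1) - Phi x)).
    apply: eq_Rintegral => x _; rewrite /h/= -Rint_indic.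
    have -> : Phi (x + 1) - Phi x = Phi (x + 1) - Phi (x + 0) by rewrite addr0.
    apply: (Rint_FTC2 (F := fun s => Phi (x + s)) ltr01).
    - move=> y; apply: continuous_comp; last exact: cd.
      by apply: continuousD; [exact: cst_continuous|exact: cvg_id].
    - move=> y; apply: continuous_comp; last exact: cP.
      by apply: continuousD; [exact: cst_continuous|exact: cvg_id].
    - move=> y _; have := @is_derive_comp_affine R Phi 1 x y (dPhi (x + y)).
      rewrite !mul1r addrC => /(_ (dP _)).
      by under eq_fun do rewrite mul1r addrC.
  by rewrite RintegralB// it subrr.
rewrite -LHS0 E.
transitivity (\int[mu]_y (\int[mu]_x dPhi x * \1_`[0%R, 1%R]%classic y)).
  rewrite RintegralZl// -[LHS]mulr1; congr (_ * _).
  have i1 : \int[mu]_(y in `[0%R, 1%R]) 1 = 1 - 0 :> R.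
    apply: (Rint_FTC2 (F := id) ltr01); first exact: continuous_cst.
    by move=> x; exact: cvg_id.
  rewrite -[LHS]subr0 -i1 Rint_indic/=.
  by apply: eq_Rintegral => y _; rewrite mulr1.
apply: eq_Rintegral => y _; have [lt it] := Rint_translate y cd ld.
by rewrite /h/= RintegralZl// it mulrC.
Qed.

Section Profile.
Variable f : R -> R.
Hypothesis pf : profile f.
Let lf := profile_L1 pf.
Let lfd := profile_dprofile_L1 pf.
Let lf2 := profile_sqr_L1 pf.
Let cf2 := profile_sqr_continuous pf.

Let dsqr x : is_derive x 1 (fun y => f y ^+ 2) (2 * (f x * dprofile f x)).
Proof.
under [X in is_derive _ _ X _]eq_fun do rewrite expr2.
apply: is_derive_eq (is_derive_mul (profile_derive pf x) (profile_derive pf x)) _.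
by ring.
Qed.

Let cfd : continuous (fun x => f x * dprofile f x).
Proof.
by apply: continuous_mul; [exact: profile_cont|exact: dprofile_continuous].
Qed.

(** The derivative of [f ^+ 2 / 2] is transformed into [i xi / 2] times the
    transform of [f ^+ 2]; the boundary terms vanish by [Rint_derivative]. *)
Lemma ct_dsqr xi : ct (fun x => f x * dprofile f x) xi =
  xi / 2 * st (fun x => f x ^+ 2) xi.
Proof.
have dP x : is_derive x 1 (fun y => f y ^+ 2 * cos (y * xi))
    (2 * (f x * dprofile f x * cos (x * xi)) - xi * (f x ^+ 2 * sin (x * xi))).
  have dc := is_derive_comp_scale (is_derive_cos (xi * x)).
  under [X in is_derive _ _ X _]eq_fun do rewrite [_ * xi]mulrC.
  by apply: is_derive_eq (is_derive_mul (dsqr x) dc) _; rewrite [x * xi]mulrC; ring.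
have l1 := L1Z 2 (L1_cos xi lfd); have l2 := L1Z xi (L1_sin xi lf2).
have := Rint_derivative (L1_cos xi lf2) (L1B l1 l2) _ dP.
rewrite RintegralB// RintegralZl//; last exact: L1_cos.
rewrite RintegralZl//; last exact: L1_sin.
rewrite /ct /st => e.
suff /e h : continuous (fun x => 2 * (f x * dprofile f x * cos (x * xi)) -
   xi * (f x ^+ 2 * sin (x * xi))) by lra.
apply: continuous_sub; apply: continuous_mul (@continuous_cst _ _) _.
- by apply: continuous_mul => //; exact: continuous_cosM.
- by apply: continuous_mul => //; exact: continuous_sinM.
Qed.

Lemma st_dsqr xi : st (fun x => f x * dprofile f x) xi =
  - (xi / 2 * ct (fun x => f x ^+ 2) xi).
Proof.
have dP x : is_derive x 1 (fun y => f y ^+ 2 * sin (y * xi))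
    (2 * (f x * dprofile f x * sin (x * xi)) + xi * (f x ^+ 2 * cos (x * xi))).
  have dc := is_derive_comp_scale (is_derive_sin (xi * x)).
  under [X in is_derive _ _ X _]eq_fun do rewrite [_ * xi]mulrC.
  by apply: is_derive_eq (is_derive_mul (dsqr x) dc) _; rewrite [x * xi]mulrC; ring.
have l1 := L1Z 2 (L1_sin xi lfd); have l2 := L1Z xi (L1_cos xi lf2).
have := Rint_derivative (L1_sin xi lf2) (L1D l1 l2) _ dP.
rewrite RintegralD// RintegralZl//; last exact: L1_sin.
rewrite RintegralZl//; last exact: L1_cos.
rewrite /ct /st => e.
suff /e h : continuous (fun x => 2 * (f x * dprofile f x * sin (x * xi)) +
   xi * (f x ^+ 2 * cos (x * xi))) by lra.
apply: continuous_add; apply: continuous_mul (@continuous_cst _ _) _.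
- by apply: continuous_mul => //; exact: continuous_sinM.
- by apply: continuous_mul => //; exact: continuous_cosM.
Qed.

End Profile.

End QuadraticFourier.

(** * Young's inequality for the nonlinearity *)

Section Convolution.
Context {R : realType}.
Notation mu := (@lebesgue_measure R).
Implicit Types (x y xi eta : R).
Variable f : R -> R.
Hypothesis pf : profile f.
Let lf := profile_L1 pf.
Let lxf := profile_moment pf.

Let amp_continuous : continuous (amp f).
Proof.
apply: continuous_add; apply: continuous_abs.
  exact: (ct_continuous lf lxf).
exact: (st_continuous lf lxf).
Qed.

Let pair_amp xi eta : R := amp f (xi - eta) + amp f (xi + eta).

(** Multiplying [f] by a second oscillation shifts its Fourier transform. *)
Let shift_le (h c : R -> R) xi eta :
  (forall x, f x * h x = 2^-1 * (f x * c (x * (xi - eta))) + 2^-1 * (f x * c (x * (xi + eta)))) \/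
  (forall x, f x * h x = 2^-1 * (f x * c (x * (xi - eta))) - 2^-1 * (f x * c (x * (xi + eta)))) ->
  (forall z, L1 (fun x => f x * c (x * z))) ->
  (forall z, `|\int[mu]_x (f x * c (x * z))| <= amp f z) ->
  `|\int[mu]_x (f x * h x)| <= pair_amp xi eta.
Proof.
move=> e lc bc.
have a0 z : 0 <= amp f z by exact: amp_ge0.
have key (s : R) : `|s| <= 1 -> (forall x, f x * h x = 2^-1 * (f x * c (x * (xi - eta))) +
    s * (2^-1 * (f x * c (x * (xi + eta))))) ->
    `|\int[mu]_x (f x * h x)| <= pair_amp xi eta.
  move=> s1 E; under eq_Rintegral do rewrite E.
  have l1 := L1Z 2^-1 (lc (xi - eta)); have l2 := L1Z 2^-1 (lc (xi + eta)).
  rewrite (RintD l1 (L1Z s l2)) (RintZ _ (lc _)) (RintZ s l2) (RintZ _ (lc _)).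
  rewrite (le_trans (ler_normD _ _))// !normrM.
  have h2 : `|2^-1 : R| <= 1 by rewrite ger0_norm// invf_le1// ler1n.
  rewrite /pair_amp; apply: lerD.
    by apply: le_trans (bc (xi - eta)); rewrite -[X in _ <= X]mul1r; apply: ler_wpM2r.
  apply: le_trans (bc (xi + eta)); rewrite -[X in _ <= X]mul1r; apply: ler_pM => //.
  by rewrite -[X in _ <= X]mul1r; apply: ler_wpM2r.
case: e => E; [apply: (key 1)|apply: (key (- 1))]; rewrite ?normrN ?normr1// => x; rewrite E.
  by rewrite mul1r.
by rewrite mulN1r.
Qed.

Let ct_amp z : `|\int[mu]_x (f x * cos (x * z))| <= amp f z.
Proof. by rewrite lerDl. Qed.

Let st_amp z : `|\int[mu]_x (f x * sin (x * z))| <= amp f z.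
Proof. by rewrite lerDr. Qed.

Let lcos z : L1 (fun x => f x * cos (x * z)). Proof. exact: L1_cos. Qed.
Let lsin z : L1 (fun x => f x * sin (x * z)). Proof. exact: L1_sin. Qed.

Let h2 : (2 : R) * 2^-1 = 1. Proof. by rewrite mulfV. Qed.

Let cos_shift xi eta : `|ct (fun x => f x * cos (x * xi)) eta| <= pair_amp xi eta /\
  `|st (fun x => f x * cos (x * xi)) eta| <= pair_amp xi eta.
Proof.
split; rewrite /ct /st; under eq_Rintegral do rewrite -mulrA.
- apply: (shift_le (h := fun x => cos (x * xi) * cos (x * eta)) (c := cos)) => //; left => x.
  by rewrite (mulrBr x) (mulrDr x) cosB cosD; field.
- apply: (shift_le (h := fun x => cos (x * xi) * sin (x * eta)) (c := fun y => - sin y)).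
  + right => x.
    by rewrite (mulrBr x) (mulrDr x) sinB sinD; field.
  + by move=> z; under eq_fun do rewrite mulrN; exact: L1N.
  + move=> z; rewrite (_ : (\int[mu]_x _) = - 1 * \int[mu]_x (f x * sin (x * z))).
      by rewrite mulN1r normrN.
    by rewrite -(RintZ _ (lsin z)); apply: eq_Rintegral => x _; ring.
Qed.

Let sin_shift xi eta : `|ct (fun x => f x * sin (x * xi)) eta| <= pair_amp xi eta /\
  `|st (fun x => f x * sin (x * xi)) eta| <= pair_amp xi eta.
Proof.
split; rewrite /ct /st; under eq_Rintegral do rewrite -mulrA.
- apply: (shift_le (h := fun x => sin (x * xi) * cos (x * eta)) (c := sin)) => //; left => x.
  by rewrite (mulrBr x) (mulrDr x) sinB sinD; field.
- apply: (shift_le (h := fun x => sin (x * xi) * sin (x * eta)) (c := cos)) => //; right => x.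
  by rewrite (mulrBr x) (mulrDr x) cosB cosD; field.
Qed.

Let kernel (z : R * R) : R := (`|z.2| * amp f z.2) * pair_amp z.1 z.2.
Let M0 : R := \int[mu]_xi amp f xi.
Let M1 : R := \int[mu]_xi (`|xi| * amp f xi).

Let la : L1 (amp f). Proof. by have [] := profile_amp pf. Qed.
Let lxa : L1 (fun xi => `|xi| * amp f xi). Proof. by have [] := profile_amp pf. Qed.

Let kernel_y eta : L1 (fun xi => kernel (xi, eta)) /\
  \int[mu]_xi kernel (xi, eta) = (`|eta| * amp f eta) * (M0 + M0).
Proof.
have [l1 i1] := Rint_shift (- eta) amp_continuous (amp_ge0 f) la.
have [l2 i2] := Rint_shift eta amp_continuous (amp_ge0 f) la.
have l : L1 (fun xi => pair_amp xi eta) by exact: L1D l1 l2.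
have i : \int[mu]_xi pair_amp xi eta = M0 + M0 by rewrite (RintD l1 l2) i1 i2.
by rewrite /kernel/=; split; [exact: L1Z|rewrite (RintZ _ l) i].
Qed.

Let kernel_ge0 xi eta : 0 <= kernel (xi, eta).
Proof. by rewrite /kernel/= mulr_ge0 ?mulr_ge0 ?addr_ge0 ?amp_ge0. Qed.

Let kernel_x xi : L1 (fun eta => kernel (xi, eta)).
Proof.
rewrite /kernel/=; apply: (L1Mb lxa (c := 4 * \int[mu]_x `|f x|)).
  have ci : continuous (fun y : R => y) by move=> y; exact: cvg_id.
  apply: continuous_measurable_fun; apply: continuous_add => y.
    apply: (@continuous_comp _ _ _ (fun y => xi - y) (amp f)); last exact: amp_continuous.
    exact: (continuous_sub (@continuous_cst R xi) ci).
  apply: (@continuous_comp _ _ _ (fun y => xi + y) (amp f)); last exact: amp_continuous.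
  exact: (continuous_add (@continuous_cst R xi) ci).
have b z : amp f z <= 2 * \int[mu]_x `|f x|.
  by rewrite mulrDl !mul1r; apply: lerD; [exact: norm_ct_le|exact: norm_st_le].
move=> y; rewrite ger0_norm ?addr_ge0 ?amp_ge0//.
by have := b (xi - y); have := b (xi + y); rewrite /pair_amp; lra.
Qed.

Let kernel_meas : measurable_fun setT kernel.
Proof.
have ma : measurable_fun setT (amp f) := L1_measurable la.
apply: measurable_funM; first exact: (measurable_snd2 (L1_measurable lxa)).
apply: measurable_funD; apply: (measurableT_comp ma).
  by apply: measurable_funB; [exact: measurable_fst|exact: measurable_snd].
by apply: measurable_funD; [exact: measurable_fst|exact: measurable_snd].
Qed.

Let kernel_int : (mu \x mu)%E.-integrable setT (EFin \o kernel).
Proof.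
apply: (prod_integrable2 kernel_meas (fun y => (kernel_y y).1)
  (g := fun eta => (M0 + M0) * (`|eta| * amp f eta))) => [y|]; last exact: L1Z.
under eq_Rintegral do rewrite ger0_norm ?kernel_ge0//.
by rewrite (kernel_y y).2 mulrC.
Qed.

Let pi2 : 0 < 2 * pi :> R. Proof. by rewrite mulr_gt0// pi_gt0. Qed.

Let main_bound (t : R -> R) xi : continuous t -> (forall x, `|t x| <= 1) ->
  (forall eta, `|ct (fun x => f x * t x) eta| <= pair_amp xi eta /\
     `|st (fun x => f x * t x) eta| <= pair_amp xi eta) ->
  `|\int[mu]_x (f x * dprofile f x * t x)| <= (2 * pi)^-1 * \int[mu]_eta kernel (xi, eta).
Proof.
move=> cont_t t1 bt; have mt := continuous_measurable_fun cont_t.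
have lt : L1 (fun x => f x * t x) by exact: L1Mb t1.
have lxt : L1 (fun x => x * (f x * t x)).
  by have := L1Mb lxf mt t1; congr L1; apply/funext => x; rewrite mulrA.
have lA := profile_st_moment pf; have lB := L1N (profile_ct_moment pf).
have -> : \int[mu]_x (f x * dprofile f x * t x) =
    (2 * pi)^-1 * \int[mu]_x (f x * t x * synth (fun xi => xi * st f xi) (fun xi => - (xi * ct f xi)) x).
  rewrite -RintegralZl//.
    by apply: eq_Rintegral => x _; rewrite /dprofile; ring.
  apply: (L1Mb lt (c := \int[mu]_xi (`|xi * st f xi| + `|- (xi * ct f xi)|))).
    by apply: continuous_measurable_fun; exact: synth_continuous.
  by move=> x; exact: synth_le.
rewrite synth_dual// normrM ger0_norm ?invr_ge0 ?(ltW pi2)// ler_wpM2l ?invr_ge0 ?(ltW pi2)//.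
have p y : `|y * st f y * ct (fun x => f x * t x) y +
    - (y * ct f y) * st (fun x => f x * t x) y| <= kernel (xi, y).
  rewrite (le_trans (ler_normD _ _))// normrM [in X in _ + X <= _]normrM normrN !normrM.
  rewrite /kernel/= /amp [X in _ <= X * _]mulrDr mulrDl addrC.
  by apply: lerD; rewrite ler_wpM2l ?mulr_ge0//; have [] := bt y.
apply: Rint_normle => //.
- apply: L1_dom (kernel_x xi) => //; apply: measurable_funD; apply: measurable_funM.
  + exact: L1_measurable lA.
  + by apply: continuous_measurable_fun; exact: ct_continuous.
  + exact: L1_measurable lB.
  + by apply: continuous_measurable_fun; exact: st_continuous.
Qed.

(** Young's inequality for the quadratic term, in the Fourier variable: the
    nonlinearity loses one derivative, which is charged to one factor only. *)
Lemma dsqr_conv :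
  let N xi := amp (fun x => f x * dprofile f x) xi in
  L1 N /\ \int[mu]_xi N xi <=
    2 / pi * (\int[mu]_xi (`|xi| * amp f xi)) * \int[mu]_xi amp f xi.
Proof.
set g := fun x => f x * dprofile f x; move=> N.
have kN xi : N xi <= pi^-1 * \int[mu]_eta kernel (xi, eta).
  have c1 := main_bound (@continuous_cosM R xi) (fun x => norm_cos_le1 _) (cos_shift xi).
  have s1 := main_bound (@continuous_sinM R xi) (fun x => norm_sin_le1 _) (sin_shift xi).
  have -> : pi^-1 * \int[mu]_eta kernel (xi, eta) =
    (2 * pi)^-1 * \int[mu]_eta kernel (xi, eta) + (2 * pi)^-1 * \int[mu]_eta kernel (xi, eta).
    have e (p k : R) : p^-1 * k = (2 * p)^-1 * k + (2 * p)^-1 * k.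
      by rewrite invfM -mulrDl -mulrDl (_ : 2^-1 + 2^-1 = 1) ?mul1r//; field.
    exact: e.
  exact: lerD.
have lK := FubiniL1 kernel_int kernel_x.
have eK : \int[mu]_xi \int[mu]_eta kernel (xi, eta) = M1 * (M0 + M0).
  rewrite (FubiniR kernel_int kernel_x (fun y => (kernel_y y).1)).
  by under eq_Rintegral do rewrite (kernel_y _).2; rewrite RintegralZr.
have cg : continuous N.
  have l2 := profile_sqr_L1 pf; have lx2 := profile_sqr_moment pf.
  have ch : continuous (fun xi : R => xi / 2).
    by apply: continuous_mul (@continuous_cst _ _) => x; exact: cvg_id.
  apply: continuous_add; apply: continuous_abs.
    have -> : ct g = (fun xi => xi / 2 * st (fun x => f x ^+ 2) xi).
      by apply/funext => z; exact: ct_dsqr.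
    by apply: continuous_mul => //; exact: st_continuous.
  have -> : st g = (fun xi => - (xi / 2 * ct (fun x => f x ^+ 2) xi)).
    by apply/funext => z; exact: st_dsqr.
  by apply: continuous_opp; apply: continuous_mul => //; exact: ct_continuous.
have lN : L1 N.
  apply: L1_dom (L1Z pi^-1 lK); first exact: continuous_measurable_fun.
  by move=> xi; rewrite ger0_norm ?amp_ge0.
split => //.
have -> : 2 / pi * M1 * M0 = pi^-1 * (M1 * (M0 + M0)) by ring.
rewrite -eK -RintegralZl//; apply: le_Rintegral => //; exact: L1Z.
Qed.

End Convolution.

(** * Joint measurability *)

Section JointMeasurability.
Context {R : realType}.
Notation mu := (@lebesgue_measure R).
Implicit Types (x y xi tau : R).

(** A function that is measurable in one variable and continuous in the other
    is jointly measurable: freeze the second variable on a grid that becomes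
    finer and finer.  The absolute value keeps the grid indexed by the
    natural numbers. *)
Lemma measurable_caratheodory (G : R -> R -> R) :
  (forall xi, continuous (G xi)) -> (forall tau, measurable_fun setT (G ^~ tau)) ->
  measurable_fun setT (fun z : R * R => G z.1 `|z.2|).
Proof.
move=> cG mG.
pose k (n : nat) (tau : R) := Num.truncn (`|tau| * n.+1%:R).
pose Gn (n : nat) (z : R * R) := G z.1 ((k n z.2)%:R / n.+1%:R).
have kP n tau : (k n tau)%:R <= `|tau| * n.+1%:R < (k n tau).+1%:R.
  by apply: truncn_itv; rewrite mulr_ge0.
have m2 n : measurable_fun setT (fun z : R * R => `|z.2| * n.+1%:R).
  apply: measurable_funM => //; apply: (measurable_snd2 (f := @Num.norm _ R)).
  exact: normr_measurable.
apply: (@measurable_fun_cvg _ _ _ setT Gn) => [n|z _].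
  pose E (i : nat) := [set z : R * R | i%:R <= `|z.2| * n.+1%:R < i.+1%:R].
  have mE i : measurable (E i).
    have := m2 n measurableT `[i%:R, i.+1%:R[%classic (measurable_itv _).
    rewrite setTI; congr measurable; apply/seteqP; split => z /=; by rewrite in_itv.
  have -> : [set: R * R] = \bigcup_i E i.
    apply/seteqP; split => // z _; exists (k n z.2) => //; exact: kP.
  apply/measurable_fun_bigcup => // i.
  apply: (@eq_measurable_fun _ _ _ _ _ (fun z : R * R => G z.1 (i%:R / n.+1%:R))).
    move=> z; rewrite inE => zE; rewrite /Gn; congr (G _ (_%:R / _)).
    by rewrite /k; apply/esym; apply: truncn_def.
  by apply: measurable_funTS; apply: (measurable_fst2 (f := G ^~ _)); exact: mG.
apply: (@cvg_comp _ _ _ (fun n => (k n z.2)%:R / n.+1%:R) (G z.1) _ (nbhs `|z.2|)); last exact: cG.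
apply/cvgrPdist_le => e e0; near=> n.
have n0 : 0 < n.+1%:R :> R by [].
have /andP[h1 h2] := kP n z.2.
have h3 : (k n z.2)%:R / n.+1%:R <= `|z.2| by rewrite ler_pdivrMr.
rewrite ger0_norm ?subr_ge0// lerBlDr.
apply: (@le_trans _ _ ((k n z.2).+1%:R / n.+1%:R)); first by rewrite ler_pdivlMr// ltW.
rewrite -natr1 mulrDl addrC lerD2r div1r; apply: ltW; near: n.
exact: (near_infty_natSinv_lt (PosNum e0)).
Unshelve. all: by end_near. Qed.

Lemma powR_abs_continuous (b : R) : 0 < b -> continuous (fun xi : R => `|xi| `^ b).
Proof.
move=> b0 x; have [->|x0] := eqVneq x 0.
  rewrite /continuous_at normr0 powR0 ?gt_eqF//.
  apply/cvgrPdist_le => e e0; have c0 : 0 < e `^ b^-1 by rewrite powR_gt0.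
  apply: (filterS _ (@nbhs0_le R R^o _ c0)) => y hy.
  rewrite sub0r normrN ger0_norm ?powR_ge0//.
  have -> : e = (e `^ b^-1) `^ b by rewrite -powRrM mulVf ?gt_eqF// powRr1// ltW.
  by rewrite ge0_ler_powR ?nnegrE ?powR_ge0// ltW.
have x1 : 0 < `|x| by rewrite normr_gt0.
apply: (@continuous_comp _ _ _ (@Num.norm _ R) (fun y : R => y `^ b)); first exact: norm_continuous.
exact: is_derive_continuous (is_derive1_powR b x1).
Qed.

End JointMeasurability.

(** * Bounded curves of profiles *)

Section Trajectories.
Context {R : realType}.
Notation mu := (@lebesgue_measure R).
Implicit Types (f g : R -> R) (x y xi t s : R).

(** A curve of profiles that is bounded and continuous for the norms at hand.
    Evenness in time is a way to have a curve on a bounded time interval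
    defined at all times. *)
Record trajectory (K : R) (v : R -> R -> R) : Prop := Trajectory {
  tr_profile : forall t, profile (v t) ;
  tr_even : forall t, v t = v `|t| ;
  tr_mass : forall t, mass (v t) <= K ;
  tr_smass : forall t, smass (v t) <= K ;
  tr_continuous : forall t (e : R), 0 < e ->
    \forall s \near t, mass (fun x => v s x - v t x) <= e }.

Lemma mass_ge0 f : 0 <= mass f.
Proof. by apply: Rintegral_ge0 => x _; rewrite mulr_ge0 ?sqr_ge0 ?ltW ?bracket4_gt0. Qed.

Lemma profile_diff_weight f g : profile f -> profile g ->
  L1 (fun x => bracket4 x * (f x - g x) ^+ 2).
Proof.
move=> pf pg; apply: L1_dom (L1D (L1Z 2 (profile_weight pf)) (L1Z 2 (profile_weight pg))).
  apply: measurable_funM; first by apply: continuous_measurable_fun; exact: continuous_bracket4.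
  apply: measurable_funX; apply: measurable_funB.
    exact: (profile_measurable pf).
  exact: (profile_measurable pg).
move=> x; have b0 := ltW (bracket4_gt0 x); rewrite (ger0_norm (mulr_ge0 b0 (sqr_ge0 _))).
rewrite [2 * (_ * _)]mulrCA [2 * (_ * g x ^+ 2)]mulrCA -mulrDr ler_wpM2l//.
by have := sqr_ge0 (f x + g x); rewrite sqrrD sqrrB; lra.
Qed.

Lemma L1_sqr_diff f g : profile f -> profile g -> L1 (fun x => (f x - g x) ^+ 2).
Proof.
move=> pf pg; apply: L1_dom (profile_diff_weight pf pg).
  apply: measurable_funX; apply: measurable_funB.
    exact: (profile_measurable pf).
  exact: (profile_measurable pg).
by move=> x; rewrite ger0_norm ?sqr_ge0// ler_peMl ?sqr_ge0// bracket4_ge1.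
Qed.

Lemma sqr_le_mass f : profile f -> \int[mu]_x f x ^+ 2 <= mass f.
Proof.
move=> pf; apply: Rint_le; [exact: profile_sqr_L1|exact: profile_weight|move=> x].
by rewrite ler_peMl ?sqr_ge0// bracket4_ge1.
Qed.

Lemma ct_diff f g xi : L1 f -> L1 g ->
  `|ct f xi - ct g xi| <= \int[mu]_x `|f x - g x|.
Proof.
move=> lf lg; rewrite -RintB; [|exact: L1_cos|exact: L1_cos].
apply: Rint_normle; [by apply: L1B; exact: L1_cos|by apply: L1_norm; exact: L1B|move=> x].
by rewrite -mulrBl normrM ler_piMr// norm_cos_le1.
Qed.

Lemma st_diff f g xi : L1 f -> L1 g ->
  `|st f xi - st g xi| <= \int[mu]_x `|f x - g x|.
Proof.
move=> lf lg; rewrite -RintB; [|exact: L1_sin|exact: L1_sin].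
apply: Rint_normle; [by apply: L1B; exact: L1_sin|by apply: L1_norm; exact: L1B|move=> x].
by rewrite -mulrBl normrM ler_piMr// norm_sin_le1.
Qed.

Definition moment f := \int[mu]_x (x * f x).

Section Trajectory.
Variables (K : R) (v : R -> R -> R).
Hypothesis tv : trajectory K v.
Let pv := tr_profile tv.
Let lv t := profile_L1 (pv t).
Let lv2 t := profile_sqr_L1 (pv t).

Lemma tr_K_ge0 : 0 <= K.
Proof. by apply: le_trans (tr_mass tv 0); exact: mass_ge0. Qed.

(** The parameter of [weight_L1] balances the norm of the difference, which
    tends to zero, against the integral of [cauchy], which does not. *)
Let near_L1x t (e : R) : 0 < e -> \forall s \near t,
  \int[mu]_x `|v t x - v s x| <= e /\ \int[mu]_x `|x * (v s x - v t x)| <= e.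
Proof.
move=> e0; have p0 : 0 < (pi : R) by exact: pi_gt0.
pose lam := e / 2 / pi; have l0 : 0 < lam by rewrite !divr_gt0.
have d0 : 0 < lam * (e / 2) by rewrite mulr_gt0// divr_gt0.
apply: (filterS _ (tr_continuous tv t d0)) => s hs.
have mf : measurable_fun setT (fun x => v s x - v t x).
  by apply: measurable_funB; apply: profile_measurable.
have [_ _ h1 h2] := weight_L1 mf (profile_diff_weight (pv s) (pv t)) l0.
under [X in X <= _ /\ _]eq_Rintegral do rewrite distrC.
have h : lam^-1 * mass (fun x => v s x - v t x) + lam * pi <= e.
  rewrite {2}/lam divfK ?gt_eqF//.
  rewrite -lerBrDr (_ : e - e / 2 = e / 2); last by field.
  by rewrite ler_pdivrMl.
by split; [apply: (le_trans h1)|apply: (le_trans h2)].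
Qed.

Let near_L1 t (e : R) : 0 < e -> \forall s \near t, \int[mu]_x `|v t x - v s x| <= e.
Proof. by move=> e0; apply: filterS (near_L1x t e0) => s []. Qed.

Let near_sqr t (e : R) : 0 < e ->
  \forall s \near t, \int[mu]_x `|v t x ^+ 2 - v s x ^+ 2| <= e.
Proof.
move=> e0; have K0 := tr_K_ge0.
have K4 : 0 < 4 * K + 1 by rewrite ltr_wpDl// mulr_ge0.
pose lam := e / 2 / (4 * K + 1); have l0 : 0 < lam by rewrite !divr_gt0.
have d0 : 0 < lam * (e / 2) by rewrite mulr_gt0// divr_gt0.
apply: (filterS _ (tr_continuous tv t d0)) => s hs.
have ld := L1_sqr_diff (pv s) (pv t).
pose b x := lam^-1 * (v s x - v t x) ^+ 2 + (lam * 2) * (v s x ^+ 2 + v t x ^+ 2).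
have l1 : L1 b by apply: L1D; apply: L1Z => //; exact: L1D.
apply: (@le_trans _ _ (\int[mu]_x b x)).
  apply: Rint_le => //; first by apply: L1_norm; exact: L1B.
  move=> x; rewrite /b subr_sqr normrM distrC.
  have -> : (v s x - v t x) ^+ 2 = `|v s x - v t x| ^+ 2 by rewrite real_normK ?num_real.
  have h : `|v t x + v s x| ^+ 2 <= 2 * (v s x ^+ 2 + v t x ^+ 2).
    rewrite real_normK ?num_real//; have := sqr_ge0 (v t x - v s x).
    by rewrite sqrrB => h; rewrite sqrrD; lra.
  have := normr_ge0 (v t x + v s x); have := normr_ge0 (v s x - v t x).
  move: (`|v s x - v t x|) (`|v t x + v s x|) h => p q h p0 q0.
  have : 0 <= lam^-1 * (p - lam / 2 * q) ^+ 2 by rewrite mulr_ge0 ?invr_ge0 ?(ltW l0)// sqr_ge0.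
  have -> : lam^-1 * (p - lam / 2 * q) ^+ 2 = lam^-1 * p ^+ 2 - p * q + lam / 4 * q ^+ 2.
    by field; rewrite gt_eqF.
  have hh : lam * q ^+ 2 <= lam * (2 * (v s x ^+ 2 + v t x ^+ 2)) by rewrite ler_wpM2l// ltW.
  have q2 : 0 <= lam * q ^+ 2 by rewrite mulr_ge0 ?sqr_ge0// ltW.
  by rewrite -[lam * 2 * _]mulrA; lra.
rewrite RintD; [|exact: L1Z|by apply: L1Z; exact: L1D].
rewrite (RintZ _ ld) (RintZ _ (L1D (lv2 s) (lv2 t))) (RintD (lv2 s) (lv2 t)).
have h1 : \int[mu]_x (v s x - v t x) ^+ 2 <= lam * (e / 2).
  apply: le_trans hs; apply: Rint_le => //; first exact: profile_diff_weight.
  by move=> x; rewrite ler_peMl ?sqr_ge0// bracket4_ge1.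
have h2 r : \int[mu]_x v r x ^+ 2 <= K.
  by apply: le_trans (tr_mass tv r); exact: sqr_le_mass.
have h3 : lam * 2 * (\int[mu]_x v s x ^+ 2 + \int[mu]_x v t x ^+ 2) <= e / 2.
  apply: (@le_trans _ _ (lam * (4 * K + 1))); last by rewrite /lam divfK// gt_eqF.
  by rewrite -mulrA ler_wpM2l ?(ltW l0)//; have := h2 s; have := h2 t; lra.
have h4 : lam^-1 * \int[mu]_x (v s x - v t x) ^+ 2 <= e / 2 by rewrite ler_pdivrMl.
by lra.
Qed.

Let time_continuous (F : (R -> R) -> R) (J : R -> R -> R) :
  (forall s t, `|F (v t) - F (v s)| <= J t s) ->
  (forall t (e : R), 0 < e -> \forall s \near t, J t s <= e) ->
  continuous (fun t => F (v t)).
Proof.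
move=> FJ nJ t; apply/cvgrPdist_le => e e0.
by apply: (filterS _ (nJ t e e0)) => s h; apply: le_trans h.
Qed.

Lemma ct_time xi : continuous (fun t => ct (v t) xi).
Proof.
apply: (time_continuous (F := ct^~ xi) _ near_L1) => s t.
exact: ct_diff.
Qed.

Lemma st_time xi : continuous (fun t => st (v t) xi).
Proof.
apply: (time_continuous (F := st^~ xi) _ near_L1) => s t.
exact: st_diff.
Qed.

Lemma moment_time : continuous (fun t => moment (v t)).
Proof.
move=> t; apply/cvgrPdist_le => e e0; apply: filterS (near_L1x t e0) => s [_].
rewrite distrC; apply: le_trans; rewrite /moment.
have lx r := profile_moment (pv r).
have E : \int[mu]_x (x * v s x) - \int[mu]_x (x * v t x) = \int[mu]_x (x * (v s x - v t x)).
  by rewrite -(RintB (lx s) (lx t)); apply: eq_Rintegral => x _; rewrite mulrBr.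
rewrite E; have l : L1 (fun x => x * (v s x - v t x)).
  by have := L1B (lx s) (lx t); congr L1; apply/funext => x; rewrite mulrBr.
by apply: Rint_normle => //; exact: L1_norm l.
Qed.

Lemma tr_int_le t : \int[mu]_x `|v t x| <= K + pi /\ \int[mu]_x `|x * v t x| <= K + pi.
Proof.
have [_ _ h1 h2] := weight_L1 (profile_measurable (pv t)) (profile_weight (pv t)) ltr01.
rewrite invr1 !mul1r in h1 h2; have := tr_mass tv t.
by split; lra.
Qed.

Lemma ct_sqr_time xi : continuous (fun t => ct (fun x => v t x ^+ 2) xi).
Proof.
apply: (time_continuous (F := fun f => ct (fun x => f x ^+ 2) xi) _ near_sqr) => s t.
exact: ct_diff.
Qed.

Lemma st_sqr_time xi : continuous (fun t => st (fun x => v t x ^+ 2) xi).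
Proof.
apply: (time_continuous (F := fun f => st (fun x => f x ^+ 2) xi) _ near_sqr) => s t.
exact: st_diff.
Qed.

Lemma energy_time : continuous (fun t => \int[mu]_x v t x ^+ 2).
Proof.
have h t : \int[mu]_x v t x ^+ 2 = ct (fun x => v t x ^+ 2) 0.
  by apply: eq_Rintegral => x _; rewrite mulr0 cos0 mulr1.
by under eq_fun do rewrite h; exact: ct_sqr_time.
Qed.

(** The Fourier transform of the nonlinearity is [FA - i FB]. *)
Definition FA t xi : R := xi / 2 * st (fun x => v t x ^+ 2) xi.
Definition FB t xi : R := - (xi / 2 * ct (fun x => v t x ^+ 2) xi).

Lemma FA_time xi : continuous (FA^~ xi).
Proof. by apply: continuous_mul; [exact: continuous_cst|exact: st_sqr_time]. Qed.

Lemma FB_time xi : continuous (FB^~ xi).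
Proof.
by apply: continuous_opp; apply: continuous_mul; [exact: continuous_cst|exact: ct_sqr_time].
Qed.

Let half_continuous : continuous (fun xi : R => xi / 2).
Proof. by apply: continuous_mul (@continuous_cst _ _) => x; exact: cvg_id. Qed.

Lemma FA_continuous t : continuous (FA t).
Proof.
apply: continuous_mul half_continuous _.
by apply: st_continuous; [exact: lv2|exact: profile_sqr_moment].
Qed.

Lemma FB_continuous t : continuous (FB t).
Proof.
apply: continuous_opp; apply: continuous_mul half_continuous _.
by apply: ct_continuous; [exact: lv2|exact: profile_sqr_moment].
Qed.

Lemma FA_even t xi : FA t (- xi) = FA t xi.
Proof. by rewrite /FA st_odd//; ring. Qed.

Lemma FB_odd t xi : FB t (- xi) = - FB t xi.
Proof. by rewrite /FB ct_even//; ring. Qed.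

Lemma ct_nonlinear t xi : ct (fun x => v t x * dprofile (v t) x) xi = FA t xi.
Proof. exact: ct_dsqr. Qed.

Lemma st_nonlinear t xi : st (fun x => v t x * dprofile (v t) x) xi = FB t xi.
Proof. exact: st_dsqr. Qed.

Definition Famp t xi : R := `|FA t xi| + `|FB t xi|.

Lemma Famp_ge0 t xi : 0 <= Famp t xi.
Proof. exact: addr_ge0. Qed.

Lemma Famp_le t xi : Famp t xi <= `|xi| * K.
Proof.
have n2 : \int[mu]_x `|v t x ^+ 2| <= K.
  apply: le_trans (tr_mass tv t); apply: le_trans (sqr_le_mass (pv t)).
  by apply: Rint_le => // [|x]; [exact: L1_norm|rewrite ger0_norm ?sqr_ge0].
have c := le_trans (norm_ct_le xi (lv2 t)) n2.
have s := le_trans (norm_st_le xi (lv2 t)) n2.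
rewrite /Famp /FA /FB normrN !normrM (_ : `|2^-1| = 2^-1); last by rewrite ger0_norm.
have cc := ler_wpM2l (normr_ge0 xi) c; have ss := ler_wpM2l (normr_ge0 xi) s.
by lra.
Qed.

Definition Fconst : R := 4 / pi * (K + pi).

Lemma Fconst_ge0 : 0 <= Fconst.
Proof.
have p0 : 0 < (pi : R) by exact: pi_gt0.
by apply: mulr_ge0; [apply: divr_ge0 => //|apply: addr_ge0; first exact: tr_K_ge0]; exact: ltW.
Qed.

(** Young's inequality, with the factor that carries the derivative bounded
    uniformly in time. *)
Lemma Famp_int t : L1 (Famp t) /\
  \int[mu]_xi Famp t xi <= Fconst * \int[mu]_xi amp (v t) xi.
Proof.
have [la lxa b0 b1] := profile_amp (pv t).
have E : amp (fun x => v t x * dprofile (v t) x) = Famp t.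
  by apply/funext => xi; rewrite /amp /Famp ct_nonlinear st_nonlinear.
have [lF bF] := dsqr_conv (pv t); rewrite E in lF bF.
split => //; apply: (le_trans bF); apply: ler_wpM2r.
  by apply: Rintegral_ge0 => xi _; exact: amp_ge0.
have p0 : 0 < (pi : R) by exact: pi_gt0.
rewrite /Fconst (_ : 4 / pi * (K + pi) = 2 / pi * (2 * (K + pi))); last by ring.
rewrite ler_wpM2l ?divr_ge0 ?(ltW p0)//.
by have := tr_smass tv t; lra.
Qed.

Lemma amp_int_le t : \int[mu]_xi amp (v t) xi <= 2 * (K + pi).
Proof.
have [_ _ b0 _] := profile_amp (pv t).
by have := tr_smass tv t; lra.
Qed.

End Trajectory.

End Trajectories.

(** * The linear flow and Duhamel's formula *)

Section Flow.
Context {R : realType}.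
Notation mu := (@lebesgue_measure R).
Implicit Types (A B : R -> R) (a r x y xi t tau : R).

Definition damp a xi : R := `|xi| `^ (1 + a).
Definition disp xi : R := xi * `|xi|.

(** [flowC a r A B - i flowS a r A B] is the product of [A - i B] and
    [exp (- r (damp a + i disp))]. *)
Definition flowC a r A B xi : R :=
  expR (- (r * damp a xi)) * (cos (r * disp xi) * A xi - sin (r * disp xi) * B xi).
Definition flowS a r A B xi : R :=
  expR (- (r * damp a xi)) * (sin (r * disp xi) * A xi + cos (r * disp xi) * B xi).

Lemma damp_ge0 a xi : 0 <= damp a xi.
Proof. exact: powR_ge0. Qed.

Lemma damp_even a xi : damp a (- xi) = damp a xi.
Proof. by rewrite /damp normrN. Qed.

Lemma disp_odd xi : disp (- xi) = - disp xi.
Proof. by rewrite /disp normrN mulNr. Qed.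

Lemma damp_continuous a : 0 < a -> continuous (damp a).
Proof. by move=> a0; apply: powR_abs_continuous; rewrite addr_gt0. Qed.

Lemma disp_continuous : continuous disp.
Proof.
have ci : continuous (fun y : R => y) by move=> y; exact: cvg_id.
exact: (continuous_mul ci (continuous_abs ci)).
Qed.

Lemma flow_le a r A B xi : 0 <= r ->
  `|flowC a r A B xi| <= `|A xi| + `|B xi| /\
  `|flowS a r A B xi| <= `|A xi| + `|B xi|.
Proof.
move=> r0; have e1 : `|expR (- (r * damp a xi))| <= 1.
  by rewrite ger0_norm ?expR_ge0// -expR0 ler_expR oppr_le0 mulr_ge0 ?damp_ge0.
have cA := ler_wpM2r (normr_ge0 (A xi)) (norm_cos_le1 (r * disp xi)).
have sA := ler_wpM2r (normr_ge0 (A xi)) (norm_sin_le1 (r * disp xi)).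
have cB := ler_wpM2r (normr_ge0 (B xi)) (norm_cos_le1 (r * disp xi)).
have sB := ler_wpM2r (normr_ge0 (B xi)) (norm_sin_le1 (r * disp xi)).
have key b c : `|b| <= `|A xi| + `|B xi| -> c = expR (- (r * damp a xi)) * b ->
    `|c| <= `|A xi| + `|B xi|.
  move=> hb ->; rewrite normrM; apply: le_trans hb.
  by rewrite -[X in _ <= X]mul1r; apply: ler_wpM2r.
split; [apply: (key _ _ _ erefl)|apply: (key _ _ _ erefl)].
  by rewrite (le_trans (ler_normB _ _))// !normrM; lra.
by rewrite (le_trans (ler_normD _ _))// !normrM; lra.
Qed.

Lemma expR_scale_continuous r (g : R -> R) : continuous g ->
  continuous (fun xi => expR (- (r * g xi))).
Proof.
move=> cg xi; apply: (@continuous_comp _ _ _ (fun xi => - (r * g xi)) expR).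
  exact: (continuous_opp (continuous_mul (@continuous_cst R r) cg)).
exact: continuous_expR.
Qed.

Lemma cos_scale_continuous r (g : R -> R) : continuous g ->
  continuous (fun xi => cos (r * g xi)).
Proof.
move=> cg xi; apply: (@continuous_comp _ _ _ (fun xi => r * g xi) cos).
  exact: (continuous_mul (@continuous_cst R r) cg).
exact: continuous_cos.
Qed.

Lemma sin_scale_continuous r (g : R -> R) : continuous g ->
  continuous (fun xi => sin (r * g xi)).
Proof.
move=> cg xi; apply: (@continuous_comp _ _ _ (fun xi => r * g xi) sin).
  exact: (continuous_mul (@continuous_cst R r) cg).
exact: continuous_sin.
Qed.

Lemma flow_continuous a r A B : 0 < a -> continuous A -> continuous B ->
  continuous (flowC a r A B) /\ continuous (flowS a r A B).
Proof.
move=> a0 cA cB; have ce := expR_scale_continuous (r := r) (damp_continuous a0).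
have cc := cos_scale_continuous (r := r) disp_continuous.
have cs := sin_scale_continuous (r := r) disp_continuous.
split; apply: continuous_mul => //.
  by apply: continuous_sub; exact: continuous_mul.
by apply: continuous_add; exact: continuous_mul.
Qed.

Lemma flow_L1 a r A B : 0 < a -> 0 <= r -> continuous A -> continuous B ->
  L1 A -> L1 B -> L1 (flowC a r A B) /\ L1 (flowS a r A B).
Proof.
move=> a0 r0 cA cB lA lB; have [c1 c2] := flow_continuous r a0 cA cB.
have l := L1D (L1_norm lA) (L1_norm lB).
split; (apply: L1_dom l; first exact: continuous_measurable_fun) => xi.
  exact: (flow_le a A B xi r0).1.
exact: (flow_le a A B xi r0).2.
Qed.

Lemma flow_parity a r A B xi : A (- xi) = A xi -> B (- xi) = - B xi ->
  flowC a r A B (- xi) = flowC a r A B xi /\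
  flowS a r A B (- xi) = - flowS a r A B xi.
Proof.
move=> eA oB; rewrite /flowC /flowS damp_even disp_odd mulrN cosN sinN eA oB.
by split; ring.
Qed.

Lemma synthB A B (A' B' : R -> R) x : L1 A -> L1 B -> L1 A' -> L1 B' ->
  synth (fun xi => A xi - A' xi) (fun xi => B xi - B' xi) x =
  synth A B x - synth A' B' x.
Proof.
move=> lA lB lA' lB'; rewrite /synth -RintB; [|exact: L1_synth|exact: L1_synth].
by apply: eq_Rintegral => xi _; ring.
Qed.

End Flow.

Section Duhamel.
Context {R : realType}.
Notation mu := (@lebesgue_measure R).
Implicit Types (x y xi t tau : R).
Variables (a T K : R) (v : R -> R -> R).
Hypothesis a0 : 0 < a.
Hypothesis tv : trajectory K v.
Let pv := tr_profile tv.
Let lv t := profile_L1 (pv t).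
Let lxv t := profile_moment (pv t).
Let cont_ct t := ct_continuous (lv t) (lxv t).
Let cont_st t := st_continuous (lv t) (lxv t).

(** The real part of the mild equation: the solution is real, and [synth] is
    the real part of the inverse Fourier transform of the flow. *)
Definition mild_trajectory := forall t x, 0 <= t <= T ->
  v t x = (2 * pi)^-1 * synth (flowC a t (ct (v 0)) (st (v 0)))
                              (flowS a t (ct (v 0)) (st (v 0))) x -
   \int[mu]_(tau in `[0%R, t]) ((2 * pi)^-1 *
      synth (flowC a (t - tau) (FA v tau) (FB v tau))
            (flowS a (t - tau) (FA v tau) (FB v tau)) x).

Let meas_F (F : R -> R -> R) : (forall tau xi, F tau xi = F `|tau| xi) ->
  (forall xi, continuous (F^~ xi)) -> (forall tau, continuous (F tau)) ->
  measurable_fun setT (fun z : R * R => F z.2 z.1).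
Proof.
move=> eF c1 c2.
have := measurable_caratheodory c1 (fun tau => continuous_measurable_fun (c2 tau)).
by congr (measurable_fun _ _); apply/funext => z; rewrite -eF.
Qed.

Let mFA : measurable_fun setT (fun z : R * R => FA v z.2 z.1).
Proof.
apply: meas_F; [by move=> tau xi; rewrite /FA -(tr_even tv)| |].
  exact: (FA_time tv).
exact: (FA_continuous tv).
Qed.

Let mFB : measurable_fun setT (fun z : R * R => FB v z.2 z.1).
Proof.
apply: meas_F; [by move=> tau xi; rewrite /FB -(tr_even tv)| |].
  exact: (FB_time tv).
exact: (FB_continuous tv).
Qed.

Lemma Famp_measurable : measurable_fun setT (fun z : R * R => Famp v z.2 z.1).
Proof. by apply: measurable_funD; apply: measurableT_comp. Qed.

Section FixedTime.
Variable t : R.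
Hypothesis t0 : 0 <= t.

Let I tau : R := \1_`[0%R, t]%classic tau.

Let lI : L1 I. Proof. exact: integrable_indic_itv. Qed.

Let I_ge0 tau : 0 <= I tau. Proof. by rewrite /I. Qed.

Let I_itv tau : I tau != 0 -> 0 <= t - tau.
Proof.
rewrite /I indicE; case: (boolP (tau \in _)) => [|_]; last by rewrite eqxx.
by rewrite inE/= in_itv/= subr_ge0 => /andP[].
Qed.

Let hC (z : R * R) : R := I z.2 * flowC a (t - z.2) (FA v z.2) (FB v z.2) z.1.
Let hS (z : R * R) : R := I z.2 * flowS a (t - z.2) (FA v z.2) (FB v z.2) z.1.

Let h_le xi tau : `|hC (xi, tau)| <= I tau * Famp v tau xi /\
  `|hS (xi, tau)| <= I tau * Famp v tau xi.
Proof.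
rewrite /hC /hS/=; have [->|/I_itv h] := eqVneq (I tau) 0.
  by rewrite !mul0r normr0.
have [c s] := flow_le a (FA v tau) (FB v tau) xi h.
have e b : `|I tau * b| = I tau * `|b| by rewrite normrM ger0_norm// I_ge0.
by rewrite !e; split; apply: (ler_wpM2l (I_ge0 tau)).
Qed.

Let m_lin : measurable_fun setT (fun z : R * R => t - z.2).
Proof. by apply: measurable_funB => //; exact: measurable_snd. Qed.

Let m_rp (g : R -> R) : continuous g -> measurable_fun setT (fun z : R * R => (t - z.2) * g z.1).
Proof.
move=> cg; apply: measurable_funM => //.
exact: (measurable_fst2 (continuous_measurable_fun cg)).
Qed.

Let m_exp : measurable_fun setT (fun z : R * R => expR (- ((t - z.2) * damp a z.1))).
Proof.
apply: measurableT_comp => //; apply: measurableT_comp => //.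
by apply: m_rp; exact: damp_continuous.
Qed.

Let m_cos : measurable_fun setT (fun z : R * R => cos ((t - z.2) * disp z.1)).
Proof.
apply: (measurableT_comp (continuous_measurable_fun (@continuous_cos R))).
by apply: m_rp; exact: disp_continuous.
Qed.

Let m_sin : measurable_fun setT (fun z : R * R => sin ((t - z.2) * disp z.1)).
Proof.
apply: (measurableT_comp (continuous_measurable_fun (@continuous_sin R))).
by apply: m_rp; exact: disp_continuous.
Qed.

Let mI : measurable_fun setT (fun z : R * R => I z.2).
Proof. exact: (measurable_snd2 (L1_measurable lI)). Qed.

Let mC : measurable_fun setT hC.
Proof.
apply: measurable_funM => //; apply: measurable_funM => //.
by apply: measurable_funB; apply: measurable_funM.
Qed.

Let mS : measurable_fun setT hS.
Proof.
apply: measurable_funM => //; apply: measurable_funM => //.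
by apply: measurable_funD; apply: measurable_funM.
Qed.

Let lF tau : L1 (fun xi => I tau * Famp v tau xi).
Proof. by apply: L1Z; have [] := Famp_int tv tau. Qed.

Let lx_ (h : R * R -> R) : measurable_fun setT h ->
  (forall xi tau, `|h (xi, tau)| <= 2 * (I tau * Famp v tau xi)) ->
  forall tau, L1 (fun xi => h (xi, tau)).
Proof.
move=> mh hh tau; apply: L1_dom (L1Z 2 (lF tau)) => //.
exact: (measurable_fun_pair1 tau mh).
Qed.

Let lt_ (h : R * R -> R) : measurable_fun setT h ->
  (forall xi tau, `|h (xi, tau)| <= 2 * (I tau * Famp v tau xi)) ->
  forall xi, L1 (fun tau => h (xi, tau)).
Proof.
move=> mh hh xi; apply: (L1_dom _ _ (L1Z (2 * (`|xi| * K)) lI)).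
  exact: (measurable_fun_pair2 xi mh).
move=> tau; rewrite (le_trans (hh _ _))// -mulrA ler_wpM2l// mulrC ler_wpM2r//.
exact: Famp_le.
Qed.

Let lz_ (h : R * R -> R) : measurable_fun setT h ->
  (forall xi tau, `|h (xi, tau)| <= 2 * (I tau * Famp v tau xi)) ->
  (mu \x mu)%E.-integrable setT (EFin \o h).
Proof.
move=> mh hh; apply: (prod_integrable2 mh (lx_ mh hh)
  (g := fun tau => (2 * (Fconst K * (2 * (K + pi)))) * I tau)); last exact: L1Z.
move=> tau; have [lf bf] := Famp_int tv tau.
apply: (@le_trans _ _ (\int[mu]_xi (2 * (I tau * Famp v tau xi)))).
  apply: Rint_le => //; first by apply: L1_norm; exact: lx_.
  exact: L1Z.
rewrite RintZ// RintZ// -mulrA ler_wpM2l// mulrC ler_wpM2r// (le_trans bf)// ler_wpM2l ?(Fconst_ge0 tv)//.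
exact: (amp_int_le tv).
Qed.

Let hC_le xi tau : `|hC (xi, tau)| <= 2 * (I tau * Famp v tau xi).
Proof.
have [h _] := h_le xi tau; apply: (le_trans h).
by rewrite ler_peMl ?ler1n// mulr_ge0 ?Famp_ge0.
Qed.

Let hS_le xi tau : `|hS (xi, tau)| <= 2 * (I tau * Famp v tau xi).
Proof.
have [_ h] := h_le xi tau; apply: (le_trans h).
by rewrite ler_peMl ?ler1n// mulr_ge0 ?Famp_ge0.
Qed.

Let DC xi := \int[mu]_tau hC (xi, tau).
Let DS xi := \int[mu]_tau hS (xi, tau).

Let lDC : L1 DC. Proof. by apply: FubiniL1; [exact: lz_|exact: lt_]. Qed.
Let lDS : L1 DS. Proof. by apply: FubiniL1; [exact: lz_|exact: lt_]. Qed.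

Let DCE xi : DC xi =
  \int[mu]_(tau in `[0%R, t]) flowC a (t - tau) (FA v tau) (FB v tau) xi.
Proof. by rewrite Rint_indic. Qed.

Let DSE xi : DS xi =
  \int[mu]_(tau in `[0%R, t]) flowS a (t - tau) (FA v tau) (FB v tau) xi.
Proof. by rewrite Rint_indic. Qed.

Let D_continuous (h : R * R -> R) : measurable_fun setT h ->
  (forall xi tau, `|h (xi, tau)| <= 2 * (I tau * Famp v tau xi)) ->
  (forall tau, continuous (fun xi => h (xi, tau))) ->
  continuous (fun xi => \int[mu]_tau h (xi, tau)).
Proof.
move=> mh hh ch xi.
have C : {in `]xi - 1, xi + 1[%classic, continuous (fun xi => \int[mu]_tau h (xi, tau))}.
  apply: (@continuity_under_integral R _ _ mu (fun xi tau => h (xi, tau)) setT measurableT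
    (xi - 1) (xi + 1) _ _ (fun tau => 2 * ((`|xi| + 1) * K) * I tau)).
  - by move=> y _; exact: lt_.
  - by apply: aeW => tau _ y _; exact: ch.
  - exact: L1Z.
  - move=> y; rewrite /= in_itv/= => /andP[y1 y2]; apply: aeW => tau _.
    rewrite (le_trans (hh _ _))// -mulrA ler_wpM2l// mulrC ler_wpM2r//.
    rewrite (le_trans (Famp_le tv _ _))//.
    rewrite ler_wpM2r ?(tr_K_ge0 tv)//.
    have -> : y = xi + (y - xi) by rewrite addrC subrK.
    by rewrite (le_trans (ler_normD _ _))// lerD2l ler_norml; apply/andP; split; lra.
by apply: C; rewrite inE/= in_itv/= ltrBlDr ltrDl ltr01.
Qed.

Let cDC : continuous DC.
Proof.
apply: D_continuous => // tau.
have c := flow_continuous (t - tau) a0 (FA_continuous tv (t := tau)) (FB_continuous tv (t := tau)).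
have := continuous_mul (@continuous_cst R (I tau)) c.1; exact.
Qed.

Let cDS : continuous DS.
Proof.
apply: D_continuous => // tau.
have c := flow_continuous (t - tau) a0 (FA_continuous tv (t := tau)) (FB_continuous tv (t := tau)).
have := continuous_mul (@continuous_cst R (I tau)) c.2; exact.
Qed.

Let layer x tau : R := synth (flowC a (t - tau) (FA v tau) (FB v tau))
  (flowS a (t - tau) (FA v tau) (FB v tau)) x.

Let synthD x : L1 (fun tau => I tau * layer x tau) /\
  synth DC DS x = \int[mu]_tau (I tau * layer x tau).
Proof.
pose h (z : R * R) := cos (x * z.1) * hC z + sin (x * z.1) * hS z.
have mc (g : R -> R) : continuous g -> measurable_fun setT (fun z : R * R => g (x * z.1)).
  move=> cg; apply: (measurable_fst2 (f := fun y => g (x * y))).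
  apply: (measurableT_comp (continuous_measurable_fun cg)).
  exact: measurable_funM.
have mh : measurable_fun setT h.
  by apply: measurable_funD; apply: measurable_funM => //; apply: mc;
    [exact: continuous_cos|exact: continuous_sin].
have hh xi tau : `|h (xi, tau)| <= 2 * (I tau * Famp v tau xi).
  have [c s] := h_le xi tau.
  have c1 := ler_wpM2r (normr_ge0 (hC (xi, tau))) (norm_cos_le1 (x * xi)).
  have s1 := ler_wpM2r (normr_ge0 (hS (xi, tau))) (norm_sin_le1 (x * xi)).
  have := ler_normD (cos (x * xi) * hC (xi, tau)) (sin (x * xi) * hS (xi, tau)).
  by rewrite /h/= (normrM (cos _)) (normrM (sin _)); lra.
have E tau : I tau * layer x tau = \int[mu]_xi h (xi, tau); last first.
  split; first by under eq_fun do rewrite E; apply: FubiniL1r; [exact: lz_|exact: lx_].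
  under [RHS]eq_Rintegral do rewrite E.
  rewrite -(FubiniR (lz_ mh hh) (lt_ mh hh) (lx_ mh hh)).
  apply: eq_Rintegral => xi _; rewrite /h/= RintD.
  - by rewrite !RintZ//; exact: lt_.
  - by apply: L1Z; exact: lt_.
  - by apply: L1Z; exact: lt_.
have [I0|/I_itv h0] := eqVneq (I tau) 0.
  rewrite I0 mul0r; under eq_Rintegral do rewrite /h /hC /hS/= I0 !mul0r !mulr0 addr0.
  by rewrite Rintegral_cst// mul0r.
have [lf _] := Famp_int tv tau.
have lA : L1 (FA v tau).
  apply: L1_dom lf; first exact: continuous_measurable_fun (FA_continuous tv (t := tau)).
  by move=> y; rewrite /Famp lerDl.
have lB : L1 (FB v tau).
  apply: L1_dom lf; first exact: continuous_measurable_fun (FB_continuous tv (t := tau)).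
  by move=> y; rewrite /Famp lerDr.
have [l1 l2] := flow_L1 a0 h0 (FA_continuous tv (t := tau)) (FB_continuous tv (t := tau)) lA lB.
rewrite /layer /synth -RintZ; last exact: L1_synth.
by apply: eq_Rintegral => xi _; rewrite /h /hC /hS/=; ring.
Qed.

(** Both sides of the mild equation are inverse Fourier transforms of
    continuous integrable functions, which therefore agree. *)
Lemma duhamel_fourier : mild_trajectory -> t <= T -> forall xi,
  ct (v t) xi = flowC a t (ct (v 0)) (st (v 0)) xi -
    \int[mu]_(tau in `[0%R, t]) flowC a (t - tau) (FA v tau) (FB v tau) xi /\
  st (v t) xi = flowS a t (ct (v 0)) (st (v 0)) xi -
    \int[mu]_(tau in `[0%R, t]) flowS a (t - tau) (FA v tau) (FB v tau) xi.
Proof.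
move=> mild tT.
have lc s := profile_ct_L1 (pv s); have ls s := profile_st_L1 (pv s).
have [f1 f2] := flow_L1 a0 t0 (@cont_ct 0) (@cont_st 0) (lc 0) (ls 0).
have [c1 c2] := flow_continuous t a0 (@cont_ct 0) (@cont_st 0).
pose GA xi := flowC a t (ct (v 0)) (st (v 0)) xi - DC xi.
pose GB xi := flowS a t (ct (v 0)) (st (v 0)) xi - DS xi.
have lGA : L1 GA by exact: L1B.
have lGB : L1 GB by exact: L1B.
have F_par tau xi r := @flow_parity R a r (FA v tau) (FB v tau) xi
  (FA_even tv tau xi) (FB_odd v tau xi).
have par xi := @flow_parity R a t (ct (v 0)) (st (v 0)) xi
  (ct_even (v 0) xi) (st_odd xi (lv 0)).
have [] := @synth_inj R (fun xi => ct (v t) xi - GA xi) (fun xi => st (v t) xi - GB xi).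
- exact: L1B.
- exact: L1B.
- by apply: continuous_sub => //; exact: continuous_sub.
- by apply: continuous_sub => //; exact: continuous_sub.
- move=> xi; rewrite ct_even /GA (par xi).1; congr (_ - (_ - _)).
  by apply: eq_Rintegral => tau _; rewrite /hC/= (F_par tau xi _).1.
- move=> xi; rewrite st_odd// /GB (par xi).2.
  have -> : DS (- xi) = - DS xi.
    rewrite -[RHS]mulN1r -RintZ; last exact: lt_.
    by apply: eq_Rintegral => tau _; rewrite /hS/= (F_par tau xi _).2; ring.
  by ring.
- move=> x; have [lx ex] := synthD x; rewrite synthB// synthB// ex.
  have p0 : (2 * pi : R) != 0 by rewrite gt_eqF// mulr_gt0// pi_gt0.
  have := profile_synth (pv t) x; rewrite mild ?t0//.
  rewrite Rint_indic; under [X in _ - X]eq_Rintegral do rewrite mulrCA.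
  rewrite RintZ// -mulrBr => /(mulfI (invr_neq0 p0)) ->.
  by rewrite subrr.
move=> A0 B0; move=> xi; split.
  by apply/eqP; rewrite -subr_eq0 -DCE; apply/eqP; exact: A0.
by apply/eqP; rewrite -subr_eq0 -DSE; apply/eqP; exact: B0.
Qed.

End FixedTime.
End Duhamel.

(** * The equation at a fixed frequency *)

Section Increments.
Context {R : realType}.
Notation mu := (@lebesgue_measure R).
Implicit Types (x y xi s t tau : R).
Variables (a T K : R) (v : R -> R -> R).
Hypothesis a0 : 0 < a.
Hypothesis tv : trajectory K v.
Hypothesis mild : mild_trajectory a T v.
Let cid : continuous (fun y : R => y). Proof. by move=> y; exact: cvg_id. Qed.

(** Minus the time derivative of the Fourier transform, in the frame that
    moves with the linear flow. *)
Definition movC a v xi tau : R := expR (tau * damp a xi) *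
  (cos (tau * disp xi) * FA v tau xi + sin (tau * disp xi) * FB v tau xi).
Definition movS a v xi tau : R := expR (tau * damp a xi) *
  (cos (tau * disp xi) * FB v tau xi - sin (tau * disp xi) * FA v tau xi).

Let scale_continuous (f : R -> R) b : continuous f -> continuous (fun tau => f (tau * b)).
Proof.
move=> cf tau; apply: (@continuous_comp _ _ _ (fun tau => tau * b) f); last exact: cf.
exact: (continuous_mul cid (@continuous_cst R b)).
Qed.

Let cFA xi : continuous (FA v ^~ xi). Proof. exact: (FA_time tv). Qed.
Let cFB xi : continuous (FB v ^~ xi). Proof. exact: (FB_time tv). Qed.

Lemma movC_continuous xi : continuous (movC a v xi).
Proof.
apply: continuous_mul; first by apply: scale_continuous; exact: continuous_expR.
apply: continuous_add; apply: continuous_mul => //; apply: scale_continuous.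
  exact: continuous_cos.
exact: continuous_sin.
Qed.

Lemma movS_continuous xi : continuous (movS a v xi).
Proof.
apply: continuous_mul; first by apply: scale_continuous; exact: continuous_expR.
apply: continuous_sub; apply: continuous_mul => //; apply: scale_continuous.
  exact: continuous_cos.
exact: continuous_sin.
Qed.

Definition movX a v xi t : R := ct (v 0) xi - \int[mu]_(tau in `[0%R, t]) movC a v xi tau.
Definition movY a v xi t : R := st (v 0) xi - \int[mu]_(tau in `[0%R, t]) movS a v xi tau.

Let ir (f : R -> R) (p q : R) : continuous f -> mu.-integrable `[p, q] (EFin \o f).
Proof. exact: continuous_itv_integrable. Qed.

(** Undoing damping and rotation leaves a primitive of a continuous function
    of time.  This is what makes the transforms differentiable in time. *)
Lemma moving_frame xi t : 0 <= t <= T ->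
  ct (v t) xi = expR (- (t * damp a xi)) *
    (cos (t * disp xi) * movX a v xi t - sin (t * disp xi) * movY a v xi t) /\
  st (v t) xi = expR (- (t * damp a xi)) *
    (sin (t * disp xi) * movX a v xi t + cos (t * disp xi) * movY a v xi t).
Proof.
move=> /andP[t0 tT]; have [-> ->] := duhamel_fourier a0 tv t0 mild tT xi.
have iC := ir 0 t (@movC_continuous xi); have iS := ir 0 t (@movS_continuous xi).
have mI : measurable (`[0%R, t]%classic : set (measurableTypeR R)) by [].
pose e := expR (- (t * damp a xi)).
have eE tau : expR (- ((t - tau) * damp a xi)) = e * expR (tau * damp a xi).
  by rewrite /e -expRD; congr expR; ring.
have -> : \int[mu]_(tau in `[0%R, t]) flowC a (t - tau) (FA v tau) (FB v tau) xi =
    e * cos (t * disp xi) * \int[mu]_(tau in `[0%R, t]) movC a v xi tau -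
    e * sin (t * disp xi) * \int[mu]_(tau in `[0%R, t]) movS a v xi tau.
  rewrite -(RintegralZl _ mI iC) -(RintegralZl _ mI iS) -RintegralB//.
  - apply: eq_Rintegral => tau _; rewrite /flowC eE mulrBl cosB sinB /movC /movS.
    by ring.
  - by apply: ir; apply: continuous_mul (@continuous_cst _ _) (@movC_continuous xi).
  - by apply: ir; apply: continuous_mul (@continuous_cst _ _) (@movS_continuous xi).
have -> : \int[mu]_(tau in `[0%R, t]) flowS a (t - tau) (FA v tau) (FB v tau) xi =
    e * sin (t * disp xi) * \int[mu]_(tau in `[0%R, t]) movC a v xi tau +
    e * cos (t * disp xi) * \int[mu]_(tau in `[0%R, t]) movS a v xi tau.
  rewrite -(RintegralZl _ mI iC) -(RintegralZl _ mI iS) -RintegralD//.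
  - apply: eq_Rintegral => tau _; rewrite /flowS eE mulrBl cosB sinB /movC /movS.
    by ring.
  - by apply: ir; apply: continuous_mul (@continuous_cst _ _) (@movC_continuous xi).
  - by apply: ir; apply: continuous_mul (@continuous_cst _ _) (@movS_continuous xi).
by rewrite /flowC /flowS /movX /movY -/e; split; ring.
Qed.

Let prim_derive (f : R -> R) t : continuous f -> 0 < t ->
  is_derive t 1 (fun t => \int[mu]_(tau in `[0%R, t]) f tau) (f t).
Proof.
move=> cf t0; have t1 : t < t + 1 by rewrite ltrDl.
have [d e] := @continuous_FTC1_closed R f 0 t (t + 1) t1 (ir 0 (t + 1) cf) t0 (cf t).
by apply: (DeriveDef d); rewrite -derive1E; exact: e.
Qed.

Let movX_derive xi t : 0 < t -> is_derive t 1 (movX a v xi) (- movC a v xi t).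
Proof.
move=> t0; have d := prim_derive (@movC_continuous xi) t0.
apply: is_derive_eq (is_derive_sub (is_derive_cst (ct (v 0) xi) t 1) d) _.
by rewrite sub0r.
Qed.

Let movY_derive xi t : 0 < t -> is_derive t 1 (movY a v xi) (- movS a v xi t).
Proof.
move=> t0; have d := prim_derive (@movS_continuous xi) t0.
apply: is_derive_eq (is_derive_sub (is_derive_cst (st (v 0) xi) t 1) d) _.
by rewrite sub0r.
Qed.

Let trigD xi t :
  [/\ is_derive t 1 (fun t => expR (- damp a xi * t)) (- damp a xi * expR (- damp a xi * t)),
      is_derive t 1 (fun t => cos (disp xi * t)) (disp xi * - sin (disp xi * t))
    & is_derive t 1 (fun t => sin (disp xi * t)) (disp xi * cos (disp xi * t))].
Proof.
split.
- exact: is_derive_comp_scale (is_derive_expR _).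
- exact: is_derive_comp_scale (is_derive_cos _).
- exact: is_derive_comp_scale (is_derive_sin _).
Qed.

Let one xi t : expR (- damp a xi * t) * expR (t * damp a xi) = 1.
Proof. by rewrite -expRD (_ : _ + _ = 0) ?expR0//; ring. Qed.

Let sq xi t : cos (disp xi * t) ^+ 2 + sin (disp xi * t) ^+ 2 = 1.
Proof. exact: cos2Dsin2. Qed.

Let near_T t : 0 < t < T -> \forall s \near t, 0 <= s <= T.
Proof.
move=> tT; have : \forall s \near t, s \in `]0, T[ by apply: near_in_itvoo; rewrite in_itv.
by apply: filterS => s; rewrite in_itv/= => /andP[/ltW -> /ltW ->].
Qed.

Lemma ct_derive xi t : 0 < t < T -> is_derive t 1 (fun t => ct (v t) xi)
  (- (damp a xi * ct (v t) xi + disp xi * st (v t) xi + FA v t xi)).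
Proof.
move=> tT; have /andP[t0 tT'] := tT.
have tI : 0 <= t <= T by rewrite !ltW.
apply: (@near_eq_is_derive _ _ _ (fun t => expR (- damp a xi * t) *
  (cos (disp xi * t) * movX a v xi t - sin (disp xi * t) * movY a v xi t))).
  apply: (filterS _ (near_T tT)) => s /(moving_frame xi)[-> _].
  by rewrite mulNr ![_ * s]mulrC.
have [de dc ds] := trigD xi t.
have dX := movX_derive xi t0; have dY := movY_derive xi t0.
apply: is_derive_eq (is_derive_mul de (is_derive_sub (is_derive_mul dc dX) (is_derive_mul ds dY))) _.
have [-> ->] := moving_frame xi tI.
have E : FA v t xi = expR (- damp a xi * t) * (cos (disp xi * t) * movC a v xi t - sin (disp xi * t) * movS a v xi t).
  rewrite -[LHS]mul1r -(sq xi t) -[_ ^+ 2 + _]mul1r -(one xi t) /movC /movS ![t * disp xi]mulrC; ring.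
by rewrite E ![t * _]mulrC mulNr; ring.
Qed.

Lemma st_derive xi t : 0 < t < T -> is_derive t 1 (fun t => st (v t) xi)
  (- (damp a xi * st (v t) xi - disp xi * ct (v t) xi + FB v t xi)).
Proof.
move=> tT; have /andP[t0 tT'] := tT.
have tI : 0 <= t <= T by rewrite !ltW.
apply: (@near_eq_is_derive _ _ _ (fun t => expR (- damp a xi * t) *
  (sin (disp xi * t) * movX a v xi t + cos (disp xi * t) * movY a v xi t))).
  apply: (filterS _ (near_T tT)) => s /(moving_frame xi)[_ ->].
  by rewrite mulNr ![_ * s]mulrC.
have [de dc ds] := trigD xi t.
have dX := movX_derive xi t0; have dY := movY_derive xi t0.
apply: is_derive_eq (is_derive_mul de (is_derive_add (is_derive_mul ds dX) (is_derive_mul dc dY))) _.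
have [-> ->] := moving_frame xi tI.
have E : FB v t xi = expR (- damp a xi * t) * (sin (disp xi * t) * movC a v xi t + cos (disp xi * t) * movS a v xi t).
  rewrite -[LHS]mul1r -(sq xi t) -[_ ^+ 2 + _]mul1r -(one xi t) /movC /movS ![t * disp xi]mulrC; ring.
by rewrite E ![t * _]mulrC mulNr; ring.
Qed.

Let rateC xi : continuous (fun tau => damp a xi * ct (v tau) xi + disp xi * st (v tau) xi + FA v tau xi).
Proof.
apply: continuous_add; last exact: cFA.
apply: continuous_add; apply: (continuous_mul (@continuous_cst _ _)).
  exact: (ct_time tv).
exact: (st_time tv).
Qed.

Let rateS xi : continuous (fun tau => damp a xi * st (v tau) xi - disp xi * ct (v tau) xi + FB v tau xi).
Proof.
apply: continuous_add; last exact: cFB.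
apply: continuous_sub; apply: (continuous_mul (@continuous_cst _ _)).
  exact: (st_time tv).
exact: (ct_time tv).
Qed.

Lemma Rint_itvN (f : R -> R) s t : continuous f ->
  \int[mu]_(tau in `[s, t]) (- f tau) = - \int[mu]_(tau in `[s, t]) f tau.
Proof.
move=> cf; rewrite -mulN1r -RintegralZl//; last exact: ir.
by apply: eq_Rintegral => tau _; rewrite mulN1r.
Qed.

Lemma ct_increment xi s t : 0 <= s -> s < t -> t <= T ->
  ct (v t) xi - ct (v s) xi = - \int[mu]_(tau in `[s, t])
    (damp a xi * ct (v tau) xi + disp xi * st (v tau) xi + FA v tau xi).
Proof.
move=> s0 sltt tT; rewrite -(Rint_itvN _ _ (@rateC xi)); apply/esym; apply: (Rint_FTC2 (F := fun t => ct (v t) xi)) => //.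
- exact: continuous_opp (@rateC xi).
- exact: (ct_time tv).
- move=> tau /andP[h1 h2]; apply: ct_derive; apply/andP; split.
    exact: le_lt_trans h1.
  exact: lt_le_trans tT.
Qed.

Lemma st_increment xi s t : 0 <= s -> s < t -> t <= T ->
  st (v t) xi - st (v s) xi = - \int[mu]_(tau in `[s, t])
    (damp a xi * st (v tau) xi - disp xi * ct (v tau) xi + FB v tau xi).
Proof.
move=> s0 sltt tT; rewrite -(Rint_itvN _ _ (@rateS xi)); apply/esym; apply: (Rint_FTC2 (F := fun t => st (v t) xi)) => //.
- exact: continuous_opp (@rateS xi).
- exact: (st_time tv).
- move=> tau /andP[h1 h2]; apply: st_derive; apply/andP; split.
    exact: le_lt_trans h1.
  exact: lt_le_trans tT.
Qed.

End Increments.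

(** * Forward uniqueness *)

Section ForwardUniqueness.
Context {R : realType}.
Notation mu := (@lebesgue_measure R).
Implicit Types (x y xi s t tau : R).
Variables (a T K : R) (v : R -> R -> R).
Hypothesis a0 : 0 < a.
Hypothesis tv : trajectory K v.
Hypothesis mild : mild_trajectory a T v.
Variable tb : R.
Hypothesis tb0 : 0 <= tb.
Hypothesis v0 : forall x, v tb x = 0.
Let pv := tr_profile tv.

Let ct0 xi : ct (v tb) xi = 0.
Proof.
rewrite /ct; under eq_Rintegral do rewrite v0 mul0r.
by rewrite Rintegral_cst// mul0r.
Qed.

Let st0 xi : st (v tb) xi = 0.
Proof.
rewrite /st; under eq_Rintegral do rewrite v0 mul0r.
by rewrite Rintegral_cst// mul0r.
Qed.

Let mov0 xi : tb <= T -> movX a v xi tb = 0 /\ movY a v xi tb = 0.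
Proof.
move=> tbT; have tI : 0 <= tb <= T by rewrite tb0.
have [] := moving_frame a0 tv mild xi tI; rewrite ct0 st0.
set e := expR _; set c := cos _; set s := sin _; set X := movX _ _ _ _; set Y := movY _ _ _ _.
have e0 : e != 0 by rewrite gt_eqF// expR_gt0.
move=> /esym/eqP; rewrite mulf_eq0 (negbTE e0)/= => /eqP h1.
move=> /esym/eqP; rewrite mulf_eq0 (negbTE e0)/= => /eqP h2.
have cs : c ^+ 2 + s ^+ 2 = 1 by exact: cos2Dsin2.
split.
- transitivity ((c ^+ 2 + s ^+ 2) * X); first by rewrite cs mul1r.
  transitivity (c * (c * X - s * Y) + s * (s * X + c * Y)); first by ring.
  by rewrite h1 h2 !mulr0 addr0.
- transitivity ((c ^+ 2 + s ^+ 2) * Y); first by rewrite cs mul1r.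
  transitivity (c * (s * X + c * Y) - s * (c * X - s * Y)); first by ring.
  by rewrite h1 h2 !mulr0 subr0.
Qed.

Let ir (f : R -> R) (p q : R) : continuous f -> mu.-integrable `[p, q] (EFin \o f).
Proof. exact: continuous_itv_integrable. Qed.

Let itvB (f : R -> R) t : continuous f -> tb <= t ->
  \int[mu]_(tau in `[0%R, t]) f tau - \int[mu]_(tau in `[0%R, tb]) f tau =
  \int[mu]_(tau in `[tb, t]) f tau.
Proof.
move=> cf tbt; rewrite Rintegral_itvB ?bnd_simp//; last exact: ir.
rewrite Rintegral_itv_obnd_cbnd//; apply: integrableS (ir tb t cf) => //.
exact: subset_itv_oc_cc.
Qed.

Let Famp_time xi : continuous (fun tau => Famp v tau xi).
Proof.
by apply: continuous_add; apply: continuous_abs; [exact: (FA_time tv)|exact: (FB_time tv)].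
Qed.

Let cC xi : continuous (movC a v xi). Proof. exact: (movC_continuous tv). Qed.
Let cS xi : continuous (movS a v xi). Proof. exact: (movS_continuous tv). Qed.

Let mov_le xi (M : R -> R) t : (forall tau, `|M tau| <= expR (tau * damp a xi) * Famp v tau xi) ->
  continuous M -> tb <= t ->
  `|\int[mu]_(tau in `[tb, t]) M tau| <=
    expR (t * damp a xi) * \int[mu]_(tau in `[tb, t]) Famp v tau xi.
Proof.
move=> hM cM tbt; have mI : measurable (`[tb, t]%classic : set (measurableTypeR R)) by [].
rewrite -(RintegralZl _ mI (ir tb t (@Famp_time xi))).
apply: (le_trans (le_normr_Rintegral _ (ir tb t cM))) => //; apply: le_Rintegral => //.
- by apply: (ir (f := fun x => `|M x|)); exact: continuous_abs.
- apply: (ir (f := fun x => expR (t * damp a xi) * Famp v x xi)).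
  exact: (continuous_mul (@continuous_cst R (expR (t * damp a xi))) (@Famp_time xi)).
- move=> tau; rewrite /= in_itv/= => /andP[_ taut]; apply: (le_trans (hM tau)).
  by rewrite ler_wpM2r ?Famp_ge0// ler_expR ler_wpM2r// damp_ge0.
Qed.

Let rot_le (e p q A B : R) : 0 <= e -> `|e * (cos p * A + sin q * B)| <= e * (`|A| + `|B|).
Proof.
move=> e0; rewrite normrM (ger0_norm e0) ler_wpM2l// (le_trans (ler_normD _ _))//.
by rewrite !normrM; apply: lerD; rewrite ler_piMl ?norm_cos_le1 ?norm_sin_le1.
Qed.

(** The weight [expR (tau * damp a xi)] of the moving frame is largest at the
    final time, where it is undone: damping can only help. *)
Let amp_le xi t : tb <= t -> t <= T ->
  amp (v t) xi <= 4 * \int[mu]_(tau in `[tb, t]) Famp v tau xi.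
Proof.
move=> tbt tT; have tI : 0 <= t <= T by rewrite tT (le_trans tb0).
have [X0 Y0] := mov0 xi (le_trans tbt tT).
set J := \int[mu]_(tau in _) _; set E := expR (t * damp a xi).
have Xt : `|movX a v xi t| <= E * J.
  have -> : movX a v xi t = - \int[mu]_(tau in `[tb, t]) movC a v xi tau.
    rewrite -[LHS]subr0 -X0 -(itvB (@cC xi) tbt) /movX; ring.
  rewrite normrN; apply: mov_le => // tau.
  exact: rot_le (expR_ge0 _).
have Yt : `|movY a v xi t| <= E * J.
  have -> : movY a v xi t = - \int[mu]_(tau in `[tb, t]) movS a v xi tau.
    rewrite -[LHS]subr0 -Y0 -(itvB (@cS xi) tbt) /movY; ring.
  rewrite normrN; apply: mov_le => // tau.
  rewrite /movS -mulrN; apply: (le_trans (rot_le _ _ _ _ (expR_ge0 _))).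
  by rewrite (normrN (FA _ _ _)) /Famp [X in _ * X <= _]addrC.
have eE : expR (- (t * damp a xi)) * E = 1 by rewrite -expRD addNr expR0.
have [c s] := moving_frame a0 tv mild xi tI.
have e0 := expR_ge0 (- (t * damp a xi)).
have bnd b : `|b| <= expR (- (t * damp a xi)) * (`|movX a v xi t| + `|movY a v xi t|) ->
    `|b| <= 2 * J.
  move=> h; apply: (le_trans h).
  apply: (@le_trans _ _ (expR (- (t * damp a xi)) * (E * J + E * J))).
    by rewrite ler_wpM2l// lerD.
  rewrite mulrDr mulrA eE mul1r; lra.
have -> : 4 * J = 2 * J + 2 * J by ring.
apply: lerD; apply: bnd.
  rewrite c -(mulrN (sin _)); apply: (le_trans (rot_le _ _ _ _ e0)).
  by rewrite normrN.
rewrite s [X in _ * X]addrC; apply: (le_trans (rot_le _ _ _ _ e0)).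
by rewrite [X in _ * X <= _]addrC.
Qed.

Let n t : R := \int[mu]_xi amp (v t) xi.

Let n_ge0 t : 0 <= n t.
Proof. by apply: Rintegral_ge0 => xi _; exact: amp_ge0. Qed.

(** The nonlinearity is bounded by the norm [n] of the solution itself, with a
    constant that does not depend on time. *)
Let n_step t (g : R -> R) : tb < t -> t <= T -> continuous g ->
  (forall tau, tb <= tau <= t -> n tau <= g tau) ->
  n t <= 4 * Fconst K * \int[mu]_(tau in `[tb, t]) g tau.
Proof.
move=> tbt tT cg ng; pose I tau : R := \1_`[tb, t]%classic tau.
have lI : L1 I by exact: integrable_indic_itv.
have I0 tau : 0 <= I tau by rewrite /I.
pose h (z : R * R) := I z.2 * Famp v z.2 z.1.
have mh : measurable_fun setT h.
  apply: measurable_funM; first exact: (measurable_snd2 (L1_measurable lI)).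
  exact: (Famp_measurable tv).
have lx tau : L1 (fun xi => h (xi, tau)).
  by rewrite /h/=; apply: L1Z; have [] := Famp_int tv tau.
have lt xi : L1 (fun tau => h (xi, tau)).
  by rewrite /h/=; apply: L1_indic => //; exact: ir (@Famp_time xi).
have bx tau : \int[mu]_xi h (xi, tau) <= I tau * (Fconst K * n tau).
  have [lf bf] := Famp_int tv tau.
  by rewrite /h/= RintZ// ler_wpM2l.
have h0 xi tau : 0 <= h (xi, tau) by rewrite /h mulr_ge0 ?Famp_ge0.
have ih : (mu \x mu)%E.-integrable setT (EFin \o h).
  apply: (prod_integrable2 mh lx (g := fun tau => (Fconst K * (2 * (K + pi))) * I tau)).
    move=> tau; under eq_Rintegral do rewrite ger0_norm//.
    apply: (le_trans (bx tau)); rewrite mulrC ler_wpM2r// ler_wpM2l ?(Fconst_ge0 tv)//.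
    exact: (amp_int_le tv).
  exact: L1Z.
have [la _ _ _] := profile_amp (pv t).
have E := FubiniR ih lt lx.
have l1 := FubiniL1 ih lt; have l2 := FubiniL1r ih lx.
apply: (@le_trans _ _ (4 * \int[mu]_xi \int[mu]_tau h (xi, tau))).
  rewrite -(RintZ 4 l1); apply: (Rint_le la (L1Z 4 l1)) => xi.
  have -> : \int[mu]_tau h (xi, tau) = \int[mu]_(tau in `[tb, t]) Famp v tau xi.
    by rewrite [RHS]Rint_indic.
  exact: amp_le (ltW tbt) tT.
have mI : measurable (`[tb, t]%classic : set (measurableTypeR R)) by [].
have lg := L1_indic mI (ir tb t cg).
rewrite E (Rint_indic `[tb, t]%classic g) -[X in _ <= X]mulrA; apply: ler_wpM2l; first exact: ler0n.
have := Rint_le l2 (L1Z (Fconst K) lg); rewrite (RintZ _ lg); apply.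
move=> tau; apply: (le_trans (bx tau)); rewrite [X in X <= _]mulrCA.
apply: (ler_wpM2l (Fconst_ge0 tv)); rewrite /I indicE.
case: (boolP (tau \in _)) => [|_]; last by rewrite !mul0r.
by rewrite inE/= in_itv/= !mul1r => /ng.
Qed.

(** Gronwall's lemma by iteration of [n_step]: integrating the exponential
    weight, whose rate is more than twice the constant of [n_step], gains a
    factor 1/2 each time. *)
Let n_decay (k : nat) : forall t, tb <= t <= T ->
  n t <= 2 * (K + pi) / 2 ^+ k * expR ((8 * Fconst K + 1) * t).
Proof.
have F0 := Fconst_ge0 tv; have p0 := @pi_gt0 R; have K0 := tr_K_ge0 tv.
set lam := 8 * Fconst K + 1; have l0 : 0 < lam by rewrite /lam ltr_wpDl// mulr_ge0.
set B := 2 * (K + pi); have B0 : 0 <= B by rewrite /B mulr_ge0// addr_ge0// ltW.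
elim: k => [|k IH] t /andP[tbt tT].
  rewrite expr0 divr1; apply: (le_trans (amp_int_le tv t)); rewrite -/B ler_peMr//.
  by rewrite -expR0 ler_expR mulr_ge0 ?(ltW l0)// (le_trans tb0).
have D0 j : 0 <= B / 2 ^+ j by rewrite divr_ge0// exprn_ge0.
move: tbt; rewrite le_eqVlt => /predU1P[<-|tbt].
  have -> : n tb = 0.
    rewrite /n /amp; under eq_Rintegral do rewrite ct0 st0 normr0 addr0.
    by rewrite Rintegral_cst// mul0r.
  by rewrite mulr_ge0// expR_ge0.
pose g tau := B / 2 ^+ k * expR (lam * tau).
have ce : continuous (fun tau => expR (lam * tau)).
  by move=> y; exact: is_derive_continuous (is_derive_comp_scale (is_derive_expR _)).
have cg : continuous g by exact: (continuous_mul (@continuous_cst R _) ce).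
apply: (le_trans (n_step tbt tT cg _)).
  by move=> tau /andP[h1 h2]; apply: IH; rewrite h1 (le_trans h2).
have -> : \int[mu]_(tau in `[tb, t]) g tau =
    lam^-1 * (B / 2 ^+ k) * expR (lam * t) - lam^-1 * (B / 2 ^+ k) * expR (lam * tb).
  apply: (Rint_FTC2 (F := fun t => lam^-1 * (B / 2 ^+ k) * expR (lam * t))) => //.
    exact: (continuous_mul (@continuous_cst R _) ce).
  move=> x _; have d := is_derive_scale (lam^-1 * (B / 2 ^+ k)) (is_derive_comp_scale (is_derive_expR (lam * x))).
  apply: is_derive_eq d _; rewrite /g; move: (B / 2 ^+ k) => D.
  by field; rewrite gt_eqF.
apply: (@le_trans _ _ (4 * Fconst K * (lam^-1 * (B / 2 ^+ k) * expR (lam * t)))).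
  apply: ler_wpM2l; first exact: mulr_ge0.
  rewrite gerBl; apply: mulr_ge0; last exact: expR_ge0.
  by apply: mulr_ge0; [rewrite invr_ge0 ltW|exact: D0].
have -> : B / 2 ^+ k.+1 = 2^-1 * (B / 2 ^+ k) by rewrite exprS invfM; ring.
move: (B / 2 ^+ k) (D0 k) => D Dk.
move: (expR (lam * t)) (expR_ge0 (lam * t)) => Ex Ex0.
have -> : 4 * Fconst K * (lam^-1 * D * Ex) = 4 * Fconst K / lam * D * Ex by ring.
apply: (ler_wpM2r Ex0); apply: (ler_wpM2r Dk).
by rewrite ler_pdivrMr// /lam; lra.
Qed.

Lemma forward_uniqueness t x : tb <= t <= T -> v t x = 0.
Proof.
move=> tI; have n0 : n t = 0.
  apply/eqP; rewrite eq_le n_ge0 andbT.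
  set C := 2 * (K + pi) * expR ((8 * Fconst K + 1) * t).
  have h : (fun k => C * (2^-1 : R) ^+ k) @ \oo --> C * 0.
    by apply: cvgMr; apply: cvg_expr; rewrite ger0_norm// invf_lt1// ltr1n.
  rewrite mulr0 in h; rewrite -(cvg_lim (@Rhausdorff R) h).
  apply: limr_ge; first by apply/cvg_ex; exists 0.
  near=> k; apply: (le_trans (n_decay k tI)).
  by rewrite /C exprVn mulrAC.
have lc := profile_ct_L1 (pv t); have ls := profile_st_L1 (pv t).
rewrite (profile_synth (pv t) x); apply/eqP; rewrite mulf_eq0; apply/orP; right.
by rewrite -normr_le0 (le_trans (synth_le x lc ls))// -/(n t) n0.
Unshelve. all: by end_near. Qed.

End ForwardUniqueness.

(** * Spatial decay and cancellation at low frequency *)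

Section SpatialDecay.
Context {R : realType}.
Notation mu := (@lebesgue_measure R).
Implicit Types (f g h : R -> R) (a x y xi theta : R).

Lemma Rint_dominated (fn : nat -> R -> R) f g : (forall n, measurable_fun setT (fn n)) ->
  L1 g -> (forall n x, `|fn n x| <= g x) -> (forall x, fn n x @[n --> \oo] --> f x) ->
  \int[mu]_x fn n x @[n --> \oo] --> \int[mu]_x f x.
Proof.
move=> mfn lg fg fnf.
have mf : measurable_fun setT f.
  by apply: (@measurable_fun_cvg _ _ _ setT fn) => // x _; exact: fnf.
have mE n : measurable_fun setT (EFin \o fn n) by apply/measurable_EFinP.
have mEf : measurable_fun setT (EFin \o f) by apply/measurable_EFinP.
have := @dominated_convergence _ _ R mu setT measurableT (fun n => EFin \o fn n) (EFin \o f) (EFin \o g) mE mEf.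
move=> [|||lf _ h].
- by apply: aeW => x _; apply: cvg_EFin; [near=> n|exact: fnf].
- exact: lg.
- by apply: aeW => x n _; rewrite lee_fin.
apply: (fine_cvg (f := fun n => (\int[mu]_x (fn n x)%:E)%E)).
by rewrite fineK //; exact: integrable_fin_num.
Unshelve. all: by end_near. Qed.

(** A bounded stand-in for the modulus, whose square dominates [1 - cos] near the
    origin as well as far from it. *)
Definition unit_trunc theta : R := Num.min 1 `|theta|.

Lemma unit_trunc_ge0 theta : 0 <= unit_trunc theta.
Proof. by rewrite le_min ler01 normr_ge0. Qed.

Lemma unit_trunc_le1 theta : unit_trunc theta <= 1.
Proof. by rewrite ge_min lexx. Qed.

Lemma unit_trunc_continuous : continuous unit_trunc.
Proof.
have -> : unit_trunc = (fun theta => 2^-1 * ((1 + `|theta|) - `|1 - `|theta| |)).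
  apply/funext => theta; rewrite /unit_trunc; case: (leP 1 `|theta|) => h.
    have e : `|1 - `|theta| | = `|theta| - 1 by rewrite distrC ger0_norm// subr_ge0.
    by rewrite e; field.
  have e : `|1 - `|theta| | = 1 - `|theta| by rewrite ger0_norm// subr_ge0 ltW.
  by rewrite e; field.
have c : continuous (fun theta : R => `|theta|) by move=> x; exact: norm_continuous.
have c1 := @continuous_cst R 1.
apply: continuous_mul; first exact: continuous_cst.
by apply: continuous_sub; [exact: continuous_add|apply: continuous_abs; exact: continuous_sub].
Qed.

Lemma one_minus_cos_trunc theta : 1 - cos theta <= 2 * unit_trunc theta ^+ 2.
Proof.
rewrite /unit_trunc; case: (leP 1 `|theta|) => h.
  by have := cos_geN1 theta; rewrite expr1n; lra.
have := one_minus_cos_le theta; rewrite real_normK ?num_real//.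
by have := sqr_ge0 theta; lra.
Qed.

(** The exponent 7 is the largest value of [5 + 2 * a]; it keeps the quotient
    bounded at the origin, and [5 + 2 * a >= 2] makes it integrable at
    infinity. *)
Let trunc_powR a theta : 0 < a -> a <= 1 -> theta != 0 ->
  unit_trunc theta ^+ 7 / (`|theta| `^ (5 + 2 * a)) <= 2 * cauchy theta.
Proof.
move=> a0 a1 t0; have t1 : 0 < `|theta| by rewrite normr_gt0.
have s0 : 0 < 1 + theta ^+ 2 by rewrite ltr_wpDr// sqr_ge0.
rewrite ler_pdivrMr ?powR_gt0// /cauchy /unit_trunc.
case: (leP 1 `|theta|) => h.
  have h2 : `|theta| `^ 2%:R <= `|theta| `^ (5 + 2 * a) by apply: ler_powR => //; lra.
  rewrite powR_mulrn// real_normK ?num_real// in h2.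
  have h1 : 1 <= theta ^+ 2 by rewrite -real_normK ?num_real// exprn_ege1.
  rewrite expr1n; apply: (@le_trans _ _ (2 * (1 + theta ^+ 2)^-1 * theta ^+ 2)).
    by rewrite mulrAC ler_pdivlMr//; lra.
  by rewrite ler_wpM2l// mulr_ge0// invr_ge0 ltW.
have h2 : `|theta| ^+ 7 <= `|theta| `^ (5 + 2 * a).
  have u : 0 < `|theta| <= 1 by rewrite t1 ltW.
  by rewrite -powR_mulrn//; apply: (ger_powR u); lra.
apply: (le_trans h2); rewrite ler_peMl ?powR_ge0//.
rewrite ler_pdivlMr// mul1r.
have : theta ^+ 2 <= 1 by rewrite -real_normK ?num_real// exprn_ile1// ltW.
by lra.
Qed.

(** Cauchy-Schwarz in its pointwise form, between the weighted square of the
    function and the dilated [cauchy]; [lam] balances the two.  One factor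
    [unit_trunc] is left with the square and makes its integral tend to
    zero. *)
Let pointwise a xi lam (f h x : R) : 0 < a -> a <= 1 -> 0 < xi -> 0 < lam ->
  `|h| <= (1 - cos (x * xi)) ^+ 2 ->
  `|f * h| / xi `^ (2 + a) <=
    4 * (lam * (`|x| `^ (5 + 2 * a) * f ^+ 2 * unit_trunc (x * xi)) +
         lam^-1 * (xi * (2 * cauchy (x * xi)))).
Proof.
move=> a0 a1 xi0 l0 hh; set m := unit_trunc _.
have m0 : 0 <= m by exact: unit_trunc_ge0.
have hm : `|h| <= 4 * m ^+ 4.
  apply: (le_trans hh); rewrite (_ : 4 * m ^+ 4 = (2 * m ^+ 2) ^+ 2); last by ring.
  rewrite ler_pXn2r ?nnegrE ?one_minus_cos_ge0 ?mulr_ge0 ?sqr_ge0//.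
  exact: one_minus_cos_trunc.
have p0 : 0 < xi `^ (2 + a) by rewrite powR_gt0.
have [x0|x0] := eqVneq x 0.
  have -> : h = 0.
    apply/eqP; rewrite -normr_le0 (le_trans hm)// /m x0 mul0r /unit_trunc normr0.
    by rewrite min_r// expr0n/= mulr0.
  have c0 := ltW (cauchy_gt0 (x * xi)).
  have g0 : 0 <= `|x| `^ (5 + 2 * a) * f ^+ 2 * m.
    by apply: mulr_ge0 => //; apply: mulr_ge0; [exact: powR_ge0|exact: sqr_ge0].
  have l1 : 0 <= lam^-1 by rewrite invr_ge0 ltW.
  have h1 := mulr_ge0 (ltW l0) g0; have h2 := mulr_ge0 l1 (mulr_ge0 (ltW xi0) (mulr_ge0 (ler0n _ 2) c0)).
  by rewrite mulr0 normr0 mul0r; apply: mulr_ge0 => //; exact: addr_ge0.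
set W := `|x| `^ (5 + 2 * a); have W0 : 0 < W by rewrite powR_gt0// normr_gt0.
set P := xi `^ (2 + a) in p0 *.
have mx : m != 0.
  by rewrite gt_eqF// lt_min ltr01 normr_gt0 mulf_neq0// gt_eqF.
have Wth : `|x * xi| `^ (5 + 2 * a) = W * (xi * P ^+ 2).
  rewrite normrM powRM// (ger0_norm (ltW xi0)); congr (_ * _).
  have -> : 5 + 2 * a = 1 + ((2 + a) + (2 + a)) by ring.
  by rewrite powRD ?(gt_eqF xi0) ?implybT// powRD ?(gt_eqF xi0) ?implybT// powRr1 ?(ltW xi0)// expr2.
have tr : m ^+ 7 / (W * (xi * P ^+ 2)) <= 2 * cauchy (x * xi).
  by rewrite -Wth; apply: trunc_powR => //; rewrite mulf_neq0// gt_eqF.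
have key : `|f| * m ^+ 4 / P <= lam * (W * f ^+ 2 * m) + lam^-1 * (m ^+ 7 / (W * P ^+ 2)).
  rewrite -(real_normK (num_real f)); move: `|f| (normr_ge0 f) => F F0.
  have : 0 <= lam * W * m * (F - lam^-1 * m ^+ 3 / (2 * W * P)) ^+ 2.
    by rewrite mulr_ge0 ?sqr_ge0// !mulr_ge0// ltW.
  have -> : lam * W * m * (F - lam^-1 * m ^+ 3 / (2 * W * P)) ^+ 2 =
      lam * (W * F ^+ 2 * m) - F * m ^+ 4 / P + 4^-1 * (lam^-1 * (m ^+ 7 / (W * P ^+ 2))).
    by field; rewrite !gt_eqF.
  have : 0 <= lam^-1 * (m ^+ 7 / (W * P ^+ 2)).
    rewrite mulr_ge0 ?invr_ge0 ?(ltW l0)// divr_ge0 ?exprn_ge0//.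
    by rewrite mulr_ge0 ?sqr_ge0// ltW.
  by lra.
apply: (@le_trans _ _ (4 * (`|f| * m ^+ 4 / P))).
  rewrite normrM mulrA ler_pM2r ?invr_gt0// mulrCA ler_wpM2l//.
rewrite ler_wpM2l// (le_trans key)// lerD2l ler_wpM2l ?invr_ge0 ?(ltW l0)//.
have -> : m ^+ 7 / (W * P ^+ 2) = xi * (m ^+ 7 / (W * (xi * P ^+ 2))).
  by field; rewrite !gt_eqF.
by rewrite ler_wpM2l// ltW.
Qed.

(** If [f] has a weight of exponent [5/2 + a] in L2, then combinations of
    values of its Fourier transform whose symbol [h] vanishes to fourth order
    at the origin are of smaller order than [xi `^ (2 + a)], the size allowed
    by scaling alone. *)
Lemma weighted_little_o a f h : 0 < a -> a <= 1 -> L1 f -> continuous h ->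
  (exists C, forall theta, `|h theta| <= C * (1 - cos theta) ^+ 2) ->
  L1 (fun x => `|x| `^ (5 + 2 * a) * f x ^+ 2) ->
  (\int[mu]_x (f x * h (x * n.+1%:R^-1))) / n.+1%:R^-1 `^ (2 + a) @[n --> \oo] --> (0 : R).
Proof.
move=> a0 a1 lf ch [C0 hC0] lg.
pose C := `|C0| + 1; have Cp : 0 < C by rewrite ltr_wpDl.
have hC theta : `|h theta| <= C * (1 - cos theta) ^+ 2.
  by apply: (le_trans (hC0 _)); rewrite ler_wpM2r ?sqr_ge0// (le_trans (ler_norm _))// lerDl.
pose g x := `|x| `^ (5 + 2 * a) * f x ^+ 2.
have g0 x : 0 <= g x by rewrite mulr_ge0 ?powR_ge0 ?sqr_ge0.
pose xn (n : nat) : R := n.+1%:R^-1.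
have xn0 n : 0 < xn n by rewrite invr_gt0.
have hxn : xn n @[n --> \oo] --> (0 : R) by exact: cvg_harmonic.
have cut y : continuous (fun x : R => unit_trunc (x * y)).
  move=> x; apply: (@continuous_comp _ _ _ (fun x => x * y) unit_trunc).
    exact: mulrr_continuous.
  exact: unit_trunc_continuous.
have mgn n : measurable_fun setT (fun x => g x * unit_trunc (x * xn n)).
  apply: measurable_funM; first exact: L1_measurable lg.
  by apply: continuous_measurable_fun; exact: cut.
have gnb n x : `|g x * unit_trunc (x * xn n)| <= g x.
  rewrite (ger0_norm (mulr_ge0 (g0 x) (unit_trunc_ge0 _))) -[X in _ <= X]mulr1.
  exact: (ler_wpM2l (g0 x) (unit_trunc_le1 _)).
have lgn n : L1 (fun x => g x * unit_trunc (x * xn n)) by apply: L1_dom (gnb n) lg.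
have D : \int[mu]_x (g x * unit_trunc (x * xn n)) @[n --> \oo] --> (0 : R).
  have -> : (0 : R) = \int[mu]_x (0 : R) by rewrite Rintegral_cst// mul0r.
  apply: (Rint_dominated (fn := fun n x => g x * unit_trunc (x * xn n)) mgn lg gnb) => x.
  rewrite -(mulr0 (g x)); apply: cvgMr.
  have -> : (0 : R) = unit_trunc (x * 0) by rewrite mulr0 /unit_trunc normr0 min_r.
  have h1 : x * xn n @[n --> \oo] --> x * 0 by exact: cvgMr.
  exact: (continuous_cvg _ (unit_trunc_continuous (x := x * 0)) h1).
apply/cvgrPdist_le => e e0.
have pp : 0 < (pi : R) by exact: pi_gt0.
pose lam := C * 4 * 2 * pi / (e / 2).
have l0 : 0 < lam by rewrite !(divr_gt0, mulr_gt0).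
pose d := e / 2 / (C * 4 * lam).
have d0 : 0 < d by rewrite !(divr_gt0, mulr_gt0).
have e2 : e / 2 != 0 by rewrite gt_eqF// divr_gt0.
have hl : lam * (e / 2) = C * 4 * 2 * pi by rewrite /lam divfK.
have hlam : C * 4 * (lam^-1 * (2 * pi)) = e / 2.
  rewrite (_ : C * 4 * _ = C * 4 * 2 * pi / lam); last by ring.
  by rewrite -hl mulrAC mulfV ?mul1r// gt_eqF.
move/cvgrPdist_le : D => /(_ _ d0) D.
near=> n; rewrite -/(xn n) sub0r normrN normrM [`|_^-1|]ger0_norm ?invr_ge0 ?powR_ge0//.
have [lc ic] := @cauchy_int R.
have [lk ik] := Rint_affine 0 (xn0 n) continuous_cauchy (fun x => ltW (cauchy_gt0 x)) lc.
have ce : (fun x => cauchy (xn n * x + 0)) = (fun x => cauchy (x * xn n)).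
  by apply/funext => x; rewrite addr0 mulrC.
rewrite ce in lk ik.
pose bnd x := C * 4 * (lam * (g x * unit_trunc (x * xn n)) + (lam^-1 * xn n * 2) * cauchy (x * xn n)).
have lb : L1 bnd by apply: L1Z; apply: L1D; exact: L1Z.
have ib : \int[mu]_x bnd x = C * 4 * (lam * \int[mu]_x (g x * unit_trunc (x * xn n))) + e / 2.
  rewrite RintZ; last by apply: L1D; exact: L1Z.
  rewrite RintD; [|exact: L1Z|exact: L1Z].
  rewrite (RintZ _ (lgn n)) RintZ// ik ic mulrDr -hlam; congr (_ + _).
  by field; rewrite (gt_eqF (xn0 n)) (gt_eqF l0).
have chn : continuous (fun x => h (x * xn n)).
  by move=> x; apply: (@continuous_comp _ _ _ (fun x => x * xn n) h); [exact: mulrr_continuous|exact: ch].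
have lfh : L1 (fun x => f x * h (x * xn n)).
  apply: (L1Mb (c := C * 4) lf); first exact: continuous_measurable_fun.
  move=> x; apply: (le_trans (hC _)); rewrite ler_wpM2l ?(ltW Cp)//.
  have := one_minus_cos_ge0 (x * xn n); have := cos_geN1 (x * xn n).
  move=> h1 h2; have h3 : 1 - cos (x * xn n) <= 2 by lra.
  by rewrite (_ : 4 = 2 ^+ 2 :> R) ?ler_pXn2r ?nnegrE//; ring.
have P0 : 0 < xn n `^ (2 + a) by rewrite powR_gt0.
apply: (@le_trans _ _ (\int[mu]_x bnd x)).
  rewrite ler_pdivrMr// [X in _ <= X]mulrC -RintZ//.
  apply: Rint_normle => //; first exact: L1Z.
  move=> x; rewrite [X in _ <= X]mulrC -ler_pdivrMr//.
  have hh : `|C^-1 * h (x * xn n)| <= (1 - cos (x * xn n)) ^+ 2.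
    by rewrite normrM ger0_norm ?invr_ge0 ?(ltW Cp)// ler_pdivrMl.
  have H := pointwise (f x) a0 a1 (xn0 n) l0 hh.
  have e1 : `|f x * (C^-1 * h (x * xn n))| = C^-1 * `|f x * h (x * xn n)|.
    by rewrite mulrCA normrM ger0_norm// invr_ge0 ltW.
  rewrite e1 in H.
  apply: (@le_trans _ _ (C * (C^-1 * `|f x * h (x * xn n)| / xn n `^ (2 + a)))).
    by rewrite !mulrA mulfV ?gt_eqF// mul1r.
  apply: (le_trans (ler_wpM2l (ltW Cp) H)).
  by rewrite /bnd -/(g x) le_eqVlt; apply/orP; left; apply/eqP; ring.
rewrite ib -lerBrDr (_ : e - e / 2 = e / 2); last by field.
have : `|0 - \int[mu]_x (g x * unit_trunc (x * xn n))| <= d by near: n.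
rewrite sub0r normrN => /(le_trans (ler_norm _)) h1.
have cl : 0 < C * 4 * lam by apply: mulr_gt0 => //; apply: mulr_gt0.
move: h1; rewrite /d ler_pdivlMr// => /(le_trans _); apply.
by rewrite le_eqVlt; apply/orP; left; apply/eqP; ring.
Unshelve. all: by end_near. Qed.

End SpatialDecay.

(** * Limits of functions of time *)

Section UniformLimits.
Context {R : realType}.
Notation mu := (@lebesgue_measure R).
Implicit Types (r : nat -> R -> R) (l : R -> R) (b : nat -> R).

(** Bounded pointwise convergence of continuous functions of time: the mode of
    convergence under which time integrals converge. *)
Definition time_limit r l := [/\ forall n, continuous (r n),
  exists B, forall n tau, `|r n tau| <= B & forall tau, r n tau @[n --> \oo] --> l tau].

Lemma time_limitD r1 l1 r2 l2 : time_limit r1 l1 -> time_limit r2 l2 ->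
  time_limit (fun n tau => r1 n tau + r2 n tau) (fun tau => l1 tau + l2 tau).
Proof.
move=> [c1 [B1 b1] h1] [c2 [B2 b2] h2]; split.
- by move=> n; exact: continuous_add.
- by exists (B1 + B2) => n tau; rewrite (le_trans (ler_normD _ _))// lerD.
- by move=> tau; exact: cvgD.
Qed.

Lemma time_limitM b (beta : R) r l : b @ \oo --> beta -> (exists C, forall n, `|b n| <= C) ->
  time_limit r l -> time_limit (fun n tau => b n * r n tau) (fun tau => beta * l tau).
Proof.
move=> hb [C bC] [c [B bB] h]; split.
- by move=> n; apply: (continuous_mul (@continuous_cst R (b n))); exact: c.
- by exists (C * B) => n tau; rewrite normrM ler_pM.
- by move=> tau; exact: cvgM.
Qed.

Lemma time_limitZ (c : R) r l : time_limit r l ->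
  time_limit (fun n tau => c * r n tau) (fun tau => c * l tau).
Proof. by apply: time_limitM; [exact: cvg_cst|exists `|c|]. Qed.

Lemma time_limit0 b r : b @ \oo --> (0 : R) -> (forall n, 0 <= b n <= 1) ->
  (forall n, continuous (r n)) -> (exists C, forall n tau, `|r n tau| <= C * b n) ->
  time_limit r (fun=> 0).
Proof.
move=> hb b01 c [C hC].
have hC' n tau : `|r n tau| <= `|C| * b n.
  have /andP[b0 _] := b01 n.
  by apply: (le_trans (hC n tau)); rewrite ler_wpM2r// ler_norm.
split => //.
- exists `|C| => n tau; apply: (le_trans (hC' n tau)).
  by rewrite ler_piMr//; have /andP[] := b01 n.
- move=> tau; apply/cvgrPdist_le => e e0.
  have h2 : (fun n => `|C| * b n) @ \oo --> `|C| * 0 by exact: cvgMr.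
  move/cvgrPdist_le : h2 => /(_ _ e0) h.
  near=> n; rewrite sub0r normrN; apply: (le_trans (hC' n tau)).
  have : `| `|C| * 0 - `|C| * b n | <= e by near: n.
  by rewrite mulr0 sub0r normrN => /(le_trans (ler_norm _)).
Unshelve. all: by end_near. Qed.

Lemma time_limit_int r l s t : time_limit r l ->
  \int[mu]_(tau in `[s, t]) r n tau @[n --> \oo] --> \int[mu]_(tau in `[s, t]) l tau.
Proof.
move=> [c [B bB] h].
pose I tau : R := \1_`[s, t]%classic tau.
have lI : L1 I by exact: integrable_indic_itv.
have := @Rint_dominated R (fun n tau => I tau * r n tau) (fun tau => I tau * l tau)
  (fun tau => B * I tau).
rewrite -(Rint_indic `[s, t]%classic l) => H.
under eq_cvg do rewrite (Rint_indic `[s, t]%classic).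
apply: H.
- move=> n; apply: measurable_funM; first exact: L1_measurable lI.
  by apply: continuous_measurable_fun; exact: c.
- exact: L1Z.
- move=> n tau; have I0 : 0 <= I tau by rewrite /I.
  by rewrite normrM (ger0_norm I0) [X in X <= _]mulrC; exact: ler_wpM2r.
- by move=> tau; apply: cvgMr; exact: h.
Qed.

Lemma time_limit_eq r l r' l' : (forall n tau, r n tau = r' n tau) ->
  (forall tau, l tau = l' tau) -> time_limit r l -> time_limit r' l'.
Proof.
move=> er el; have -> : r = r' by apply/funext => n; apply/funext => tau.
by have -> : l = l' by apply/funext.
Qed.

Lemma Rint_itv_comb (f1 f2 f3 : R -> R) (c1 c2 c3 s t : R) :
  continuous f1 -> continuous f2 -> continuous f3 ->
  \int[mu]_(tau in `[s, t]) (c1 * f1 tau + c2 * f2 tau + c3 * f3 tau) =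
  c1 * \int[mu]_(tau in `[s, t]) f1 tau + c2 * \int[mu]_(tau in `[s, t]) f2 tau +
  c3 * \int[mu]_(tau in `[s, t]) f3 tau.
Proof.
move=> k1 k2 k3; have mI : measurable (`[s, t]%classic : set (measurableTypeR R)) by [].
have z (c : R) (f : R -> R) : continuous f -> continuous (fun x => c * f x).
  by move=> cf; exact: (continuous_mul (@continuous_cst R c) cf).
have i (f : R -> R) : continuous f -> mu.-integrable `[s, t] (EFin \o f).
  by move=> cf; exact: continuous_itv_integrable.
have z1 := z c1 _ k1; have z2 := z c2 _ k2; have z3 := z c3 _ k3.
rewrite (RintegralD mI (i _ (continuous_add z1 z2)) (i _ z3)).
rewrite (RintegralD mI (i _ z1) (i _ z2)).
by rewrite (RintegralZl _ mI (i _ k1)) (RintegralZl _ mI (i _ k2)) (RintegralZl _ mI (i _ k3)).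
Qed.

Definition xn (n : nat) : R := n.+1%:R^-1.

Lemma xn_gt0 n : 0 < xn n.
Proof. by rewrite invr_gt0. Qed.

Lemma xn_le1 n : xn n <= 1.
Proof. by rewrite invf_le1// ler1n. Qed.

Lemma xn_cvg : xn @ \oo --> (0 : R).
Proof. exact: cvg_harmonic. Qed.

Lemma xn_powR (c : R) : 0 < c -> (fun n => xn n `^ c) @ \oo --> (0 : R).
Proof.
move=> c0; have := @powR_abs_continuous R c c0 0; rewrite /continuous_at normr0 powR0 ?gt_eqF// => h.
have -> : (fun n => xn n `^ c) = (fun n => `|xn n| `^ c).
  by apply/funext => n; rewrite ger0_norm// ltW// xn_gt0.
apply: (@cvg_comp _ _ _ xn (fun y : R => `|y| `^ c) _ (nbhs (0 : R))) => //.
exact: xn_cvg.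
Qed.

Lemma xn_powR_le1 (c : R) n : 0 <= c -> xn n `^ c <= 1.
Proof.
move=> c0; apply: (@le_trans _ _ (1 `^ c)); last by rewrite powR1.
by rewrite ge0_ler_powR ?nnegrE ?xn_le1// ltW// xn_gt0.
Qed.

Lemma derive_xn (F : R -> R) (d : R) : is_derive (0 : R) 1 F d ->
  (F (xn n) - F 0) / xn n @[n --> \oo] --> d.
Proof.
move=> dF; have h : h^-1 * (F h - F 0) @[h --> 0^'] --> d.
  have -> : (fun h => h^-1 * (F h - F 0)) =
      (fun h => h^-1 *: ((F \o shift 0) (h *: (1 : R^o)) - F 0)).
    by apply/funext => y; rewrite /= addr0 /GRing.scale/= mulr1.
  by have [dd <-] := dF; exact: dd.
have hx : xn @ \oo --> 0^'.
  move=> A hA; have h1 : \forall n \near \oo, xn n != 0 -> A (xn n) := xn_cvg hA.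
  suff : \forall n \near \oo, A (xn n) by [].
  apply: filterS h1 => n; apply.
  by apply: lt0r_neq0; exact: xn_gt0.
under eq_cvg do rewrite mulrC.
by apply: (@cvg_comp _ _ _ xn (fun h : R => h^-1 * (F h - F 0)) _ 0^').
Qed.

End UniformLimits.

(** * Combinations of dilations *)

Section TrigonometricCombinations.
Context {R : realType}.
Notation mu := (@lebesgue_measure R).
Implicit Types (f : R -> R) (x xi theta : R).

Let cos4 theta : cos (4 * theta) = 8 * cos theta ^+ 4 - 8 * cos theta ^+ 2 + 1.
Proof.
have -> : 4 * theta = (theta + theta) + (theta + theta) by ring.
rewrite cosD sinD cosD; have := cos2Dsin2 theta.
move: (cos theta) (sin theta) => c s h; have -> : s * c = c * s by ring.
have -> : (c * c - s * s) * (c * c - s * s) - (c * s + c * s) * (c * s + c * s) =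
  (c ^+ 2 - s ^+ 2) ^+ 2 - 4 * c ^+ 2 * s ^+ 2 by ring.
have -> : s ^+ 2 = 1 - c ^+ 2 by rewrite -[X in X - _]h; ring.
by ring.
Qed.

Let cos2 theta : cos (2 * theta) = 2 * cos theta ^+ 2 - 1.
Proof.
have -> : 2 * theta = theta + theta by ring.
rewrite cosD; have := cos2Dsin2 theta; move: (cos theta) (sin theta) => c s h.
have -> : 2 * c ^+ 2 - 1 = 2 * c ^+ 2 - (c ^+ 2 + s ^+ 2) by rewrite h.
by ring.
Qed.

Let sin2 theta : sin (2 * theta) = 2 * cos theta * sin theta.
Proof. have -> : 2 * theta = theta + theta by ring.
by rewrite sinD; ring. Qed.

Let sin4 theta : sin (4 * theta) = 4 * cos theta * sin theta * (2 * cos theta ^+ 2 - 1).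
Proof.
have -> : 4 * theta = 2 * (2 * theta) by ring.
by rewrite sin2 cos2 sin2; ring.
Qed.

(** The weights [1, -10, 16] at the dilations [4, 2, 1] annihilate the powers 1
    and 3, and [1, -5, 4] the powers 0 and 2: on [X = 2 ^ s] they are
    [(X - 2) (X - 8)] and [(X - 1) (X - 4)]. *)
Definition odd_comb (f : R -> R) xi : R := f (4 * xi) - 10 * f (2 * xi) + 16 * f xi.
Definition even_comb (f : R -> R) xi : R := f (4 * xi) - 5 * f (2 * xi) + 4 * f xi.

Lemma odd_comb_sin theta : odd_comb sin theta =
  8 * sin theta * (cos theta + 2) * (1 - cos theta) ^+ 2.
Proof. by rewrite /odd_comb sin4 sin2; ring. Qed.

Lemma even_comb_cos theta : even_comb cos theta =
  (8 * cos theta ^+ 2 + 16 * cos theta + 6) * (1 - cos theta) ^+ 2.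
Proof. by rewrite /even_comb cos4 cos2; ring. Qed.

Lemma odd_comb_sin_le theta : `|odd_comb sin theta| <= 24 * (1 - cos theta) ^+ 2.
Proof.
rewrite odd_comb_sin normrM [`|_ ^+ 2|]ger0_norm ?sqr_ge0// ler_wpM2r ?sqr_ge0//.
rewrite !normrM (ger0_norm (ler0n _ 8)) -mulrA (_ : 24 = 8 * 3 :> R); last by ring.
rewrite ler_wpM2l// -[X in _ <= X]mul1r ler_pM// ?norm_sin_le1//.
by rewrite ler_norml; have := cos_geN1 theta; have := cos_le1 theta; lra.
Qed.

Lemma even_comb_cos_le theta : `|even_comb cos theta| <= 30 * (1 - cos theta) ^+ 2.
Proof.
rewrite even_comb_cos normrM [`|_ ^+ 2|]ger0_norm ?sqr_ge0// ler_wpM2r ?sqr_ge0//.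
have := cos_geN1 theta; have := cos_le1 theta; move: (cos theta) => c h1 h2.
have : c ^+ 2 <= 1 by rewrite -[c ^+ 2]real_normK ?num_real// exprn_ile1// ler_norml h1 h2.
by have := sqr_ge0 (c + 1); rewrite sqrrD1 ler_norml => h3 h4; apply/andP; split; lra.
Qed.

(** The same dilations with the additional factor of the derivative in the
    nonlinear term. *)
Definition odd_comb' (f : R -> R) xi : R := 4 * f (4 * xi) - 20 * f (2 * xi) + 16 * f xi.
Definition even_comb' (f : R -> R) xi : R := 4 * f (4 * xi) - 10 * f (2 * xi) + 4 * f xi.

Lemma odd_comb'_cos_le theta : `|odd_comb' cos theta| <= 120 * `|theta| ^+ 2.
Proof.
have -> : odd_comb' cos theta = 4 * even_comb cos theta.
  by rewrite /odd_comb' /even_comb; ring.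
rewrite normrM ger0_norm// (_ : 120 * _ = 4 * (30 * `|theta| ^+ 2)); last by ring.
rewrite ler_wpM2l// (le_trans (even_comb_cos_le theta))// ler_wpM2l//.
by rewrite ler_pXn2r ?nnegrE ?one_minus_cos_ge0// one_minus_cos_le1.
Qed.

Lemma even_comb'_sin_le theta : `|even_comb' sin theta| <= 34 * `|theta| ^+ 3.
Proof.
have -> : even_comb' sin theta =
    4 * sin theta * ((1 - cos theta) * (1 - 8 * cos theta - 8 * cos theta ^+ 2)).
  by rewrite /even_comb' sin4 sin2; ring.
rewrite !normrM (ger0_norm (ler0n _ 4)) (ger0_norm (one_minus_cos_ge0 theta)).
have -> : 34 * `|theta| ^+ 3 = 4 * `|theta| * ((`|theta| ^+ 2 / 2) * 17) by field.
rewrite ler_pM ?mulr_ge0 ?one_minus_cos_ge0//.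
  by rewrite ler_wpM2l// norm_sin_le.
rewrite ler_pM ?one_minus_cos_ge0//.
  by rewrite real_normK ?num_real// one_minus_cos_le.
have := cos_geN1 theta; have := cos_le1 theta; move: (cos theta) => c h1 h2.
have : c ^+ 2 <= 1 by rewrite -[c ^+ 2]real_normK ?num_real// exprn_ile1// ler_norml h1 h2.
by have := sqr_ge0 c; rewrite ler_norml => h3 h4; apply/andP; split; lra.
Qed.

Lemma odd_comb_continuous f : continuous f -> continuous (odd_comb f).
Proof.
move=> cf; have d (k : R) : continuous (fun x => f (k * x)).
  move=> x; apply: (@continuous_comp _ _ _ (fun x => k * x) f); last exact: cf.
  exact: mulrl_continuous.
apply: continuous_add; last by apply: continuous_mul; first exact: continuous_cst.
by apply: continuous_sub => //; apply: continuous_mul; first exact: continuous_cst.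
Qed.

Lemma even_comb_continuous f : continuous f -> continuous (even_comb f).
Proof.
move=> cf; have d (k : R) : continuous (fun x => f (k * x)).
  move=> x; apply: (@continuous_comp _ _ _ (fun x => k * x) f); last exact: cf.
  exact: mulrl_continuous.
apply: continuous_add; last by apply: continuous_mul; first exact: continuous_cst.
by apply: continuous_sub => //; apply: continuous_mul; first exact: continuous_cst.
Qed.

Let comb3 (g : R -> R) (c1 c2 c3 : R) f xi : L1 f ->
  (forall y, L1 (fun x => f x * g (x * y))) ->
  \int[mu]_x (f x * (c1 * g (4 * (x * xi)) - c2 * g (2 * (x * xi)) + c3 * g (x * xi))) =
  c1 * \int[mu]_x (f x * g (x * (4 * xi))) - c2 * \int[mu]_x (f x * g (x * (2 * xi))) +
  c3 * \int[mu]_x (f x * g (x * xi)).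
Proof.
move=> lf lg; rewrite -(RintZ c1 (lg _)) -(RintZ c2 (lg _)) -(RintZ c3 (lg _)).
rewrite -(RintB (L1Z c1 (lg _)) (L1Z c2 (lg _))).
rewrite -(RintD (L1B (L1Z c1 (lg _)) (L1Z c2 (lg _))) (L1Z c3 (lg _))).
by apply: eq_Rintegral => x _; rewrite ![x * (_ * xi)]mulrCA; ring.
Qed.

Lemma odd_comb_st f xi : L1 f ->
  \int[mu]_x (f x * odd_comb sin (x * xi)) = odd_comb (st f) xi.
Proof.
move=> lf; rewrite /odd_comb -(mul1r (st f (4 * xi))).
rewrite /st -(@comb3 sin 1 10 16 f xi lf (fun y => L1_sin y lf)).
by apply: eq_Rintegral => x _; rewrite mul1r.
Qed.

Lemma even_comb_ct f xi : L1 f ->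
  \int[mu]_x (f x * even_comb cos (x * xi)) = even_comb (ct f) xi.
Proof.
move=> lf; rewrite /even_comb -(mul1r (ct f (4 * xi))).
rewrite /ct -(@comb3 cos 1 5 4 f xi lf (fun y => L1_cos y lf)).
by apply: eq_Rintegral => x _; rewrite mul1r.
Qed.

Lemma odd_comb'_ct f xi : L1 f ->
  \int[mu]_x (f x * odd_comb' cos (x * xi)) = odd_comb' (ct f) xi.
Proof. by move=> lf; rewrite /odd_comb' /ct -(@comb3 cos 4 20 16 f xi lf (fun y => L1_cos y lf)). Qed.

Lemma even_comb'_st f xi : L1 f ->
  \int[mu]_x (f x * even_comb' sin (x * xi)) = even_comb' (st f) xi.
Proof. by move=> lf; rewrite /even_comb' /st -(@comb3 sin 4 10 4 f xi lf (fun y => L1_sin y lf)). Qed.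

Let cube_le x : `|x| ^+ 3 <= bracket4 x /\ `|x| ^+ 2 <= bracket4 x.
Proof.
rewrite /bracket4 -(real_normK (num_real x)); move: `|x| (normr_ge0 x) => y y0.
have e : (1 + y ^+ 2) ^+ 2 = 1 + 2 * y ^+ 2 + y ^+ 4 by ring.
have y2 : 0 <= y ^+ 2 by exact: sqr_ge0.
have y4 : 0 <= y ^+ 4 by exact: exprn_ge0.
rewrite e; split; last by lra.
have : 0 <= y ^+ 2 * (y - 2^-1) ^+ 2 by rewrite mulr_ge0 ?sqr_ge0.
have -> : y ^+ 2 * (y - 2^-1) ^+ 2 = y ^+ 4 - y ^+ 3 + y ^+ 2 / 4 by field.
by lra.
Qed.

(** Squares of profiles have four weights in L1, so their Fourier transforms
    are smooth enough for the combinations to be small. *)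
Lemma sqr_comb_le f (h : R -> R) (C xi : R) (j : nat) : profile f -> (j == 2) || (j == 3) ->
  (forall theta, `|h theta| <= C * `|theta| ^+ j) -> L1 (fun x => f x ^+ 2 * h (x * xi)) ->
  0 <= C -> `|\int[mu]_x (f x ^+ 2 * h (x * xi))| <= C * `|xi| ^+ j * mass f.
Proof.
move=> pf jj hh lh C0; rewrite -RintZ; last exact: profile_weight.
apply: Rint_normle => //; first by apply: L1Z; exact: profile_weight.
move=> x; rewrite normrM (ger0_norm (sqr_ge0 _)).
apply: (@le_trans _ _ (f x ^+ 2 * (C * `|x * xi| ^+ j))).
  by rewrite ler_wpM2l ?sqr_ge0.
rewrite normrM exprMn.
have -> : f x ^+ 2 * (C * (`|x| ^+ j * `|xi| ^+ j)) =
  C * `|xi| ^+ j * (`|x| ^+ j * f x ^+ 2) by ring.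
apply: ler_wpM2l; first by rewrite mulr_ge0// exprn_ge0.
apply: ler_wpM2r; first exact: sqr_ge0.
by case/orP: jj => /eqP ->; have [] := cube_le x.
Qed.

End TrigonometricCombinations.

(** * The equation at low frequency *)

Section LowFrequencies.
Context {R : realType}.
Notation mu := (@lebesgue_measure R).
Implicit Types (f : R -> R) (k x y xi s t tau : R).
Variables (a T K : R) (v : R -> R -> R).
Hypothesis a0 : 0 < a.
Hypothesis a1 : a <= 1.
Hypothesis tv : trajectory K v.
Hypothesis mild : mild_trajectory a T v.
Let pv := tr_profile tv.
Let lv t := profile_L1 (pv t).
Let lxv t := profile_moment (pv t).
Let lv2 t := profile_sqr_L1 (pv t).
Let lxv2 t := profile_sqr_moment (pv t).
Let Q : R := K + pi.

Let ct_small tau xi : `|ct (v tau) xi - ct (v tau) 0| <= Q * `|xi|.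
Proof.
rewrite [Q * _]mulrC; apply: (le_trans (ct_lip _ _ (lv tau) (lxv tau))).
by rewrite subr0 ler_wpM2l//; have [] := tr_int_le tv tau.
Qed.

Let st0 f : st f 0 = 0.
Proof.
rewrite /st; under eq_Rintegral do rewrite mulr0 sin0 mulr0.
by rewrite Rintegral_cst// mul0r.
Qed.

Let st_small tau xi : `|st (v tau) xi| <= Q * `|xi|.
Proof.
have := st_lip xi 0 (lv tau) (lxv tau); rewrite st0 !subr0 => h.
rewrite [Q * _]mulrC; apply: (le_trans h).
by rewrite ler_wpM2l//; have [] := tr_int_le tv tau.
Qed.

Let scale_cvg k : (fun n => k * xn n) @ \oo --> (0 : R).
Proof. by rewrite -(mulr0 k); apply: cvgMr; exact: xn_cvg. Qed.

Let along f k : continuous f -> (fun n => f (k * xn n)) @ \oo --> f 0.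
Proof.
move=> cf; apply: (@cvg_comp _ _ _ (fun n => k * xn n) f _ (nbhs (0 : R))).
  exact: scale_cvg.
exact: cf.
Qed.

Let x_neq0 n : xn n != 0 :> R. Proof. by apply: lt0r_neq0; exact: xn_gt0. Qed.
Let x_ge0 n : 0 <= xn n :> R. Proof. by apply: ltW; exact: xn_gt0. Qed.

Lemma time_limit_ct k : 0 <= k -> time_limit (fun n tau => ct (v tau) (k * xn n)) (fun tau => ct (v tau) 0).
Proof.
move=> k0; split.
- by move=> n; exact: (ct_time tv).
- exists Q => n tau; apply: (le_trans (norm_ct_le _ (lv tau))).
  by have [] := tr_int_le tv tau.
- by move=> tau; apply: along; exact: ct_continuous.
Qed.

Let tl_ct_sqr k : 0 <= k -> time_limit (fun n tau => ct (fun x => v tau x ^+ 2) (k * xn n))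
  (fun tau => \int[mu]_x v tau x ^+ 2).
Proof.
move=> k0; split.
- by move=> n; exact: (ct_sqr_time tv).
- exists K => n tau; apply: (le_trans (norm_ct_le _ (lv2 tau))).
  apply: le_trans (tr_mass tv tau); apply: le_trans (sqr_le_mass (pv tau)).
  by apply: Rint_le => // [|x]; [exact: L1_norm|rewrite ger0_norm ?sqr_ge0].
- move=> tau; have -> : \int[mu]_x v tau x ^+ 2 = ct (fun x => v tau x ^+ 2) 0.
    by apply: eq_Rintegral => x _; rewrite mulr0 cos0 mulr1.
  by apply: along; exact: ct_continuous.
Qed.

(** The first moment is the derivative of the sine transform at the origin. *)
Lemma time_limit_st k : 0 <= k -> time_limit (fun n tau => (xn n)^-1 * st (v tau) (k * xn n))
  (fun tau => k * moment (v tau)).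
Proof.
move=> k0; split.
- by move=> n; apply: (continuous_mul (@continuous_cst R _)); exact: (st_time tv).
- exists (Q * k) => n tau; rewrite normrM ger0_norm ?invr_ge0// ler_pdivrMl ?xn_gt0//.
  apply: (le_trans (st_small _ _)); rewrite ger0_norm ?mulr_ge0//.
  by rewrite mulrA mulrC.
- move=> tau; rewrite -(RintZ k (lxv tau)).
  have E n : (xn n)^-1 * st (v tau) (k * xn n) =
      \int[mu]_x (v tau x * ((sin (x * k * xn n) - sin (x * k * 0)) / xn n)).
    rewrite /st -RintZ; last exact: L1_sin.
    by apply: eq_Rintegral => x _; rewrite mulr0 sin0 subr0 (mulrA x k); ring.
  under eq_cvg do rewrite E.
  apply: (@Rint_dominated R _ _ (fun x => k * `|x * v tau x|)).
  + move=> n; apply: measurable_funM; first exact: profile_measurable.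
    apply: continuous_measurable_fun; apply: continuous_mul; last exact: continuous_cst.
    apply: continuous_sub; move=> x.
      apply: (@continuous_comp _ _ _ (fun x => x * k * xn n) sin); last exact: continuous_sin.
      exact: (continuous_mul (continuous_mul (fun x => cvg_id) (@continuous_cst R k)) (@continuous_cst R (xn n))).
    apply: (@continuous_comp _ _ _ (fun x => x * k * 0) sin); last exact: continuous_sin.
    exact: (continuous_mul (continuous_mul (fun x => cvg_id) (@continuous_cst R k)) (@continuous_cst R 0)).
  + by apply: L1Z; exact: (L1_norm (lxv tau)).
  + move=> n x; rewrite mulr0 sin0 subr0 !normrM [`|_^-1|]ger0_norm ?invr_ge0//.
    rewrite mulrA ler_pdivrMr ?xn_gt0//.
    apply: (@le_trans _ _ (`|v tau x| * `|x * k * xn n|)); first by rewrite ler_wpM2l// norm_sin_le.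
    by rewrite !normrM (ger0_norm k0) (ger0_norm (x_ge0 n)) le_eqVlt; apply/orP; left; apply/eqP; ring.
  + move=> x; have -> : k * (x * v tau x) = v tau x * (x * k) by ring.
    apply: cvgMr; apply: (@derive_xn R (fun h => sin (x * k * h)) (x * k)).
    have := is_derive_comp_scale (is_derive_sin (x * k * 0)).
    by rewrite mulr0 cos0 mulr1.
Qed.

(** The cosine transform is even, so it has no first-order term. *)
Lemma time_limit_ct0 k : 0 <= k ->
  time_limit (fun n tau => (xn n)^-1 * (ct (v tau) (k * xn n) - ct (v tau) 0)) (fun=> 0).
Proof.
move=> k0; split.
- move=> n; apply: (continuous_mul (@continuous_cst R _)).
  by apply: continuous_sub; exact: (ct_time tv).
- exists (Q * k) => n tau; rewrite normrM ger0_norm ?invr_ge0// ler_pdivrMl ?xn_gt0//.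
  apply: (le_trans (ct_small _ _)); rewrite ger0_norm ?mulr_ge0//.
  by rewrite mulrA mulrC.
- move=> tau; have z : \int[mu]_x (0 : R) = 0 by rewrite Rintegral_cst// mul0r.
  have E n : (xn n)^-1 * (ct (v tau) (k * xn n) - ct (v tau) 0) =
      \int[mu]_x (v tau x * ((cos (x * k * xn n) - cos (x * k * 0)) / xn n)).
    rewrite /ct -RintB; [|exact: L1_cos|exact: L1_cos].
    rewrite -RintZ; last by apply: L1B; exact: L1_cos.
    by apply: eq_Rintegral => x _; rewrite !mulr0 (mulrA x k); ring.
  under eq_cvg do rewrite E.
  suff: \int[mu]_x (v tau x * ((cos (x * k * xn n) - cos (x * k * 0)) / xn n)) @[n --> \oo] -->
      \int[mu]_x (0 : R) by rewrite z.
  apply: (@Rint_dominated R _ _ (fun x => k * `|x * v tau x|)).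
  + move=> n; apply: measurable_funM; first exact: profile_measurable.
    apply: continuous_measurable_fun; apply: continuous_mul; last exact: continuous_cst.
    apply: continuous_sub; move=> x.
      apply: (@continuous_comp _ _ _ (fun x => x * k * xn n) cos); last exact: continuous_cos.
      exact: (continuous_mul (continuous_mul (fun x => cvg_id) (@continuous_cst R k)) (@continuous_cst R (xn n))).
    apply: (@continuous_comp _ _ _ (fun x => x * k * 0) cos); last exact: continuous_cos.
    exact: (continuous_mul (continuous_mul (fun x => cvg_id) (@continuous_cst R k)) (@continuous_cst R 0)).
  + by apply: L1Z; exact: (L1_norm (lxv tau)).
  + move=> n x; rewrite !normrM [`|_^-1|]ger0_norm ?invr_ge0//.
    rewrite mulrA ler_pdivrMr ?xn_gt0//.
    apply: (@le_trans _ _ (`|v tau x| * `|x * k * xn n - x * k * 0|)).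
      by rewrite ler_wpM2l// norm_cosB.
    rewrite mulr0 subr0 !normrM (ger0_norm k0) (ger0_norm (x_ge0 n)).
    by rewrite le_eqVlt; apply/orP; left; apply/eqP; ring.
  + move=> x.
    suff: v tau x * ((cos (x * k * xn n) - cos (x * k * 0)) / xn n) @[n --> \oo] --> v tau x * 0.
      by rewrite (mulr0 (v tau x)).
    apply: cvgMr; apply: (@derive_xn R (fun h => cos (x * k * h)) 0).
    have := is_derive_comp_scale (is_derive_cos (x * k * 0)).
    by rewrite mulr0 sin0 oppr0 mulr0.
Qed.

(** Every term of the equation vanishes at frequency zero. *)
Lemma mass_conserved s t : 0 <= s -> s < t -> t <= T -> ct (v t) 0 = ct (v s) 0.
Proof.
move=> s0 sltt tT; apply/eqP; rewrite -subr_eq0 (ct_increment a0 tv mild)//.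
have z tau : damp a 0 * ct (v tau) 0 + disp 0 * st (v tau) 0 + FA v tau 0 = 0.
  by rewrite /damp /disp /FA normr0 powR0 ?gt_eqF ?addr_gt0// !mul0r !addr0.
under eq_Rintegral do rewrite z.
by rewrite Rintegral_cst// mul0r oppr0.
Qed.

Lemma damp_xn k n : 0 <= k -> damp a (k * xn n) = k `^ (1 + a) * (xn n * xn n `^ a).
Proof.
move=> k0; rewrite /damp ger0_norm ?mulr_ge0// powRM//.
rewrite [X in _ * X]powRD ?x_neq0 ?implybT//.
by rewrite powRr1.
Qed.

Lemma disp_xn k n : 0 <= k -> disp (k * xn n) = k ^+ 2 * xn n ^+ 2.
Proof. by move=> k0; rewrite /disp ger0_norm ?mulr_ge0//; ring. Qed.

Let pw0 : (fun n => xn n `^ a) @ \oo --> (0 : R). Proof. exact: xn_powR. Qed.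

Let pw1 n : 0 <= (xn n : R) `^ a <= 1.
Proof. by rewrite powR_ge0 xn_powR_le1// ltW. Qed.

Let bounded01 (b : nat -> R) : (forall n, 0 <= b n <= 1) -> exists C, forall n, `|b n| <= C.
Proof. by move=> h; exists 1 => n; have /andP[b0 b1] := h n; rewrite ger0_norm. Qed.

(** Minus the time derivatives of [st (v tau) xi] and [ct (v tau) xi]. *)
Definition sine_rate xi tau := damp a xi * st (v tau) xi - disp xi * ct (v tau) xi + FB v tau xi.
Definition cosine_rate xi tau := damp a xi * ct (v tau) xi + disp xi * st (v tau) xi + FA v tau xi.

Lemma sine_rate_time xi : continuous (sine_rate xi).
Proof.
apply: continuous_add; last exact: (FB_time tv).
apply: continuous_sub; apply: (continuous_mul (@continuous_cst _ _)).
  exact: (st_time tv).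
exact: (ct_time tv).
Qed.

Lemma cosine_rate_time xi : continuous (cosine_rate xi).
Proof.
apply: continuous_add; last exact: (FA_time tv).
apply: continuous_add; apply: (continuous_mul (@continuous_cst _ _)).
  exact: (ct_time tv).
exact: (st_time tv).
Qed.

(** The law of the sine transform, divided by the frequency, in the limit of
    frequency zero: the linear terms are of higher order, and the nonlinear one
    tends to minus half the energy. *)
Lemma moment_increment s t : 0 <= s -> s < t -> t <= T ->
  moment (v t) - moment (v s) = 2^-1 * \int[mu]_(tau in `[s, t]) \int[mu]_x v tau x ^+ 2.
Proof.
move=> s0 sltt tT.
have mI : measurable (`[s, t]%classic : set (measurableTypeR R)) by [].
have L : time_limit (fun n tau => (xn n)^-1 * sine_rate (1 * xn n) tau)
    (fun tau => - (2^-1 * \int[mu]_x v tau x ^+ 2)).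
  have z1 : time_limit (fun n tau => (xn n * xn n `^ a) * ((xn n)^-1 * st (v tau) (1 * xn n)))
      (fun tau => (0 * 0) * (1 * moment (v tau))).
    apply: time_limitM; last exact: time_limit_st.
      by apply: cvgM; [exact: xn_cvg|exact: pw0].
    apply: bounded01 => n; have /andP[p0 p1] := pw1 n.
    by rewrite mulr_ge0// mulr_ile1// xn_le1.
  have z2 : time_limit (fun n tau => xn n * ct (v tau) (1 * xn n)) (fun tau => 0 * ct (v tau) 0).
    apply: time_limitM; [exact: xn_cvg| |exact: time_limit_ct].
    by apply: bounded01 => n; rewrite x_ge0 xn_le1.
  have z3 := time_limitZ (- 2^-1) (tl_ct_sqr ler01).
  apply: time_limit_eq (time_limitD (time_limitD z1 (time_limitZ (- 1) z2)) z3).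
    move=> n tau; rewrite /sine_rate damp_xn// disp_xn// powR1 /FB.
    by move: (st _ _) (ct _ _) (ct _ _) (xn n `^ a) => A B C D; field; exact: x_neq0.
  by move=> tau; rewrite !mul0r mulr0 !add0r mulNr.
have H := time_limit_int (s := s) (t := t) L.
have E n : \int[mu]_(tau in `[s, t]) ((xn n)^-1 * sine_rate (1 * xn n) tau) =
    - ((xn n)^-1 * st (v t) (1 * xn n)) + (xn n)^-1 * st (v s) (1 * xn n).
  rewrite (RintegralZl _ mI (continuous_itv_integrable s t (@sine_rate_time _))).
  have := st_increment a0 tv mild (1 * xn n) s0 sltt tT; rewrite -/(sine_rate _) => e.
  have -> : \int[mu]_(tau in `[s, t]) sine_rate (1 * xn n) tau = - (st (v t) (1 * xn n) - st (v s) (1 * xn n)).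
    by rewrite e opprK.
  by ring.
have H' : (fun n => - ((xn n)^-1 * st (v t) (1 * xn n)) + (xn n)^-1 * st (v s) (1 * xn n)) @ \oo -->
    - (1 * moment (v t)) + 1 * moment (v s).
  have [_ _ ht] := time_limit_st ler01.
  by apply: cvgD; [apply: cvgN; exact: ht|exact: ht].
move: H; under eq_cvg do rewrite E.
move=> /(cvg_unique _ H') => /(_ (@Rhausdorff R)).
rewrite (Rint_itvN _ _ (f := fun tau => 2^-1 * \int[mu]_x v tau x ^+ 2)); last first.
  by apply: (continuous_mul (@continuous_cst _ _)); exact: (energy_time tv).
rewrite (RintegralZl _ mI (continuous_itv_integrable s t (energy_time tv))).
by lra.
Qed.

End LowFrequencies.

(** * Consequences of decay at two times *)

Section VanishingMoment.
Context {R : realType}.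
Notation mu := (@lebesgue_measure R).
Implicit Types (f : R -> R) (k x y xi s t tau : R).
Variables (a T K : R) (v : R -> R -> R).
Hypothesis a0 : 0 < a.
Hypothesis a1 : a <= 1.
Hypothesis tv : trajectory K v.
Hypothesis mild : mild_trajectory a T v.
Let pv := tr_profile tv.
Let lv t := profile_L1 (pv t).
Let lv2 t := profile_sqr_L1 (pv t).
Let x_neq0 n : xn n != 0 :> R. Proof. by apply: lt0r_neq0; exact: xn_gt0. Qed.
Let x_ge0 n : 0 <= xn n :> R. Proof. by apply: ltW; exact: xn_gt0. Qed.

Let comb_limit (c1 c2 c3 : R) r1 l1 r2 l2 r3 l3 :
  @time_limit R r1 l1 -> time_limit r2 l2 -> time_limit r3 l3 ->
  time_limit (fun n tau => c1 * r1 n tau + c2 * r2 n tau + c3 * r3 n tau)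
    (fun tau => c1 * l1 tau + c2 * l2 tau + c3 * l3 tau).
Proof.
move=> h1 h2 h3.
exact: time_limitD (time_limitD (time_limitZ c1 h1) (time_limitZ c2 h2)) (time_limitZ c3 h3).
Qed.

Let odd_sqr tau xi : `|odd_comb' (ct (fun x => v tau x ^+ 2)) xi| <= 120 * K * `|xi| ^+ 2.
Proof.
rewrite -(odd_comb'_ct _ (lv2 tau)).
apply: (@le_trans _ _ (120 * `|xi| ^+ 2 * mass (v tau))).
  apply: sqr_comb_le => //; first exact: odd_comb'_cos_le.
  rewrite /odd_comb'.
  have E : (fun x => v tau x ^+ 2 * (4 * cos (4 * (x * xi)) - 20 * cos (2 * (x * xi)) + 16 * cos (x * xi))) =
      (fun x => 4 * (v tau x ^+ 2 * cos (x * (4 * xi))) - 20 * (v tau x ^+ 2 * cos (x * (2 * xi))) +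
        16 * (v tau x ^+ 2 * cos (x * xi))).
    apply/funext => x; rewrite (mulrCA x 4) (mulrCA x 2); ring.
  rewrite E.
  by apply: L1D; [apply: L1B|]; apply: L1Z; exact: L1_cos.
by rewrite mulrAC ler_wpM2r ?sqr_ge0// ler_wpM2l// tr_mass.
Qed.

Let even_sqr tau xi : `|even_comb' (st (fun x => v tau x ^+ 2)) xi| <= 34 * K * `|xi| ^+ 3.
Proof.
rewrite -(even_comb'_st _ (lv2 tau)).
apply: (@le_trans _ _ (34 * `|xi| ^+ 3 * mass (v tau))).
  apply: sqr_comb_le => //; first exact: even_comb'_sin_le.
  rewrite /even_comb'.
  have E : (fun x => v tau x ^+ 2 * (4 * sin (4 * (x * xi)) - 10 * sin (2 * (x * xi)) + 4 * sin (x * xi))) =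
      (fun x => 4 * (v tau x ^+ 2 * sin (x * (4 * xi))) - 10 * (v tau x ^+ 2 * sin (x * (2 * xi))) +
        4 * (v tau x ^+ 2 * sin (x * xi))).
    apply/funext => x; rewrite (mulrCA x 4) (mulrCA x 2); ring.
  rewrite E.
  by apply: L1D; [apply: L1B|]; apply: L1Z; exact: L1_sin.
by rewrite mulrAC ler_wpM2r ?exprn_ge0// ler_wpM2l// tr_mass.
Qed.

Let odd_sqr_time xi : continuous (fun tau => odd_comb' (ct (fun x => v tau x ^+ 2)) xi).
Proof.
rewrite /odd_comb'; apply: continuous_add; last first.
  by apply: (continuous_mul (@continuous_cst _ _)); exact: (ct_sqr_time tv).
by apply: continuous_sub; apply: (continuous_mul (@continuous_cst _ _)); exact: (ct_sqr_time tv).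
Qed.

Let even_sqr_time xi : continuous (fun tau => even_comb' (st (fun x => v tau x ^+ 2)) xi).
Proof.
rewrite /even_comb'; apply: continuous_add; last first.
  by apply: (continuous_mul (@continuous_cst _ _)); exact: (st_sqr_time tv).
by apply: continuous_sub; apply: (continuous_mul (@continuous_cst _ _)); exact: (st_sqr_time tv).
Qed.

(** The decay at infinity that the weight exponent [5 / 2 + a] provides. *)
Definition tight t := L1 (fun x => `|x| `^ (5 + 2 * a) * v t x ^+ 2).

Lemma odd_little_o t : tight t ->
  odd_comb (st (v t)) (xn n) / xn n `^ (2 + a) @[n --> \oo] --> (0 : R).
Proof.
move=> h; have := @weighted_little_o R a (v t) (odd_comb sin) a0 a1 (lv t)
  (odd_comb_continuous (@continuous_sin R)).
move=> /(_ (ex_intro _ 24 (@odd_comb_sin_le R)) h).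
by under eq_cvg do rewrite (odd_comb_st _ (lv t)).
Qed.

Lemma even_little_o t : tight t ->
  even_comb (ct (v t)) (xn n) / xn n `^ (2 + a) @[n --> \oo] --> (0 : R).
Proof.
move=> h; have := @weighted_little_o R a (v t) (even_comb cos) a0 a1 (lv t)
  (even_comb_continuous (@continuous_cos R)).
move=> /(_ (ex_intro _ 30 (@even_comb_cos_le R)) h).
by under eq_cvg do rewrite (even_comb_ct _ (lv t)).
Qed.

Lemma odd_comb_increment s t xi : 0 <= s -> s < t -> t <= T ->
  \int[mu]_(tau in `[s, t]) odd_comb (sine_rate a v ^~ tau) xi =
  odd_comb (st (v s)) xi - odd_comb (st (v t)) xi.
Proof.
move=> s0 sltt tT; rewrite /odd_comb.
have c y : continuous (sine_rate a v y) by exact: (sine_rate_time tv).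
have i y : \int[mu]_(tau in `[s, t]) sine_rate a v y tau = st (v s) y - st (v t) y.
  by rewrite -[LHS]opprK -(st_increment a0 tv mild y s0 sltt tT) opprB.
under eq_Rintegral do rewrite -(mul1r (sine_rate a v (4 * xi) _)) -mulNr.
by rewrite (Rint_itv_comb _ _ _ _ _ (c _) (c _) (c _)) !i; ring.
Qed.

Lemma even_comb_increment s t xi : 0 <= s -> s < t -> t <= T ->
  \int[mu]_(tau in `[s, t]) even_comb (cosine_rate a v ^~ tau) xi =
  even_comb (ct (v s)) xi - even_comb (ct (v t)) xi.
Proof.
move=> s0 sltt tT; rewrite /even_comb.
have c y : continuous (cosine_rate a v y) by exact: (cosine_rate_time tv).
have i y : \int[mu]_(tau in `[s, t]) cosine_rate a v y tau = ct (v s) y - ct (v t) y.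
  by rewrite -[LHS]opprK -(ct_increment a0 tv mild y s0 sltt tT) opprB.
under eq_Rintegral do rewrite -(mul1r (cosine_rate a v (4 * xi) _)) -mulNr.
by rewrite (Rint_itv_comb _ _ _ _ _ (c _) (c _) (c _)) !i; ring.
Qed.

Let sine_rate_comb n tau : odd_comb (sine_rate a v ^~ tau) (xn n) =
  xn n * xn n `^ a * (4 `^ (1 + a) * st (v tau) (4 * xn n)
    + (- 10 * 2 `^ (1 + a)) * st (v tau) (2 * xn n) + 16 * st (v tau) (1 * xn n))
  - xn n ^+ 2 * (16 * ct (v tau) (4 * xn n) + (- 40) * ct (v tau) (2 * xn n) + 16 * ct (v tau) (1 * xn n))
  - 2^-1 * (xn n * odd_comb' (ct (fun x => v tau x ^+ 2)) (xn n)).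
Proof.
rewrite /odd_comb /odd_comb' /sine_rate -(mul1r (xn n)) !mulrA !mulr1.
rewrite !damp_xn// !disp_xn// powR1 /FB !mul1r. by field.
Qed.

Let cosine_rate_comb n tau : a = 1 -> even_comb (cosine_rate a v ^~ tau) (xn n) =
  xn n ^+ 2 * (16 * (ct (v tau) (4 * xn n) - ct (v tau) 0)
    + (- 20) * (ct (v tau) (2 * xn n) - ct (v tau) 0) + 4 * (ct (v tau) (1 * xn n) - ct (v tau) 0))
  + xn n ^+ 2 * (16 * st (v tau) (4 * xn n) + (- 20) * st (v tau) (2 * xn n) + 4 * st (v tau) (1 * xn n))
  + 2^-1 * (xn n * even_comb' (st (fun x => v tau x ^+ 2)) (xn n)).
Proof.
move=> ->.
rewrite /even_comb /even_comb' /cosine_rate -(mul1r (xn n)) !mulrA !mulr1.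
rewrite !damp_xn// !disp_xn// powR1 powRr1//.
have p2 (k : R) : 0 <= k -> k `^ (1 + 1) = k ^+ 2 by move=> k0; rewrite -powR_mulrn//.
by rewrite !p2// /FA !mul1r; field.
Qed.

Let odd_time xi : continuous (fun tau => odd_comb (sine_rate a v ^~ tau) xi).
Proof.
have c y : continuous (sine_rate a v y) by exact: (sine_rate_time tv).
exact: (continuous_add (continuous_sub (c _) (continuous_mul (@continuous_cst R 10) (c _)))
  (continuous_mul (@continuous_cst R 16) (c xi))).
Qed.

Let even_time xi : continuous (fun tau => even_comb (cosine_rate a v ^~ tau) xi).
Proof.
have c y : continuous (cosine_rate a v y) by exact: (cosine_rate_time tv).
exact: (continuous_add (continuous_sub (c _) (continuous_mul (@continuous_cst R 5) (c _)))
  (continuous_mul (@continuous_cst R 4) (c xi))).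
Qed.

(** To the order [xi ^+ 2] the combination of the rates sees the dispersion
    acting on the mean, as [odd_comb] does not annihilate the symbol
    [xi * `|xi|]: its value there is 16 - 40 + 16 = - 8.  At the two end times
    the combination is of the smaller order [xi `^ (2 + a)]. *)
Lemma tight_mean_zero s t : 0 <= s -> s < t -> t <= T -> tight s -> tight t ->
  forall tau, s <= tau <= t -> ct (v tau) 0 = 0.
Proof.
move=> s0 sltt tT hs ht.
have L : time_limit (fun n tau => xn n ^- 2 * odd_comb (sine_rate a v ^~ tau) (xn n))
    (fun tau => 8 * ct (v tau) 0).
  have zs := comb_limit (4 `^ (1 + a)) (- 10 * 2 `^ (1 + a)) 16
    (time_limit_st tv (ler0n R 4)) (time_limit_st tv (ler0n R 2)) (time_limit_st tv (ler0n R 1)).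
  have zc := comb_limit 16 (- 40) 16
    (time_limit_ct tv (ler0n R 4)) (time_limit_ct tv (ler0n R 2)) (time_limit_ct tv (ler0n R 1)).
  have p01 n : 0 <= (xn n : R) `^ a <= 1 by rewrite powR_ge0 xn_powR_le1// ltW.
  have z1 := time_limitM (xn_powR a0) (ex_intro _ 1 _) zs.
  have b1 n : `|xn n `^ a| <= 1 :> R by have /andP[p0 p1] := p01 n; rewrite ger0_norm.
  have z3 : time_limit (fun n tau => 2^-1 * ((xn n)^-1 * odd_comb' (ct (fun x => v tau x ^+ 2)) (xn n))) (fun=> 0).
    apply: (time_limit0 (b := xn)); first exact: xn_cvg.
    - by move=> n; rewrite x_ge0 xn_le1.
    - by move=> n; apply: (continuous_mul (@continuous_cst _ _)); apply: (continuous_mul (@continuous_cst _ _)).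
    - exists (60 * K) => n tau; rewrite !normrM.
      rewrite [`|2^-1|]ger0_norm// [`|(xn n)^-1|]ger0_norm ?invr_ge0//.
      have := odd_sqr tau (xn n); rewrite (ger0_norm (x_ge0 n)).
      move: `|odd_comb' _ _| => z hz.
      rewrite ler_pdivrMl// ler_pdivrMl ?xn_gt0//; apply: (le_trans hz).
      by rewrite le_eqVlt; apply/orP; left; apply/eqP; ring.
  have z := time_limitD (time_limitD (z1 b1) (time_limitZ (-1) zc)) (time_limitZ (-1) z3).
  apply: time_limit_eq z => [n tau|tau].
    rewrite sine_rate_comb.
    move: (4 `^ _) (2 `^ _) (_ `^ a) (odd_comb' _ _) (st _ _) (st _ _) (st _ _) => A B C D E F G.
    by field; exact: x_neq0.
  by ring.
have H := time_limit_int (s := s) (t := t) L.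
have mI : measurable (`[s, t]%classic : set (measurableTypeR R)) by [].
have E n : \int[mu]_(tau in `[s, t]) (xn n ^- 2 * odd_comb (sine_rate a v ^~ tau) (xn n)) =
    xn n `^ a * (odd_comb (st (v s)) (xn n) / xn n `^ (2 + a)) -
    xn n `^ a * (odd_comb (st (v t)) (xn n) / xn n `^ (2 + a)).
  rewrite (RintegralZl _ mI (continuous_itv_integrable s t (@odd_time _))) odd_comb_increment//.
  have -> : xn n `^ (2 + a) = xn n ^+ 2 * xn n `^ a :> R.
    by rewrite powRD ?x_neq0 ?implybT// powR_mulrn.
  have := powR_gt0 a (xn_gt0 n : 0 < (xn n : R)).
  move: (odd_comb _ _) (odd_comb _ _) (xn n `^ a) => A B C C0.
  by field; rewrite x_neq0 gt_eqF.
have H0 : (fun n => xn n `^ a * (odd_comb (st (v s)) (xn n) / xn n `^ (2 + a)) -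
    xn n `^ a * (odd_comb (st (v t)) (xn n) / xn n `^ (2 + a))) @ \oo --> (0 * 0 - 0 * 0 : R).
  by apply: cvgB; apply: cvgM; [exact: xn_powR|exact: odd_little_o|exact: xn_powR|exact: odd_little_o].
move: H; under eq_cvg do rewrite E.
move=> /(cvg_unique _ H0) => /(_ (@Rhausdorff R)); rewrite mul0r subrr => e tau /andP[st' tt].
have cM tau' : s <= tau' <= t -> ct (v tau') 0 = ct (v s) 0.
  move=> /andP[]; rewrite le_eqVlt => /orP[/eqP <-//|h h'].
  by apply: (mass_conserved a0 tv mild) => //; apply: le_trans tT.
rewrite cM ?st'//; move: e.
have -> : \int[mu]_(tau in `[s, t]) (8 * ct (v tau) 0) = \int[mu]_(tau in `[s, t]) (8 * ct (v s) 0).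
  by apply: eq_Rintegral => tau'; rewrite inE/= in_itv/= => h; rewrite cM.
have muE : mu `[s, t]%classic = (t - s)%:E by rewrite lebesgue_measure_itv/= lte_fin sltt EFinB.
rewrite Rintegral_cst// [X in fine X]muE/=.
move=> /esym/eqP; rewrite mulf_eq0 subr_eq0 (gt_eqF sltt) orbF mulf_eq0.
by rewrite pnatr_eq0/= => /eqP.
Qed.

Let b01_bounded (c : R) : 0 <= c -> forall n, `|xn n `^ c| <= 1 :> R.
Proof. by move=> c0 n; rewrite ger0_norm ?powR_ge0// xn_powR_le1. Qed.

(** The symbol that selects the first moment, [4 p^2 - 20 p + 16] with
    [p = 2 `^ (1 + a)], has the roots 1 and 4, that is [a = -1] and [a = 1]. *)
Let odd_symbol : a < 1 -> 4 `^ (1 + a) * 4 + (- 10 * 2 `^ (1 + a)) * 2 + 16 * 1 != 0 :> R.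
Proof.
move=> al; have -> : 4 = 2 * 2 :> R by ring.
have mono (x y : R) : x < y -> 2 `^ x < 2 `^ y.
  by move=> xy; rewrite /powR gt_eqF// ltr_expR ltr_pM2r// ln_gt0// ltr1n.
rewrite powRM//; have p1 : 1 < 2 `^ (1 + a) :> R.
  by rewrite -[X in X < _](powRr0 2) mono// addr_gt0.
have p4 : 2 `^ (1 + a) < 4 :> R.
  have -> : 4 = 2 `^ 2 :> R by rewrite (powR_mulrn 2)//; ring.
  by rewrite mono//; lra.
move: (2 `^ _) p1 p4 => p p1 p4.
have -> : p * p * (2 * 2) + -10 * p * 2 + 16 * 1 = - (4 * ((p - 1) * (4 - p))) by ring.
by rewrite oppr_eq0 !mulf_neq0// subr_eq0 gt_eqF.
Qed.

(** Without mean the dispersion is at most of order [xi ^+ 3], and the damping of the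
    moment, of order [xi `^ (2 + a)], is the leading term. *)
Let sub_tight_moment s t : a < 1 -> 0 <= s -> s < t -> t <= T -> tight s -> tight t ->
  \int[mu]_(tau in `[s, t]) moment (v tau) = 0.
Proof.
move=> al s0 sltt tT hs ht; have M0 := tight_mean_zero s0 sltt tT hs ht.
pose S : R := 4 `^ (1 + a) * 4 + (- 10 * 2 `^ (1 + a)) * 2 + 16 * 1.
have da0 : 0 < 1 - a by rewrite subr_gt0.
pose r n tau := (4 `^ (1 + a) * ((xn n)^-1 * st (v tau) (4 * xn n))
    + (- 10 * 2 `^ (1 + a)) * ((xn n)^-1 * st (v tau) (2 * xn n))
    + 16 * ((xn n)^-1 * st (v tau) (1 * xn n)))
  + (-1) * (xn n `^ (1 - a) * (16 * ((xn n)^-1 * (ct (v tau) (4 * xn n) - ct (v tau) 0))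
    + (- 40) * ((xn n)^-1 * (ct (v tau) (2 * xn n) - ct (v tau) 0))
    + 16 * ((xn n)^-1 * (ct (v tau) (1 * xn n) - ct (v tau) 0))))
  + (-1) * (2^-1 * (xn n `^ (1 - a) * (xn n ^- 2 * odd_comb' (ct (fun x => v tau x ^+ 2)) (xn n)))).
have L : time_limit r (fun tau => S * moment (v tau)).
  have zs := comb_limit (4 `^ (1 + a)) (- 10 * 2 `^ (1 + a)) 16
    (time_limit_st tv (ler0n R 4)) (time_limit_st tv (ler0n R 2)) (time_limit_st tv (ler0n R 1)).
  have zc := comb_limit 16 (- 40) 16
    (time_limit_ct0 tv (ler0n R 4)) (time_limit_ct0 tv (ler0n R 2)) (time_limit_ct0 tv (ler0n R 1)).
  have z2 := time_limitM (xn_powR da0) (ex_intro _ 1 (b01_bounded (ltW da0))) zc.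
  have z3 : time_limit (fun n tau => 2^-1 * (xn n `^ (1 - a) *
      (xn n ^- 2 * odd_comb' (ct (fun x => v tau x ^+ 2)) (xn n)))) (fun=> 0).
    apply: (time_limit0 (b := fun n => xn n `^ (1 - a))); first exact: xn_powR.
    - by move=> n; rewrite powR_ge0 xn_powR_le1// ltW.
    - move=> n; do 3 apply: (continuous_mul (@continuous_cst _ _)).
      exact: odd_sqr_time.
    - exists (60 * K) => n tau; rewrite !normrM.
      rewrite [`|2^-1|]ger0_norm// [`|xn n ^- 2|]ger0_norm ?invr_ge0 ?sqr_ge0//.
      rewrite [`|_ `^ _|]ger0_norm ?powR_ge0//.
      have := odd_sqr tau (xn n); rewrite (ger0_norm (x_ge0 n)).
      move: `|odd_comb' _ _| => z hz.
      rewrite (_ : 60 * K * _ = 2^-1 * (xn n `^ (1 - a) * (120 * K))); last by field.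
      rewrite ler_wpM2l// ler_wpM2l ?powR_ge0// ler_pdivrMl ?exprn_gt0 ?xn_gt0//.
      by rewrite mulrC.
  have z := time_limitD (time_limitD zs (time_limitZ (-1) z2)) (time_limitZ (-1) z3).
  apply: time_limit_eq z => [n tau|tau]; first by [].
  by rewrite /S; ring.
have pE n : xn n `^ (2 + a) = xn n ^+ 2 * xn n `^ a :> R.
  by rewrite powRD ?x_neq0 ?implybT// powR_mulrn.
have H := time_limit_int (s := s) (t := t) L.
have mI : measurable (`[s, t]%classic : set (measurableTypeR R)) by [].
have E n : \int[mu]_(tau in `[s, t]) r n tau =
    odd_comb (st (v s)) (xn n) / xn n `^ (2 + a) - odd_comb (st (v t)) (xn n) / xn n `^ (2 + a).
  have -> : \int[mu]_(tau in `[s, t]) r n tau =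
      \int[mu]_(tau in `[s, t]) ((xn n `^ (2 + a))^-1 * odd_comb (sine_rate a v ^~ tau) (xn n)).
    apply: eq_Rintegral => tau; rewrite inE/= in_itv/= => h.
    rewrite /r sine_rate_comb M0// pE.
    have -> : xn n `^ (1 - a) = xn n * (xn n `^ a)^-1 :> R.
      by rewrite powRB ?x_neq0 ?implybT// powRr1.
    have := powR_gt0 a (xn_gt0 n : 0 < (xn n : R)) => /lt0r_neq0.
    move: (4 `^ _) (2 `^ _) (xn n `^ a) (odd_comb' _ _) (st _ _) (st _ _) (st _ _) => A B C D F G I C0.
    by field; rewrite C0 x_neq0.
  rewrite (RintegralZl _ mI (continuous_itv_integrable s t (@odd_time _))) odd_comb_increment//.
  by ring.
have H0 : (fun n => odd_comb (st (v s)) (xn n) / xn n `^ (2 + a) -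
    odd_comb (st (v t)) (xn n) / xn n `^ (2 + a)) @ \oo --> (0 - 0 : R).
  by apply: cvgB; exact: odd_little_o.
move: H; under eq_cvg do rewrite E.
move=> /(cvg_unique _ H0) => /(_ (@Rhausdorff R)).
rewrite subrr (RintegralZl _ mI (continuous_itv_integrable s t (moment_time tv))).
by move=> /esym/eqP; rewrite mulf_eq0 (negbTE (odd_symbol al)) => /eqP.
Qed.

(** For [a = 1] the odd combination annihilates the damping of the moment.  The
    even one sees the dispersion acting on the moment, with the value
    16 * 4 - 20 * 2 + 4 = 28, and annihilates the damping of the mean. *)
Let full_tight_moment s t : a = 1 -> 0 <= s -> s < t -> t <= T -> tight s -> tight t ->
  \int[mu]_(tau in `[s, t]) moment (v tau) = 0.
Proof.
move=> ae s0 sltt tT hs ht.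
have L : time_limit (fun n tau => xn n ^- 3 * even_comb (cosine_rate a v ^~ tau) (xn n))
    (fun tau => 28 * moment (v tau)).
  have zs := comb_limit 16 (- 20) 4
    (time_limit_st tv (ler0n R 4)) (time_limit_st tv (ler0n R 2)) (time_limit_st tv (ler0n R 1)).
  have zc := comb_limit 16 (- 20) 4
    (time_limit_ct0 tv (ler0n R 4)) (time_limit_ct0 tv (ler0n R 2)) (time_limit_ct0 tv (ler0n R 1)).
  have z3 : time_limit (fun n tau => 2^-1 * (xn n ^- 2 * even_comb' (st (fun x => v tau x ^+ 2)) (xn n))) (fun=> 0).
    apply: (time_limit0 (b := xn)); first exact: xn_cvg.
    - by move=> n; rewrite x_ge0 xn_le1.
    - move=> n; do 2 apply: (continuous_mul (@continuous_cst _ _)).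
      exact: even_sqr_time.
    - exists (17 * K) => n tau; rewrite !normrM.
      rewrite [`|2^-1|]ger0_norm// [`|xn n ^- 2|]ger0_norm ?invr_ge0 ?sqr_ge0//.
      have := even_sqr tau (xn n); rewrite (ger0_norm (x_ge0 n)).
      move: `|even_comb' _ _| => z hz.
      rewrite ler_pdivrMl// ler_pdivrMl ?exprn_gt0 ?xn_gt0//; apply: (le_trans hz).
      by rewrite le_eqVlt; apply/orP; left; apply/eqP; ring.
  have z := time_limitD (time_limitD zs zc) z3.
  apply: time_limit_eq z => [n tau|tau]; last by ring.
  rewrite cosine_rate_comb//.
  move: (even_comb' _ _) (st _ _) (st _ _) (st _ _) => A B C D.
  by field; exact: x_neq0.
have H := time_limit_int (s := s) (t := t) L.
have mI : measurable (`[s, t]%classic : set (measurableTypeR R)) by [].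
have pE n : xn n `^ (2 + a) = xn n ^+ 3 :> R.
  by rewrite ae (_ : 2 + 1 = 3%:R :> R); [rewrite powR_mulrn|ring].
have E n : \int[mu]_(tau in `[s, t]) (xn n ^- 3 * even_comb (cosine_rate a v ^~ tau) (xn n)) =
    even_comb (ct (v s)) (xn n) / xn n `^ (2 + a) - even_comb (ct (v t)) (xn n) / xn n `^ (2 + a).
  rewrite (RintegralZl _ mI (continuous_itv_integrable s t (@even_time _))) even_comb_increment// pE.
  by ring.
have H0 : (fun n => even_comb (ct (v s)) (xn n) / xn n `^ (2 + a) -
    even_comb (ct (v t)) (xn n) / xn n `^ (2 + a)) @ \oo --> (0 - 0 : R).
  by apply: cvgB; exact: even_little_o.
move: H; under eq_cvg do rewrite E.
move=> /(cvg_unique _ H0) => /(_ (@Rhausdorff R)).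
rewrite subrr (RintegralZl _ mI (continuous_itv_integrable s t (moment_time tv))).
by move=> /esym/eqP; rewrite mulf_eq0 pnatr_eq0 => /eqP.
Qed.

Lemma tight_moment s t : 0 <= s -> s < t -> t <= T -> tight s -> tight t ->
  \int[mu]_(tau in `[s, t]) moment (v tau) = 0.
Proof.
have [al|] := ltP a 1; first exact: sub_tight_moment.
by move=> ag; apply: full_tight_moment; apply/le_anti; rewrite a1 ag.
Qed.

End VanishingMoment.

(** * Extinction *)

Section Extinction.
Context {R : realType}.
Notation mu := (@lebesgue_measure R).
Implicit Types (f : R -> R) (x s t tau : R).

Lemma Rint_itv_ge f s t (c : R) : s < t -> continuous f -> (forall x, s <= x <= t -> c <= f x) ->
  (t - s) * c <= \int[mu]_(x in `[s, t]) f x.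
Proof.
move=> slt cf h; have muE : mu `[s, t]%classic = (t - s)%:E.
  by rewrite lebesgue_measure_itv/= lte_fin slt EFinB.
have mI : measurable (`[s, t]%classic : set (measurableTypeR R)) by [].
have -> : (t - s) * c = \int[mu]_(x in `[s, t]) c.
  by rewrite Rintegral_cst// [X in fine X]muE/= mulrC.
apply: (le_Rintegral mI); first exact: continuous_itv_integrable (@continuous_cst R c).
  exact: continuous_itv_integrable cf.
by move=> x; rewrite /= in_itv/=; exact: h.
Qed.

Lemma Rint_itv_le f s t (c : R) : s < t -> continuous f -> (forall x, s <= x <= t -> f x <= c) ->
  \int[mu]_(x in `[s, t]) f x <= (t - s) * c.
Proof.
move=> slt cf h; rewrite -lerN2 -Rint_itvN// -mulrN; apply: Rint_itv_ge => //.
  exact: continuous_opp.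
by move=> x xI; rewrite lerN2; exact: h.
Qed.

Lemma Rint_itv_npos f s p t : s < p -> p < t -> continuous f ->
  (forall x, p <= x <= t -> f x <= 0) ->
  \int[mu]_(x in `[s, t]) f x <= \int[mu]_(x in `[s, p]) f x.
Proof.
move=> sp pt cf h.
have L r q : L1 (fun x => \1_(`[r, q]%classic : set R) x * f x).
  have mI : measurable (`[r, q]%classic : set (measurableTypeR R)) by [].
  exact: (L1_indic mI (continuous_itv_integrable r q cf)).
rewrite (Rint_indic `[s, t]%classic f) (Rint_indic `[s, p]%classic f).
apply: (Rint_le (L _ _) (L _ _)) => x.
rewrite !indicE !mem_setE !in_itv/=; have [sx|] := leP s x; last by rewrite mul0r.
have [xp|px] := leP x p; first by rewrite (le_trans xp (ltW pt)).
by have [xt|] := leP x t; rewrite ?mul0r// mul1r h// (ltW px).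
Qed.

Lemma profile_energy0 f : profile f -> \int[mu]_x f x ^+ 2 = 0 -> forall x, f x = 0.
Proof.
move=> pf e0.
have l2 := profile_sqr_L1 pf.
have z : (\int[mu]_x `|(f x ^+ 2)%:E| = 0)%E.
  have -> : (\int[mu]_x `|(f x ^+ 2)%:E|)%E = (\int[mu]_x (f x ^+ 2)%:E)%E.
    by apply: eq_integral => x _; rewrite gee0_abs// lee_fin sqr_ge0.
  by have := L1E l2; rewrite e0.
have mf2 : measurable_fun setT (fun x => (f x ^+ 2)%:E) by have /integrableP[] := l2.
have ae0 := (ae_eq_integral_abs mu measurableT mf2).1 z.
have z0 (g : R -> R) : measurable_fun setT g -> \int[mu]_x (f x * g x) = 0.
  move=> mg; have mf := profile_measurable pf.
  rewrite /Rintegral (_ : integral _ _ _ = 0%E)//.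
  rewrite -(integral0 mu setT); apply: ae_eq_integral => //.
    by apply/measurable_EFinP; exact: measurable_funM.
  apply: filterS ae0 => x /(_ I) /= [/eqP]; rewrite sqrf_eq0 => /eqP -> _.
  by rewrite mul0r.
have mc (h : R -> R) xi : continuous h -> measurable_fun setT (fun x => h (x * xi)).
  move=> ch; apply: continuous_measurable_fun => x.
  apply: (@continuous_comp _ _ _ (fun x => x * xi) h); last exact: ch.
  exact: mulrr_continuous.
have c0 xi : ct f xi = 0 by apply: z0; apply: mc; exact: continuous_cos.
have s0 xi : st f xi = 0 by apply: z0; apply: mc; exact: continuous_sin.
move=> x; rewrite profile_synth// /synth.
under eq_Rintegral do rewrite c0 s0 !mulr0 addr0.
by rewrite Rintegral_cst// mul0r mulr0.
Qed.

Section Moments.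
Variables (a T K : R) (v : R -> R -> R).
Hypothesis a0 : 0 < a.
Hypothesis tv : trajectory K v.
Hypothesis mild : mild_trajectory a T v.

(** Since the moment is nondecreasing, a vanishing mean over two consecutive
    time intervals makes it vanish over the first one; there its rate of
    growth, half the energy, has mean zero as well. *)
Lemma extinction_time t1 t2 t3 : 0 <= t1 -> t1 < t2 -> t2 < t3 -> t3 <= T ->
  \int[mu]_(tau in `[t1, t2]) moment (v tau) = 0 ->
  \int[mu]_(tau in `[t2, t3]) moment (v tau) = 0 ->
  exists tau, [/\ t1 < tau, tau < t2 & forall x, v tau x = 0].
Proof.
move=> t10 t12 t23 t3T z12 z23; have cm := moment_time tv.
have t20 : 0 <= t2 by apply: le_trans (ltW t12).
have t2T : t2 <= T by apply: le_trans (ltW t23) _.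
have mono s t : 0 <= s -> s <= t -> t <= T -> moment (v s) <= moment (v t).
  move=> s0; rewrite le_eqVlt => /orP[/eqP <-//|st' tT].
  rewrite -subr_ge0 (moment_increment a0 tv mild)// mulr_ge0//.
  by apply: Rintegral_ge0 => tau _; apply: Rintegral_ge0 => x _; exact: sqr_ge0.
(* The mean over the second interval is at least the value at its start. *)
have m2 : moment (v t2) <= 0.
  have := @Rint_itv_ge _ t2 t3 (moment (v t2)) t23 cm; rewrite z23 pmulr_rle0 ?subr_gt0//.
  by apply => x /andP[h1 h2]; apply: mono => //; exact: le_trans t3T.
have mz tau : t1 < tau -> tau < t2 -> moment (v tau) = 0.
  move=> h1 h2; have p0 : 0 <= tau by apply: le_trans (ltW h1).
  apply/le_anti; rewrite (le_trans (mono _ _ p0 (ltW h2) t2T) m2)/=.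
  have zt : 0 <= \int[mu]_(x in `[t1, tau]) moment (v x).
    rewrite -[X in X <= _]z12; apply: Rint_itv_npos => // x /andP[x1 x2].
    by apply: le_trans m2; apply: mono => //; exact: le_trans x1.
  have d0 : 0 < tau - t1 by rewrite subr_gt0.
  rewrite -(pmulr_rge0 _ d0); apply: (le_trans zt).
  apply: (@Rint_itv_le _ t1 tau (moment (v tau)) h1 cm) => x /andP[x1 x2].
  apply: mono => //; first exact: le_trans x1.
  exact: le_trans (ltW h2) t2T.
(* An interval inside the open first one, so that the time found is not an
   end point. *)
pose p := (2 * t1 + t2) / 3; pose q := (t1 + 2 * t2) / 3.
have tp : t1 < p by rewrite /p; lra.
have pq : p < q by rewrite /p /q; lra.
have qt : q < t2 by rewrite /q; lra.
have p0 : 0 <= p by apply: le_trans (ltW tp).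
have ce := energy_time tv.
have e0 : \int[mu]_(tau in `[p, q]) \int[mu]_x v tau x ^+ 2 = 0.
  have := moment_increment a0 tv mild p0 pq (le_trans (ltW qt) t2T).
  rewrite (mz q (lt_trans tp pq) qt) (mz p tp (lt_trans pq qt)) subrr.
  by move/esym/eqP; rewrite mulf_eq0 invr_eq0 pnatr_eq0 => /eqP.
have [c cI hc] := EVT_min (ltW pq) (continuous_subspaceT ce).
move: cI; rewrite in_itv/= => /andP[pc cq].
exists c; split; [exact: lt_le_trans pc|exact: le_lt_trans qt|].
apply: (profile_energy0 (tr_profile tv c)); apply/le_anti/andP; split; last first.
  by apply: Rintegral_ge0 => x _; exact: sqr_ge0.
have := @Rint_itv_ge _ p q (\int[mu]_x v c x ^+ 2) pq ce.
rewrite e0 pmulr_rle0 ?subr_gt0//; apply => x xI; apply: hc.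
by rewrite in_itv.
Qed.

End Moments.
End Extinction.

(** * The function space *)

Section FunctionSpaces.
Context {R : realType}.
Notation mu := (@lebesgue_measure R).
Implicit Types (f g : R -> R) (x xi s t tau : R).
Local Open Scope complex_scope.

Lemma japanese_ge0 x : 0 <= japanese x.
Proof. exact: sqrtr_ge0. Qed.

Lemma japanese_pow2 x : japanese x `^ 2 = 1 + x ^+ 2.
Proof. by rewrite (powR_mulrn 2) ?japanese_ge0// sqr_sqrtr// addr_ge0// sqr_ge0. Qed.

Lemma fourierE f xi : L1 f -> fourier f xi = ct f xi +i* (- st f xi).
Proof.
move=> lf; rewrite /fourier /Cintegral; congr (_ +i* _).
  by apply: eq_Rintegral => x _; rewrite /= expR0 cosN !mul1r mulr0 subr0 (mulrC xi x); ring.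
rewrite -mulN1r -RintZ; last exact: L1_sin.
by apply: eq_Rintegral => x _; rewrite /= expR0 sinN !mul1r mulr0 add0r (mulrC xi); ring.
Qed.

Lemma weighted_sqr f x : weighted 2 f x ^+ 2 = bracket4 x * f x ^+ 2.
Proof. by rewrite /weighted japanese_pow2 exprMn. Qed.

Lemma sobolev_density_sqr f xi : L1 f ->
  sobolev_density 2 f xi ^+ 2 = bracket4 xi * (ct f xi ^+ 2 + st f xi ^+ 2).
Proof.
move=> lf; rewrite /sobolev_density japanese_pow2 exprMn fourierE//= sqr_sqrtr ?sqrrN//.
by rewrite addr_ge0// sqr_ge0.
Qed.

Lemma Zspace_profile f : continuous f -> Zspace 2 2 f -> profile f.
Proof.
move=> cf [_ /Lfun2_integrable_sqr hs /Lfun2_integrable_sqr hw].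
have lw : L1 (fun x => bracket4 x * f x ^+ 2).
  by move: hw; congr (mu.-integrable setT); apply/funext => x /=; rewrite weighted_sqr.
have [lf _ _ _] := weight_L1 (continuous_measurable_fun cf) lw ltr01.
split => //.
by move: hs; congr (mu.-integrable setT); apply/funext => x /=; rewrite sobolev_density_sqr.
Qed.

Lemma Lnorm2_sqr f : L1 (fun x => f x ^+ 2) ->
  ('N[mu]_2%:E[EFin \o f] ^+ 2 = (\int[mu]_x (f x ^+ 2))%:E)%E.
Proof.
move=> lf.
have n0 : (0 <= 'N[mu]_2%:E[EFin \o f])%E by exact: Lnorm_ge0.
have pE (y : \bar R) : (0 <= y -> y ^+ 2 = y `^ 2)%E.
  case: y => [r||//]; last by move=> _; rewrite poweRyr ?pnatr_eq0// expe2 mulyy.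
  by rewrite lee_fin => r0; rewrite poweR_EFin (powR_mulrn 2)// EFin_expe.
rewrite pE// powR_Lnorm// -(L1E lf); apply: eq_integral => x _ /=.
by rewrite (powR_mulrn 2)// real_normK ?num_real.
Qed.

Lemma Znorm_mass f : L1 f -> L1 (fun x => bracket4 x * f x ^+ 2) ->
  L1 (fun xi => bracket4 xi * (ct f xi ^+ 2 + st f xi ^+ 2)) ->
  Znorm 2 2 f = ((smass f + mass f) `^ 2^-1)%:E.
Proof.
move=> lf lw ls; rewrite /Znorm !Lnorm2_sqr.
- rewrite -EFinD poweR_EFin; congr (((_ + _) `^ _)%:E).
    by apply: eq_Rintegral => x _; rewrite sobolev_density_sqr.
  by apply: eq_Rintegral => x _; rewrite weighted_sqr.
- by move: lw; congr L1; apply/funext => x; rewrite weighted_sqr.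
- by move: ls; congr L1; apply/funext => x; rewrite sobolev_density_sqr.
Qed.

Lemma ct_sub f g xi : L1 f -> L1 g -> ct (f \- g) xi = ct f xi - ct g xi.
Proof.
move=> lf lg; rewrite /ct -RintB; [|exact: L1_cos|exact: L1_cos].
by apply: eq_Rintegral => x _; rewrite -mulrBl.
Qed.

Lemma st_sub f g xi : L1 f -> L1 g -> st (f \- g) xi = st f xi - st g xi.
Proof.
move=> lf lg; rewrite /st -RintB; [|exact: L1_sin|exact: L1_sin].
by apply: eq_Rintegral => x _; rewrite -mulrBl.
Qed.

Lemma profile_sub f g : profile f -> profile g -> profile (f \- g).
Proof.
move=> pf pg; have lf := profile_L1 pf; have lg := profile_L1 pg.
have cS (h1 h2 : R -> R) : continuous h1 -> continuous h2 -> continuous (h1 \- h2).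
  by move=> c1 c2; exact: continuous_sub.
split; [exact: cS (profile_cont pf) (profile_cont pg)|exact: profile_diff_weight|].
have cE xi := ct_sub xi lf lg; have sE xi := st_sub xi lf lg.
have cc (h : R -> R) : profile h -> continuous (ct h) /\ continuous (st h).
  move=> ph; split; first exact: ct_continuous (profile_L1 ph) (profile_moment ph).
  exact: st_continuous (profile_L1 ph) (profile_moment ph).
have [cf sf] := cc f pf; have [cg sg] := cc g pg.
apply: L1_dom (L1D (L1Z 2 (profile_sobolev pf)) (L1Z 2 (profile_sobolev pg))).
  under eq_fun do rewrite cE sE.
  apply: continuous_measurable_fun; apply: (continuous_mul continuous_bracket4).
  have cX (h : R -> R) : continuous h -> continuous (fun x => h x ^+ 2).
    by move=> ch; under eq_fun do rewrite expr2; exact: continuous_mul.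
  exact: (continuous_add (cX _ (cS _ _ cf cg)) (cX _ (cS _ _ sf sg))).
move=> xi; have b0 := ltW (bracket4_gt0 xi); rewrite cE sE.
rewrite ger0_norm; last by rewrite mulr_ge0// addr_ge0// sqr_ge0.
rewrite [2 * (_ * _)]mulrCA [2 * (_ * (ct g _ ^+ 2 + _))]mulrCA -mulrDr ler_wpM2l//.
have := sqr_ge0 (ct f xi + ct g xi); have := sqr_ge0 (st f xi + st g xi).
by rewrite !sqrrB !sqrrD; lra.
Qed.

Let Rint_le2 (h1 h2 h3 : R -> R) : L1 h1 -> L1 h2 -> L1 h3 ->
  (forall x, h1 x <= 2 * h2 x + 2 * h3 x) ->
  \int[mu]_x h1 x <= 2 * \int[mu]_x h2 x + 2 * \int[mu]_x h3 x.
Proof.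
move=> l1 l2 l3 le123; rewrite -(RintZ 2 l2) -(RintZ 2 l3) -(RintD (L1Z 2 l2) (L1Z 2 l3)).
by apply: Rint_le => //; apply: L1D; exact: L1Z.
Qed.

Lemma mass_triangle f g : profile f -> profile g ->
  mass f + smass f <= 2 * (mass g + smass g) + 2 * (mass (f \- g) + smass (f \- g)).
Proof.
move=> pf pg; have pd := profile_sub pf pg.
have lf := profile_L1 pf; have lg := profile_L1 pg.
have cE xi := ct_sub xi lf lg; have sE xi := st_sub xi lf lg.
have h1 : mass f <= 2 * mass g + 2 * mass (f \- g).
  apply: (Rint_le2 (profile_weight pf) (profile_weight pg) (profile_weight pd)) => x.
  rewrite [2 * (_ * _)]mulrCA [2 * (_ * (_ \- _) x ^+ 2)]mulrCA -mulrDr ler_wpM2l//.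
    exact: ltW (bracket4_gt0 x).
  by have := sqr_ge0 (f x - g x - g x); rewrite /= !sqrrB; lra.
have h2 : smass f <= 2 * smass g + 2 * smass (f \- g).
  apply: (Rint_le2 (profile_sobolev pf) (profile_sobolev pg) (profile_sobolev pd)) => xi.
  rewrite [2 * (_ * _)]mulrCA [2 * (_ * (ct (_ \- _) xi ^+ 2 + _))]mulrCA -mulrDr ler_wpM2l//.
    exact: ltW (bracket4_gt0 xi).
  rewrite cE sE; have := sqr_ge0 (ct f xi - ct g xi - ct g xi).
  by have := sqr_ge0 (st f xi - st g xi - st g xi); rewrite !sqrrB; lra.
move: (mass f) (mass g) (mass _) (smass f) (smass g) (smass _) h1 h2 => A B C D E F h1 h2.
by lra.
Qed.

Lemma smass_ge0 f : 0 <= smass f.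
Proof.
by apply: Rintegral_ge0 => xi _; rewrite mulr_ge0 ?addr_ge0 ?sqr_ge0 ?ltW ?bracket4_gt0.
Qed.

Section ReflectedCurve.
Variables (T : R) (u : R -> R -> R).
Hypothesis T0 : 0 < T.
Hypothesis uZ : continuous_in_Z T 2 2 u.
Hypothesis uc : forall t, t \in `[0, T] -> continuous (u t).

(** The curve on [0, T] is continued to all times by reflection at 0 and by
    its final value. *)
Definition clamp t : R := Num.min `|t| T.
Definition reflected t := u (clamp t).

Let clampI t : clamp t \in `[0, T].
Proof. by rewrite in_itv/= le_min normr_ge0 (ltW T0) ge_min lexx orbT. Qed.

Lemma clampE t : 0 <= t <= T -> clamp t = t.
Proof. by move=> /andP[h1 h2]; rewrite /clamp ger0_norm// min_l. Qed.

Let clamp_continuous : continuous clamp.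
Proof.
move=> t; apply: (@continuous_min R R (fun t => `|t|) (fun=> T) t).
  exact: norm_continuous.
exact: cvg_cst.
Qed.

Let pu t : t \in `[0, T] -> profile (u t).
Proof. by move=> tI; apply: Zspace_profile; [exact: uc|have [h _] := uZ; exact: h]. Qed.

Let near_u t0 (e : R) : 0 < e -> t0 \in `[0, T] -> \forall t \near t0, t \in `[0, T] ->
  mass (u t \- u t0) + smass (u t \- u t0) <= e.
Proof.
move=> e0 t0I; have [_ /(_ t0 t0I) h] := uZ.
have d0 : 0 < e `^ 2^-1 by exact: powR_gt0.
have hn : \forall t \near t0, t \in `[0, T] -> (Znorm 2 2 (u t \- u t0)%R < (e `^ 2^-1)%:E)%E.
  apply: (h [set y | (y < (e `^ 2^-1)%:E)%E]).
  exact: (lt_nbhsl d0).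
apply: (filterS _ hn) => t ht tI; have {ht} := ht tI.
have pd := profile_sub (pu tI) (pu t0I).
rewrite (Znorm_mass (profile_L1 pd) (profile_weight pd) (profile_sobolev pd)) lte_fin (addrC (smass _)).
have := addr_ge0 (mass_ge0 (u t \- u t0)) (smass_ge0 (u t \- u t0)).
move: (mass _ + smass _) => z z0; rewrite (leNgt z); apply: contraTN => ez.
rewrite -leNgt; apply: ge0_ler_powR; rewrite ?nnegrE ?(ltW e0) ?(ltW ez)//.
Qed.

(** Continuity bounds the norms locally in time, and [0, T] is compact. *)
Lemma reflected_trajectory : exists K, trajectory K reflected.
Proof.
have [K hK] : exists K, forall t, t \in `[0, T] -> mass (u t) + smass (u t) <= K.
  have := @segment_compact R 0 T; rewrite compact_near_coveringP => /(_ R +oo%R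
    (fun K t => t \in `[0, T] -> mass (u t) + smass (u t) <= K)) hc.
  have [|K [_ h]] := hc _.
    move=> t tI; exists ([set s | s \in `[0, T] -> mass (u s \- u t) + smass (u s \- u t) <= 1],
        [set K | 2 * (mass (u t) + smass (u t)) + 2 * 1 <= K]).
      split => /=; first exact: near_u ltr01 tI.
      exact: nbhs_pinfty_ge (num_real _).
    move=> [s K] [/= hs hK] sI; apply: le_trans hK.
    apply: (le_trans (mass_triangle (pu sI) (pu tI))).
    by rewrite lerD2l ler_wpM2l// hs.
  by exists (K + 1) => t tI; apply: (h (K + 1)); rewrite ?ltrDl.
exists K; split.
- by move=> t; exact: pu (clampI t).
- by move=> t; rewrite /reflected /clamp normr_id.
- by move=> t; apply: le_trans (hK _ (clampI t)); rewrite lerDl smass_ge0.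
- by move=> t; apply: le_trans (hK _ (clampI t)); rewrite lerDr mass_ge0.
- move=> t e e0.
  have hn : \forall s \near t, clamp s \in `[0, T] ->
      mass (u (clamp s) \- u (clamp t)) + smass (u (clamp s) \- u (clamp t)) <= e.
    exact: clamp_continuous (near_u e0 (clampI t)).
  apply: (filterS _ hn) => s /(_ (clampI s)); apply: le_trans.
  by rewrite lerDl smass_ge0.
Qed.

End ReflectedCurve.
End FunctionSpaces.

(** * Mild solutions *)

Section MildSolutions.
Context {R : realType}.
Notation mu := (@lebesgue_measure R).
Implicit Types (f : R -> R) (x xi s t tau : R).
Local Open Scope complex_scope.

Lemma Re_U (a r : R) f x : L1 f -> complex.Re (U a r f x) =
  (2 * pi)^-1 * synth (flowC a r (ct f) (st f)) (flowS a r (ct f) (st f)) x.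
Proof.
move=> lf; rewrite /U; have -> : fourier f = fun xi => ct f xi +i* (- st f xi).
  by apply/funext => xi; exact: fourierE.
rewrite /inv_fourier /Cintegral /= mul0r subr0; congr (_ * _).
apply: eq_Rintegral => xi _; rewrite /= expR0 !mul1r /flowC /flowS /damp /disp cosN sinN.
by move: (expR _) (cos _) (sin _) (cos _) (sin _) => A B C D E; ring.
Qed.

Lemma weighted_tail (a : R) f : continuous f ->
  weighted (5 / 2 + a) f \in Lfun mu 2%:E -> 0 < a -> L1 (fun x => `|x| `^ (5 + 2 * a) * f x ^+ 2).
Proof.
move=> cf /Lfun2_integrable_sqr h a0; apply: L1_dom h.
  apply: measurable_funM; last first.
    by apply: measurable_funX; exact: continuous_measurable_fun.
  apply: continuous_measurable_fun; apply: powR_abs_continuous.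
  by rewrite addr_gt0// mulr_gt0.
move=> x; rewrite (ger0_norm (mulr_ge0 (powR_ge0 _ _) (sqr_ge0 _))).
rewrite /= /weighted exprMn ler_wpM2r ?sqr_ge0//.
have -> : 5 + 2 * a = (5 / 2 + a) * 2 by field.
rewrite powRrM (powR_mulrn 2) ?powR_ge0//.
rewrite ler_sqr ?nnegrE ?powR_ge0//; apply: ge0_ler_powR; rewrite ?nnegrE ?japanese_ge0//.
  by rewrite addr_ge0// ltW.
by rewrite -sqrtr_sqr ler_sqrt ?lerDr// addr_ge0// sqr_ge0.
Qed.

Lemma reflected_mild (a T K : R) (phi : R -> R) (u : R -> R -> R) : 0 < T -> mild_solution a T phi u ->
  trajectory K (reflected T u) -> mild_trajectory a T (reflected T u).
Proof.
move=> T0 [u0 hu] tv t x tI; have pv := tr_profile tv.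
have E s : 0 <= s <= T -> reflected T u s = u s by move=> sI; rewrite /reflected clampE.
have ReB (z w : R[i]) : complex.Re (z - w) = complex.Re z - complex.Re w by case: z w => ? ? [].
have E0 : reflected T u 0 = phi by rewrite E ?lexx ?ltW.
have lphi : L1 phi by rewrite -E0; exact: profile_L1.
have -> : reflected T u t x = complex.Re ((u t x)%:C) by rewrite E.
rewrite (hu t x _) ?in_itv// ReB (Re_U _ _ _ lphi) E0; congr (_ - _).
transitivity (\int[mu]_(tau in `[0%R, t])
    complex.Re (U a (t - tau) (fun y => 2^-1 * derive1 (fun z => u tau z ^+ 2) y) x)); first by [].
apply: eq_Rintegral => tau; rewrite inE/= in_itv/= => /andP[h1 h2].
have tauI : 0 <= tau <= T by rewrite h1 (le_trans h2)//; case/andP: tI.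
rewrite -[LHS]/(complex.Re (U a (t - tau) (fun y => 2^-1 * derive1 (fun z => u tau z ^+ 2) y) x)).
have -> : (fun y => 2^-1 * derive1 (fun z => u tau z ^+ 2) y) =
    (fun y => reflected T u tau y * dprofile (reflected T u tau) y).
  by apply/funext => y; rewrite -(E tau tauI) profile_sqr_derive// mulKf ?pnatr_eq0.
rewrite (Re_U _ _ _ (profile_dprofile_L1 (pv tau))).
have cE : ct (fun y => reflected T u tau y * dprofile (reflected T u tau) y) = FA (reflected T u) tau.
  by apply/funext => xi; exact: (ct_nonlinear tv).
have sE : st (fun y => reflected T u tau y * dprofile (reflected T u tau) y) = FB (reflected T u) tau.
  by apply/funext => xi; exact: (st_nonlinear tv).
by rewrite cE sE.
Qed.

End MildSolutions.

(** * Decay at three times *)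

Theorem theorem1p3 (R : realType) (a T : R) (phi : R -> R) (u : R -> R -> R)
    (ha0 : 0 < a) (ha1 : a <= 1) (hT : 0 < T)
    (huZ : continuous_in_Z T 2 2 u)
    (* elements of H^2 are identified with their continuous representatives *)
    (hucont : forall t, t \in `[0, T] -> continuous (u t))
    (husol : mild_solution a T phi u)
    (t1 t2 t3 : R) (h1 : 0 <= t1) (h12 : t1 < t2) (h23 : t2 < t3) (h3 : t3 <= T)
    (hZ1 : Zspace (5 / 2 + a) (5 / 2 + a) (u t1))
    (hZ2 : Zspace (5 / 2 + a) (5 / 2 + a) (u t2))
    (hZ3 : Zspace (5 / 2 + a) (5 / 2 + a) (u t3)) :
  exists tbar : R, [/\ t1 < tbar, tbar < t2 &
    forall t x, tbar <= t <= T -> u t x = 0].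
Proof.
have [K tv] := reflected_trajectory hT huZ hucont.
have mild := reflected_mild hT husol tv.
have E t : 0 <= t <= T -> reflected T u t = u t by move=> tI; rewrite /reflected clampE.
have tail t : 0 <= t <= T -> Zspace (5 / 2 + a) (5 / 2 + a) (u t) -> tight a (reflected T u) t.
  move=> tI [_ _ hw]; rewrite /tight E//; apply: weighted_tail => //.
  by apply: hucont; rewrite in_itv.
have t20 : 0 <= t2 by apply: le_trans (ltW h12).
have t2T : t2 <= T by apply: le_trans (ltW h23) h3.
have t1T : t1 <= T by apply: le_trans (ltW h12) t2T.
have t30 : 0 <= t3 by apply: le_trans (ltW h23).
have k1 : tight a (reflected T u) t1 by apply: tail; rewrite ?h1.
have k2 : tight a (reflected T u) t2 by apply: tail; rewrite ?t20.
have k3 : tight a (reflected T u) t3 by apply: tail; rewrite ?t30.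
have [tau [r1 r2 z]] := extinction_time ha0 tv mild h1 h12 h23 h3
  (tight_moment ha0 ha1 tv mild h1 h12 t2T k1 k2)
  (tight_moment ha0 ha1 tv mild t20 h23 h3 k2 k3).
have tau0 : 0 <= tau by apply: le_trans (ltW r1).
exists tau; split=> // t x tI; rewrite -E.
  exact: (forward_uniqueness ha0 tv mild tau0 z).
by case/andP: tI => q1 ->; rewrite (le_trans tau0 q1).
Qed.
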